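(* Let $\mathcal{T}$ be a positive linear form on $\mathcal{L}_{n,m}$ and let $0\le d\le n$. The following are equivalent. (1) (Bernstein–Szegő condition) There exists $p\in\mathbb{C}[z,w]$ with no zeros on $\mathbb{T}\times\overline{\mathbb{D}}$, degree at most $(n,m)$, and where $p(z,0)$ has $d$ zeros in $\mathbb{D}$, such that $$\mathcal{T}(z^jw^k)=\int_{\mathbb{T}^2} z^jw^k\,\frac{|dz||dw|}{(2\pi)^2|p(z,w)|^2}\qquad\text{for all } |j|\le n,\ |k|\le m.$$ (2) (Split-shift condition) There exist subspaces $\mathcal{K}_1,\mathcal{K}_2\subset\mathcal{H}_{\mathcal T}$ with $\mathcal{E}^1_{n-1,m}=\mathcal{K}_1\oplus\mathcal{K}_2$, $\mathcal{K}_1\perp z\mathcal{K}_2$, $\mathcal{K}_1,\ z\mathcal{K}_2\subset\mathcal{E}^1_{n,m}$, and $\dim\mathcal{K}_1=d$. (3) (Matrix condition) The invariant subspace of $T$ generated by the range of $B$ is contained in the kernel of $A$ (i.e. $AT^jB=0$ for $j=0,\dots,n-1$), and $$\dim\mathcal{A}\le d\le n-\dim\mathcal{B}.$$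
   Context: $\mathbb{D}=\{|z|<1\}$, $\mathbb{T}=\partial\mathbb{D}$; $n,m$ are nonnegative integers and $d$ is an integer. Zeros are counted with multiplicity. $\mathcal{L}_{j,k}$ is the complex span of $z^sw^t$, $-j\le s\le j$, $-k\le t\le k$, and $\mathcal{P}_{j,k}$ the complex span of $z^sw^t$, $0\le s\le j$, $0\le t\le k$ (with $\mathcal{P}_{j,k}=\{0\}$ if $j<0$ or $k<0$). Degree at most $(n,m)$ means membership in $\mathcal{P}_{n,m}$. For a polynomial $g$, $\bar g(z,w)=\overline{g(\bar z,\bar w)}$. A linear form $\mathcal{T}:\mathcal{L}_{n,m}\to\mathbb{C}$ is positive if $\mathcal{T}(f(z,w)\bar f(1/z,1/w))>0$ for all nonzero $f\in\mathcal{P}_{n,m}$. $\mathcal{H}_{\mathcal T}$ is $\mathcal{P}_{n,m}$ with inner product $\langle f,g\rangle_{\mathcal T}=\mathcal{T}(f(z,w)\bar g(1/z,1/w))$; all orthogonality, orthogonal direct sums, complements and orthogonal projections $P_{\mathcal M}$ are in $\mathcal{H}_{\mathcal T}$. Put $\mathcal{E}^1_{k,l}=\mathcal{P}_{k,l}\ominus w\mathcal{P}_{k,l-1}$, $\mathcal{E}^2_{k,l}=\mathcal{P}_{k,l}\ominus z\mathcal{P}_{k-1,l}$, $\mathcal{F}^2_{k,l}=\mathcal{P}_{k,l}\ominus\mathcal{P}_{k-1,l}$. Operators ($M_z$ is multiplication by $z$): $A=P_{w\mathcal{E}^2_{n,m-1}}M_z:\mathcal{E}^1_{n-1,m}\to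 w\mathcal{E}^2_{n,m-1}$; $B=P_{\mathcal{E}^1_{n-1,m}}:w\mathcal{F}^2_{n,m-1}\to\mathcal{E}^1_{n-1,m}$; $T=P_{\mathcal{E}^1_{n-1,m}}M_z:\mathcal{E}^1_{n-1,m}\to\mathcal{E}^1_{n-1,m}$; $A^*,T^*$ are the adjoints. Finally $\mathcal{A}=\mathrm{span}\{(T^* )^jA^*f: f\in w\mathcal{E}^2_{n,m-1},\ j\ge0\}$ and $\mathcal{B}=\mathrm{span}\{T^jBf: f\in w\mathcal{F}^2_{n,m-1},\ j\ge0\}$. *)

(* Defs.v *)
From HB Require Import structures.
From mathcomp Require Import all_boot all_order all_algebra.
From mathcomp Require Import all_classical all_reals all_analysis.
From mathcomp Require Import complex ring lra.

Set Implicit Arguments.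
Unset Strict Implicit.
Unset Printing Implicit Defensive.

Import Order.TTheory GRing.Theory Num.Theory.

Local Open Scope ring_scope.

Section VectorSpaces.
Variables (F : fieldType) (V : vectType F).
Implicit Types (S : set V) (U W : {vspace V}) (t : 'End(V)).

Definition is_least (P : {vspace V} -> Prop) W :=
  P W /\ forall W', P W' -> (W <= W')%VS.

(* [vspan S] is the linear span of an arbitrary, possibly infinite, set [S];
   [invspace t U] is the invariant subspace of [t] generated by [U].  Both
   exist and are unique: see [vspanP] and [invspaceP]. *)
Definition vspan S : {vspace V} :=
  xget 0%VS (is_least (fun W => forall x, S x -> x \in W)).

Definition invspace t U : {vspace V} :=
  xget 0%VS (is_least (fun W => (U <= W)%VS && (t @: W <= W)%VS)).

Lemma least_ex (P : {vspace V} -> Prop) :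
  P fullv -> (forall U W, P U -> P W -> P (U :&: W)%VS) ->
  exists W, is_least P W.
Proof.
move=> Pf PI.
have [k] := ubnP (\dim (fullv : {vspace V})).
elim: k fullv Pf => // k IH U PU leUk.
have [lU|] := pselect (forall W, P W -> (U <= W)%VS); first by exists U.
move/existsNP => [W /not_implyP[PW /negP nUW]].
apply: (IH (U :&: W)%VS (PI _ _ PU PW)).
rewrite -ltnS; apply: leq_trans leUk; rewrite ltnS ltn_neqAle dimvS ?capvSl// andbT.
apply: contra nUW => /eqP eqd; apply/capv_idPl/eqP.
by rewrite eqEdim capvSl eqd leqnn.
Qed.

Lemma vspanP S : is_least (fun W => forall x, S x -> x \in W) (vspan S).
Proof.
apply: xgetPex; apply: least_ex => [x _|U W SU SW x Sx]; first exact: memvf.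
by rewrite memv_cap SU ?SW.
Qed.

Lemma invspaceP t U :
  is_least (fun W => (U <= W)%VS && (t @: W <= W)%VS) (invspace t U).
Proof.
apply: xgetPex; apply: least_ex => [|W1 W2]; first by rewrite !subvf.
move=> /andP[U1 t1] /andP[U2 t2]; rewrite !subv_cap U1 U2 /=.
by rewrite (subv_trans (limgS _ (capvSl _ _)) t1)
           (subv_trans (limgS _ (capvSr _ _)) t2).
Qed.

End VectorSpaces.

Section DotSpaces.
Variables (C : numClosedFieldType) (V : vectType C).
Variable form : {dot V for Num.conj}.
Implicit Types M N U W : {vspace V}.

Definition ominus M N : {vspace V} := (M :&: orthov form N)%VS.

Definition vincl M : 'Hom(subvs_of M, V) := linfun vsval.

(* The orthogonal projection P_M, with codomain M. *)
Definition oproj M : 'Hom(V, subvs_of M) :=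
  (linfun (vsproj M) \o daddv_pi M (orthov form M))%VF.

Definition is_adjoint U W (A : 'Hom(subvs_of U, subvs_of W))
    (B : 'Hom(subvs_of W, subvs_of U)) :=
  forall f g, form (vsval (A f)) (vsval g) = form (vsval f) (vsval (B g)).

(* Exists and is unique: see [adjointP] and [is_adjoint_inj]. *)
Definition adjoint U W (A : 'Hom(subvs_of U, subvs_of W)) :
    'Hom(subvs_of W, subvs_of U) :=
  xget 0 (is_adjoint A).

Lemma oprojP M f :
  f - vsval (oproj M f) \in orthov form M.
Proof.
have M0 : (M :&: orthov form M = 0)%VS.
  apply/eqP; rewrite -subv0; apply/subvP => x; rewrite memv_cap => /andP[xM].
  by move=> /mem_orthovP/(_ _ xM)/eqP; rewrite dnorm_eq0 memv0.
have addM : (M + orthov form M = fullv)%VS.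
  apply/eqP; rewrite eqEdim subvf /= dimv_disjoint_sum// /orthov.
  pose psi := linfun (fun u : V =>
    \row_(i < \dim M) (form u (vbasis M)`_i : C^o)).
  have psiE u : psi u = \row_(i < \dim M) (form u (vbasis M)`_i).
    pose p0 := fun u : V => \row_(i < \dim M) (form u (vbasis M)`_i : C^o).
    have lp0 : linear p0.
      move=> a x y; apply/rowP => i; rewrite !mxE.
      by rewrite linearDl linearZl_LR.
    pose p1 := GRing.isLinear.Build _ _ _ _ p0 lp0.
    pose p : {linear V -> 'rV[C^o]_(\dim M)} := HB.pack p0 p1.
    exact: (lfunE p u).
  have kerE : (lker psi <= orthov form M)%VS.
    apply/subvP => u; rewrite memv_ker psiE => /eqP/rowP u0.
    apply/mem_orthovP => v /coord_vbasis ->; rewrite linear_sumr big1// => i _.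
    by rewrite linearZr_LR /=; move: (u0 i); rewrite !mxE => ->; rewrite mulr0.
  have := limg_ker_dim psi fullv; rewrite capfv => <-.
  rewrite addnC leq_add ?dimvS//.
  by apply: leq_trans (dimvS (subvf _)) _; rewrite dimvf /dim /= mul1n.
have /= piE := daddv_pi_add M0 (_ : f \in (M + orthov form M)%VS).
rewrite /oproj comp_lfunE lfunE /= vsprojK ?memv_pi//.
by rewrite -{1}piE ?addM ?memvf// addrC addKr memv_pi.
Qed.

Lemma is_adjoint_inj U W (A : 'Hom(subvs_of U, subvs_of W)) B1 B2 :
  is_adjoint A B1 -> is_adjoint A B2 -> B1 = B2.
Proof.
move=> h1 h2; apply/lfunP => g; apply/eqP; rewrite -subr_eq0.
have h (f : subvs_of U) : form (vsval f) (vsval (B1 g - B2 g)) = 0.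
  by rewrite !linearB /= -h1 -h2 subrr.
by move/eqP: (h (B1 g - B2 g)); rewrite dnorm_eq0 => /eqP x0; apply/eqP/subvs_inj.
Qed.

Lemma adjointP U W (A : 'Hom(subvs_of U, subvs_of W)) :
  is_adjoint A (adjoint A).
Proof.
apply: xgetPex.
pose e := vbasis (fullv : {vspace subvs_of U}).
pose k := \dim (fullv : {vspace subvs_of U}).
have lin (Y : {vspace V}) (a : 'I_k -> V) :
    linear (fun u : subvs_of Y => \row_(i < k) (form (vsval u) (a i) : C^o)).
  move=> c x y; apply/rowP => i; rewrite !mxE.
  by rewrite linearD linearZ /= linearDl linearZl_LR.
pose p0 u := \row_(i < k) (form (vsval (u : subvs_of U)) (vsval e`_i) : C^o).
pose q0 u := \row_(i < k) (form (vsval (u : subvs_of W)) (vsval (A e`_i)) : C^o).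
have lp0 : linear p0 := lin _ _.
have lq0 : linear q0 := lin _ _.
pose p1 := GRing.isLinear.Build _ _ _ _ p0 lp0.
pose q1 := GRing.isLinear.Build _ _ _ _ q0 lq0.
pose p : {linear subvs_of U -> 'rV[C^o]_k} := HB.pack p0 p1.
pose q : {linear subvs_of W -> 'rV[C^o]_k} := HB.pack q0 q1.
have kp : lker (linfun p) == 0%VS.
  rewrite -subv0; apply/subvP => u; rewrite memv_ker lfunE => /eqP/rowP u0.
  rewrite memv0; suff : form (vsval u) (vsval u) == 0.
    by rewrite dnorm_eq0 => /eqP x0; apply/eqP/subvs_inj.
  rewrite {2}(coord_vbasis (memvf u)) linear_sum linear_sumr big1// => i _.
  rewrite !linearZ /=.
  by move: (u0 i); rewrite !mxE => ->; rewrite mulr0.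
have fp : limg (linfun p) = fullv.
  apply/eqP; rewrite eqEdim subvf /= limg_dim_eq; last by rewrite (eqP kp) capv0.
  by rewrite dimvf /dim /= mul1n.
exists ((linfun p)^-1 \o linfun q)%VF => f g.
rewrite comp_lfunE; set s := (X in _ = form _ (vsval X)).
have hs : p s = q g.
  by rewrite -(lfunE p) /s limg_lfunVK ?fp ?memvf// lfunE.
rewrite (coord_vbasis (memvf f)) !linear_sum !linear_sumlz /=.
apply: eq_bigr => i _; rewrite !linearZ /= !linearZl_LR /=; congr (_ * _).
have /rowP/(_ i) := hs; rewrite !mxE => hsi.
by rewrite [LHS]hermC [RHS]hermC; congr (_ * Num.conj _); apply/esym.
Qed.

End DotSpaces.

(* An element f of P_{n,m} is the matrix of its coefficients: [f s t] is the
   coefficient of z^s w^t. *)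
Notation bipoly R n m := 'M[R[i]]_(n.+1, m.+1).

(* An element of L_{n,m} is the matrix of its coefficients, with indices
   shifted by (n, m): entry (a, b) is the coefficient of z^(a-n) w^(b-m). *)
Notation laurent R n m := 'M[R[i]]_((n + n).+1, (m + m).+1).

Section Polynomials.
Variables (R : realType) (n m : nat).
Local Notation C := R[i].
Implicit Types f g p : bipoly R n m.

(* z^s w^t; it is 0 when s > n or t > m. *)
Definition mon (s t : nat) : bipoly R n m :=
  \matrix_(a, b) ((a == s :> nat) && (b == t :> nat))%:R.

(* z^s w^t, for |s| <= n and |t| <= m. *)
Definition lmon (s t : int) : laurent R n m :=
  \matrix_(a, b) ((a%:Z - n%:Z == s) && (b%:Z - m%:Z == t))%:R.

(* The coefficients of the outer polynomial are polynomials in z, and its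
   variable is w. *)
Definition topoly p : {poly {poly C}} :=
  \sum_(s < n.+1) \sum_(t < m.+1) (p s t *: 'X^s) *: 'X^t.

Definition eval2 p (z w : C) : C := (topoly p).[w%:P].[z].

(* p(z, 0) *)
Definition slice0 p : {poly C} := (topoly p).[0].

(* f(z, w) * conj g (1/z, 1/w) *)
Definition lprod f g : laurent R n m :=
  \sum_(s < n.+1) \sum_(t < m.+1) \sum_(s' < n.+1) \sum_(t' < m.+1)
    (f s t * Num.conj (g s' t')) *: lmon (s%:Z - s'%:Z) (t%:Z - t'%:Z).

Definition positive_form (T : {scalar laurent R n m}) :=
  forall f, f != 0 -> 0 < T (lprod f f).

(* Multiplication by z and by w, truncated to P_{n,m}.  The truncation only
   drops the terms in z^n (resp. in w^m), so these are the genuine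
   multiplications on P_{n-1,m} (resp. on P_{n,m-1}). *)
Definition Mz : 'End(bipoly R n m) :=
  linfun (fun f => \sum_(s < n.+1) \sum_(t < m.+1) f s t *: mon s.+1 t).

Definition Mw : 'End(bipoly R n m) :=
  linfun (fun f => \sum_(s < n.+1) \sum_(t < m.+1) f s t *: mon s t.+1).

(* P_{k,l}, for integers k <= n and l <= m. *)
Definition Psp (k l : int) : {vspace bipoly R n m} :=
  (\sum_(s < n.+1 | (s%:Z <= k)%R)
    \sum_(t < m.+1 | (t%:Z <= l)%R) <[mon s t]>)%VS.

Lemma lin_comb_linear (e : nat -> nat -> bipoly R n m) :
  linear (fun f => \sum_(s < n.+1) \sum_(t < m.+1) f s t *: e s t).
Proof.
move=> a f g; rewrite scaler_sumr -big_split; apply: eq_bigr => s _.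
rewrite scaler_sumr -big_split; apply: eq_bigr => t _ /=.
by rewrite !mxE scalerDl scalerA.
Qed.

Lemma MzE f : Mz f = \sum_(s < n.+1) \sum_(t < m.+1) f s t *: mon s.+1 t.
Proof.
pose h f := \sum_(s < n.+1) \sum_(t < m.+1) f s t *: mon s.+1 t.
have lh : linear h := lin_comb_linear (fun s t => mon s.+1 t).
pose h1 := GRing.isLinear.Build _ _ _ _ h lh.
pose h2 : {linear bipoly R n m -> bipoly R n m} := HB.pack h h1.
exact: (lfunE h2).
Qed.

Lemma MwE f : Mw f = \sum_(s < n.+1) \sum_(t < m.+1) f s t *: mon s t.+1.
Proof.
pose h f := \sum_(s < n.+1) \sum_(t < m.+1) f s t *: mon s t.+1.
have lh : linear h := lin_comb_linear (fun s t => mon s t.+1).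
pose h1 := GRing.isLinear.Build _ _ _ _ h lh.
pose h2 : {linear bipoly R n m -> bipoly R n m} := HB.pack h h1.
exact: (lfunE h2).
Qed.

Lemma lprodPl a f1 f2 g :
  lprod (a *: f1 + f2) g = a *: lprod f1 g + lprod f2 g.
Proof.
rewrite scaler_sumr -big_split; apply: eq_bigr => s _.
rewrite scaler_sumr -big_split; apply: eq_bigr => t _.
rewrite scaler_sumr -big_split; apply: eq_bigr => s' _.
rewrite scaler_sumr -big_split; apply: eq_bigr => t' _ /=.
by rewrite !mxE scalerA -scalerDl mulrDl mulrA.
Qed.

Lemma lprodPr a f g1 g2 :
  lprod f (a *: g1 + g2) = Num.conj a *: lprod f g1 + lprod f g2.
Proof.
rewrite scaler_sumr -big_split; apply: eq_bigr => s _.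
rewrite scaler_sumr -big_split; apply: eq_bigr => t _.
rewrite scaler_sumr -big_split; apply: eq_bigr => s' _.
rewrite scaler_sumr -big_split; apply: eq_bigr => t' _ /=.
by rewrite !mxE scalerA -scalerDl rmorphD rmorphM mulrDr mulrCA.
Qed.

End Polynomials.

(* The number of zeros of [q != 0] in the open unit disk, counted with
   multiplicity. *)
Definition nzeros_disk (R : realType) (q : {poly R[i]}) : nat :=
  count (fun r => `|r| < 1) (sval (closed_field_poly_normal q)).

Definition expi (R : realType) (x : R) : R[i] := (cos x +i* sin x)%C.

(* The integral over T^2 with respect to |dz||dw|. *)
Definition torus_int (R : realType) (F : R[i] -> R[i] -> R[i]) : R[i] :=
  let mu := (@lebesgue_measure R \x @lebesgue_measure R)%E in
  let D : set (R * R) := (`[0%R, 2 * pi] `*` `[0%R, 2 * pi])%classic in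
  let G (x : R * R) := F (expi x.1) (expi x.2) in
  ((\int[mu]_(x in D) complex.Re (G x))
    +i* (\int[mu]_(x in D) complex.Im (G x)))%C.

Section SplitShift.
Variables (R : realType) (n m : nat) (T : {scalar laurent R n m}).
Local Notation H := (bipoly R n m).
Implicit Types f g : H.

(* The inner product of H_T. *)
Definition hdot (_ : positive_form T) f g : R[i] := T (lprod f g).

Hypothesis T_gt0 : positive_form T.
Lemma hdot_bilinear : bilinear_for *%R (Num.conj \; *%R) (hdot T_gt0).
Proof.
split=> [g a f1 f2|f a g1 g2]; first by rewrite /hdot lprodPl linearP.
by rewrite /hdot /= lprodPr linearP.
Qed.

HB.instance Definition _ :=
  bilinear_isBilinear.Build _ _ _ _ _ _ (hdot T_gt0) hdot_bilinear.

Lemma hdot_ge0 f : 0 <= hdot T_gt0 f f.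
Proof.
have [->|f0] := eqVneq f 0; last exact/ltW/T_gt0.
by rewrite linear0r.
Qed.

Lemma hdot_hermitian f g :
  hdot T_gt0 f g = (-1) ^+ false * Num.conj (hdot T_gt0 g f).
Proof.
set u := hdot T_gt0 f g; set v := hdot T_gt0 g f.
have cross c : let d := Num.conj c * u + c * v in Num.conj d = d.
  have -> : Num.conj c * u + c * v =
      hdot T_gt0 (f + c *: g) (f + c *: g) - hdot T_gt0 f f
      - c * Num.conj c * hdot T_gt0 g g.
    rewrite linearDl !linearDr !linearZl_LR !linearZr_LR /= -/u -/v.
    by rewrite /GRing.scale /=; ring.
  apply: conj_Creal; rewrite !rpredB ?ger0_real ?hdot_ge0 //.
  by apply: mulr_ge0; rewrite ?mul_conjC_ge0 ?hdot_ge0.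
have := cross 1; rewrite /= rmorph1 !mul1r rmorphD => h1.
have := cross 'i; rewrite /= conjCi rmorphD !rmorphM rmorphN /= conjCi => hi.
have {}hi : Num.conj u - Num.conj v + u - v = 0.
  apply/(mulfI (neq0Ci R[i])); rewrite mulr0.
  move/eqP: hi; rewrite -subr_eq0 => /eqP <-; ring.
have h2 : 2%:R != 0 :> R[i] by rewrite pnatr_eq0.
apply: (mulfI h2); apply/eqP; rewrite -subr_eq0; apply/eqP.
move/eqP: h1; rewrite -subr_eq0 => /eqP h1.
by rewrite -[RHS]subr0 -[X in _ = X - _]hi -[X in _ = _ - X]h1; ring.
Qed.


HB.instance Definition _ :=
  isHermitianSesquilinear.Build _ _ _ _ (hdot T_gt0) hdot_hermitian.
HB.instance Definition _ := isDotProduct.Build _ _ (hdot T_gt0) T_gt0.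

Definition dotT : {dot H for Num.conj} := hdot T_gt0.

Local Notation P k l := (Psp R n m k l).
Local Notation Mz := (Mz R n m).
Local Notation Mw := (Mw R n m).

Definition E1 (k l : int) : {vspace H} :=
  ominus dotT (P k l) (Mw @: P k (l - 1))%VS.
Definition E2 (k l : int) : {vspace H} :=
  ominus dotT (P k l) (Mz @: P (k - 1) l)%VS.
Definition F2 (k l : int) : {vspace H} :=
  ominus dotT (P k l) (P (k - 1) l).

(* E^1_{n-1,m}, w E^2_{n,m-1} and w F^2_{n,m-1}. *)
Definition domT : {vspace H} := E1 (n%:Z - 1) m%:Z.
Definition wE2 : {vspace H} := (Mw @: E2 n%:Z (m%:Z - 1))%VS.
Definition wF2 : {vspace H} := (Mw @: F2 n%:Z (m%:Z - 1))%VS.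

Definition opA : 'Hom(subvs_of domT, subvs_of wE2) :=
  (oproj dotT wE2 \o (Mz \o vincl domT))%VF.
Definition opB : 'Hom(subvs_of wF2, subvs_of domT) :=
  (oproj dotT domT \o vincl wF2)%VF.
Definition opT : 'End(subvs_of domT) :=
  (oproj dotT domT \o (Mz \o vincl domT))%VF.

Definition calA : {vspace subvs_of domT} :=
  vspan [set x | exists (j : nat) (f : subvs_of wE2),
    x = iter j (adjoint dotT opT) (adjoint dotT opA f)]%classic.
Definition calB : {vspace subvs_of domT} :=
  vspan [set x | exists (j : nat) (f : subvs_of wF2),
    x = iter j opT (opB f)]%classic.

Definition bernstein_szego (d : nat) : Prop :=
  exists p : H,
    [/\ forall z w : R[i], `|z| = 1 -> `|w| <= 1 -> eval2 p z w != 0,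
        nzeros_disk (slice0 p) = d
      & forall j k : int, `|j| <= n%:Z -> `|k| <= m%:Z ->
          T (lmon R n m j k) =
          torus_int (fun z w =>
            z ^ j * w ^ k / (((2 * pi)%:C)%C ^+ 2 * `|eval2 p z w| ^+ 2))].

Definition split_shift (d : nat) : Prop :=
  exists K1 K2 : {vspace H},
    [/\ E1 (n%:Z - 1) m%:Z = (K1 + K2)%VS /\ (K1 <= orthov dotT K2)%VS,
        (K1 <= orthov dotT (Mz @: K2))%VS,
        (K1 <= E1 n%:Z m%:Z)%VS,
        (Mz @: K2 <= E1 n%:Z m%:Z)%VS
      & \dim K1 = d].

Definition matrix_condition (d : nat) : Prop :=
  (invspace opT (limg opB) <= lker opA)%VS /\
  ((\dim calA)%:Z <= d%:Z <= n%:Z - (\dim calB)%:Z).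

End SplitShift.

(* Main.v *)
(** (2) <-> (3): in (2), K2 is a T-invariant subspace of E^1_{n-1,m} that contains
    the range of B and lies in the kernel of A, and K1 is its complement; so K2
    lies between calB and the orthogonal complement of calA.  Over C, two nested
    invariant subspaces have invariant subspaces of every dimension between them.

    (2) -> (1): E^1_{n,m} is the sum of K1, z K2 and the line of a unit vector p.
    For |z| = 1 this makes the reproducing kernel, for the coefficients of the
    powers of w, of the complement of P_{n-1,m} satisfy the Christoffel-Darboux
    recursion of p(z, .).  Hence p has no zero on T x closed D, and that kernel is
    the inverse of the Toeplitz matrix of 1/|p(z, .)|^2: the inner product and the
    one of 1/|p|^2 agree on the complement.  Splitting off at each step the
    component in the complement, z^N f is a combination of such components up to
    the image of f under the N-th power of a compression of the shift, which tends
    to 0.  The zeros of p(z, 0) are counted by comparing dimensions: those in D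
    divide f(z, 0) for f in K2, the others divide it for f in K1.

    (1) -> (2): write p(z, 0) = p_in p_out and let K1 and K2 be the f in
    E^1_{n-1,m} with f(z, 0) in p_out C[z], resp. p_in C[z].  Fibrewise,
    f = (f(z, 0) / p(z, 0)) p + w g, and the Fourier coefficients of g in z have
    index >= 0 for K2 and < n for K1.  The moments of w g against z^k w^(i+1) vanish for
    0 <= k < n, and the inverse of the fibrewise Toeplitz matrix is a positive
    Laurent polynomial of degree at most n in z; this forces the moments to vanish
    also for k < 0, resp. for k >= n. *)

From HB Require Import structures.
Require Import Defs.
From mathcomp Require Import all_boot all_order all_algebra.
From mathcomp Require Import all_classical all_reals all_analysis.
From mathcomp Require Import measurable_realfun complex.
From mathcomp Require Import ring zify.

Set Implicit Arguments.
Unset Strict Implicit.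
Unset Printing Implicit Defensive.

Import Order.TTheory GRing.Theory Num.Theory.
Local Open Scope ring_scope.

(** * Finite-dimensional inner product spaces *)

(** The data stop at |j| <= n, while 1/|p|^2 has moments of every order; both directions have to
    cross this gap. From (2), the crossing rests on a wandering subspace: the complement of
    P_{n-1,m} keeps its inner product on every single fibre |z| = 1, so its translates by powers of
    z are orthogonal in the weighted space. Nonvanishing of p comes from positivity: at a zero w of
    p(z, .) with |w| < 1 the Christoffel-Darboux formula makes a squared norm nonpositive, so
    evaluation at (z, w) is represented inside P_{n-1,m}, by an eigenvector of the truncated
    multiplication by z, which is nilpotent. From (1), a nonzero moment outside the window would be
    the common product of one function with infinitely many orthogonal functions of bounded norm,
    against Bessel's inequality; they are orthogonal when spaced by n because the kernel has degree
    at most n in z. Analysis is kept elementary: holomorphic functions are uniform limits of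
    polynomials on the closed disk, and Cauchy's formula at 0 is the orthogonality of the powers of
    z. *)

Section DotAlgebra.
Variables (C : numClosedFieldType) (V : vectType C).
Variable form : {dot V for Num.conj}.
Implicit Types (M N U W K : {vspace V}) (x y f g : V).

Lemma dotDl x y f : form (x + y) f = form x f + form y f.
Proof. by rewrite linearDl. Qed.
Lemma dotDr x y f : form f (x + y) = form f x + form f y.
Proof. by rewrite linearDr. Qed.
Lemma dotZl a x f : form (a *: x) f = a * form x f.
Proof. by rewrite linearZl_LR. Qed.
Lemma dotZr a x f : form f (a *: x) = a^* * form f x.
Proof. by rewrite linearZr_LR. Qed.
Lemma dotZZ a x : form (a *: x) (a *: x) = `|a| ^+ 2 * form x x.
Proof. by rewrite dotZl dotZr mulrA normCK. Qed.
Lemma dotNl x f : form (- x) f = - form x f.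
Proof. by rewrite -scaleN1r dotZl mulN1r. Qed.
Lemma dotNr x f : form f (- x) = - form f x.
Proof. by rewrite -scaleN1r dotZr rmorphN rmorph1 mulN1r. Qed.
Lemma dotBl x y f : form (x - y) f = form x f - form y f.
Proof. by rewrite dotDl dotNl. Qed.
Lemma dotBr x y f : form f (x - y) = form f x - form f y.
Proof. by rewrite dotDr dotNr. Qed.
Lemma dot0l f : form 0 f = 0.
Proof. by rewrite -(scale0r 0) dotZl mul0r. Qed.
Lemma dot0r f : form f 0 = 0.
Proof. by rewrite -(scale0r 0) dotZr rmorph0 mul0r. Qed.
Lemma dot_suml (I : Type) (r : seq I) (P : pred I) (F : I -> V) f :
  form (\sum_(i <- r | P i) F i) f = \sum_(i <- r | P i) form (F i) f.
Proof.
by elim/big_rec2: _ => [|i a b _ <-]; rewrite ?dot0l ?dotDl.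
Qed.
Lemma dot_sumr (I : Type) (r : seq I) (P : pred I) (F : I -> V) f :
  form f (\sum_(i <- r | P i) F i) = \sum_(i <- r | P i) form f (F i).
Proof.
by elim/big_rec2: _ => [|i a b _ <-]; rewrite ?dot0r ?dotDr.
Qed.
Lemma dotC x y : form x y = (form y x)^*.
Proof. by rewrite hermC expr0 mul1r. Qed.
Lemma dot_ge0 x : 0 <= form x x. Proof. exact: dnorm_ge0. Qed.
Lemma dot_eq0 x : form x x = 0 -> x = 0.
Proof. by move=> /eqP; rewrite dnorm_eq0 => /eqP. Qed.
Lemma dot_eq0C x y : form x y = 0 -> form y x = 0.
Proof. by move=> h; rewrite dotC h rmorph0. Qed.

Lemma orthP M x : reflect (forall y, y \in M -> form x y = 0) (x \in orthov form M).
Proof. by apply: (iffP mem_orthovP). Qed.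

Lemma orthS M N : reflect (forall x y, x \in M -> y \in N -> form x y = 0)
  (M <= orthov form N)%VS.
Proof. by apply: (iffP (orthovP (form := form))) => h x y /h; apply. Qed.

Lemma memv_ominus M N x :
  reflect (x \in M /\ forall y, y \in N -> form x y = 0) (x \in ominus form M N).
Proof. by rewrite memv_cap; apply: (iffP andP) => -[h /orthP]. Qed.

Definition proj M x : V := vsval (oproj form M x).

Lemma proj_mem M x : proj M x \in M.
Proof. exact: subvsP. Qed.

Lemma proj_orth M x y : y \in M -> form (x - proj M x) y = 0.
Proof. by move=> yM; have /orthP := oprojP form M x; apply. Qed.

Lemma proj_dotl M x y : y \in M -> form (proj M x) y = form x y.
Proof. by move=> /(proj_orth x)/eqP; rewrite dotBl subr_eq0 => /eqP. Qed.

Lemma proj_dotr M x y : y \in M -> form y (proj M x) = form y x.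
Proof. by move=> yM; rewrite dotC proj_dotl // -dotC. Qed.

Lemma orth_uniq M x y : x \in M -> y \in M ->
  (forall f, f \in M -> form f x = form f y) -> x = y.
Proof.
move=> xM yM h; apply/eqP; rewrite -subr_eq0; apply/eqP/dot_eq0.
by rewrite dotBr h ?subrr // rpredB.
Qed.

Lemma proj_uniq M x y : y \in M -> (forall f, f \in M -> form x f = form y f) ->
  proj M x = y.
Proof.
move=> yM h; apply: (@orth_uniq M) => // [|f fM]; first exact: proj_mem.
by rewrite proj_dotr // dotC h // -dotC.
Qed.

Lemma proj_id M x : x \in M -> proj M x = x.
Proof. by move=> xM; apply: proj_uniq. Qed.

Lemma orth_decomp M x : exists y z, [/\ x = y + z, y \in M &
  forall f, f \in M -> form z f = 0].
Proof.
exists (proj M x), (x - proj M x); split; first by rewrite addrC subrK.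
  exact: proj_mem.
exact: proj_orth.
Qed.

Lemma ominus_decomp M N x : (N <= M)%VS -> x \in M ->
  exists y z, [/\ x = y + z, y \in ominus form M N & z \in N].
Proof.
move=> NM xM; exists (x - proj N x), (proj N x); rewrite subrK; split => //.
  apply/memv_ominus; split; last exact: proj_orth.
  by rewrite rpredB // (subvP NM) // proj_mem.
exact: proj_mem.
Qed.

Lemma dim_ominus M N : (N <= M)%VS -> (\dim (ominus form M N) + \dim N = \dim M)%N.
Proof.
move=> NM; rewrite -dimv_disjoint_sum; last first.
  apply/eqP; rewrite -subv0; apply/subvP => x; rewrite memv_cap => /andP[].
  move=> /memv_ominus[_ h] xN; rewrite memv0; apply/eqP/dot_eq0; exact: h.
congr (\dim _); apply/eqP; rewrite eqEsubv; apply/andP; split.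
  by rewrite subv_add capvSl.
apply/subvP => x xM; have [y [z [-> yN zN]]] := ominus_decomp NM xM.
exact: memv_add.
Qed.

(** [L] is a bare function with linearity as a hypothesis, so that evaluations, coordinates and
    evaluations of quotients can be used without packing them as linear maps. *)
Lemma riesz (L : V -> C) : (forall a x y, L (a *: x + y) = a * L x + L y) ->
  exists y, forall x, L x = form x y.
Proof.
move=> lin.
have L0 : L 0 = 0.
  by have /eqP := lin 1 0 0; rewrite scaler0 addr0 mul1r -subr_eq subrr eq_sym => /eqP.
have LZ a x : L (a *: x) = a * L x by rewrite -[a *: x]addr0 lin L0 addr0.
have LD x y : L (x + y) = L x + L y by rewrite -{1}[x]scale1r lin mul1r.
pose p0 : V -> C^o := L.
have lp0 : linear p0 by move=> a x y; rewrite /p0 lin.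
pose p1 := GRing.isLinear.Build _ _ _ _ p0 lp0.
pose p : {linear V -> C^o} := HB.pack p0 p1.
pose K := lker (linfun p).
have inK x : (x \in K) = (L x == 0) by rewrite memv_ker lfunE.
have [K1|/existsNP[x0 Lx0]] := pselect (forall x, L x = 0).
  by exists 0 => x; rewrite dot0r K1.
have [k [e [xke kK eK]]] := orth_decomp K x0.
have Le : L e != 0.
  move: kK; rewrite inK => /eqP Lk; apply/eqP => Le; apply: Lx0.
  by rewrite xke LD Lk Le addr0.
have ee : form e e != 0.
  by apply: contraNneq Le => /dot_eq0 ->; rewrite L0.
exists ((L e / form e e)^* *: e) => x; rewrite dotZr conjCK.
have : form (x - (L x / L e) *: e) e = 0.
  apply: dot_eq0C; apply: eK; rewrite inK -scaleNr addrC lin mulNr.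
  by rewrite divfK // addNr.
move/eqP; rewrite dotBl dotZl subr_eq0 => /eqP ->.
by field; rewrite ee Le.
Qed.

Lemma dotCS x y : `|form x y| ^+ 2 <= form x x * form y y.
Proof.
have [->|y0] := eqVneq y 0; first by rewrite !dot0r normr0 expr0n mulr0.
have yy : 0 < form y y by rewrite dnorm_gt0.
set b := form x y; set c := form y y.
have := dot_ge0 (x - (b / c) *: y).
have cc : (b / c)^* = b^* / c by rewrite rmorphM fmorphV /= (conj_Creal (gtr0_real yy)).
rewrite dotBl !dotBr !dotZl !dotZr (dotC y x) -/b -/c cc.
have c0 : c != 0 by rewrite gt_eqF.
have -> : form x x - b^* / c * b - (b / c * b^* - b / c * (b^* / c * c)) =
  form x x - b * b^* / c by field.
by rewrite -normCK subr_ge0 ler_pdivrMr.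
Qed.

Lemma form_bound (L : V -> C) : (forall a x y, L (a *: x + y) = a * L x + L y) ->
  exists2 B, 0 <= B & forall x, `|L x| ^+ 2 <= B * form x x.
Proof.
move=> /riesz[y Ly]; exists (form y y); first exact: dot_ge0.
by move=> x; rewrite Ly mulrC; exact: dotCS.
Qed.

Lemma dot_pyth x y : form x y = 0 -> form (x + y) (x + y) = form x x + form y y.
Proof. by move=> h; rewrite dotDl !dotDr h (dot_eq0C h) addr0 add0r. Qed.

Lemma proj_le M x : form (proj M x) (proj M x) <= form x x.
Proof.
have -> : form x x = form (proj M x) (proj M x) + form (x - proj M x) (x - proj M x).
  rewrite -dot_pyth; first by rewrite addrC subrK.
  by apply: dot_eq0C; apply: proj_orth; exact: proj_mem.
by rewrite lerDl dot_ge0.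
Qed.

End DotAlgebra.

(** The hypotheses on [Q] are those of a squared seminorm, weaker than being a dot product: besides
    comparing two dot products, this is applied to the integral form of 1/|p|^2, known only to be
    semidefinite. *)
Lemma quad_bound (C : numClosedFieldType) (V : vectType C) (Q : V -> C) (f2 : {dot V for Num.conj}) :
  (forall x, 0 <= Q x) -> Q 0 = 0 -> (forall a x, Q (a *: x) = `|a| ^+ 2 * Q x) ->
  (forall x y, Q (x + y) <= 2 * Q x + 2 * Q y) ->
  exists2 B, 0 < B & forall x, Q x <= B * f2 x x.
Proof.
move=> Q0 Q00 QZ QD; suff : exists2 B, 0 <= B & forall x, Q x <= B * f2 x x.
  move=> [B B0 h]; exists (B + 1); first by rewrite ltr_wpDl.
  by move=> x; rewrite mulrDl mul1r; apply: le_trans (h x) _; rewrite lerDl dot_ge0.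
pose k := \dim (fullv : {vspace V}).
pose e := vbasis (fullv : {vspace V}).
have cb (i : 'I_k) : exists B, (0 <= B) && `[< forall x, `|coord e i x| ^+ 2 <= B * f2 x x >].
  have [a x y|B B0 h] := @form_bound _ _ f2 (coord e i).
    by rewrite linearP.
  by exists B; rewrite B0; apply/asboolP.
pose B i := xchoose (cb i).
have B0 i : 0 <= B i by have /andP[] := xchooseP (cb i).
have hB i x : `|coord e i x| ^+ 2 <= B i * f2 x x.
  by have /andP[_ /asboolP] := xchooseP (cb i); apply.
have tri (r : seq 'I_k) : exists2 D, 0 <= D & forall x,
    Q (\sum_(i <- r) coord e i x *: e`_i) <= D * f2 x x.
  elim: r => [|i r [D D0 IH]].
    by exists 0 => // y; rewrite big_nil Q00 mul0r.
  exists (2 * (B i * Q e`_i) + 2 * D).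
    by rewrite addr_ge0 ?mulr_ge0.
  move=> y; rewrite big_cons; apply: le_trans (QD _ _) _.
  rewrite [leRHS]mulrDl; apply: lerD; last first.
    by rewrite -mulrA ler_pM2l ?ltr0n //; exact: IH.
  rewrite QZ -mulrA ler_pM2l ?ltr0n //.
  rewrite [leRHS]mulrAC; apply: ler_wpM2r => //.
have [D D0 h] := tri (index_enum 'I_k); exists D => // x.
by have := h x; rewrite -[\sum_(_ <- _) _](coord_vbasis (memvf x)).
Qed.

Lemma dot_equiv (C : numClosedFieldType) (V : vectType C) (f1 f2 : {dot V for Num.conj}) :
  exists2 B, 0 < B & forall x, f1 x x <= B * f2 x x.
Proof.
apply: (quad_bound (Q := fun x => f1 x x)) => [x||a x|x y].
- exact: dot_ge0.
- exact: dot0l.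
- exact: dotZZ.
have := dot_ge0 f1 (x - y); rewrite !dotDl !dotDr !dotNl !dotNr => h.
rewrite -subr_ge0; apply: le_trans h _; rewrite le_eqVlt; apply/orP; left; apply/eqP.
by ring.
Qed.

Lemma vinclE (C : numClosedFieldType) (V : vectType C) (M : {vspace V}) (x : subvs_of M) :
  vincl M x = vsval x.
Proof. by rewrite lfunE. Qed.

Lemma compressE (C : numClosedFieldType) (V : vectType C) (form : {dot V for Num.conj})
    (M N : {vspace V}) (t : 'End(V)) (x : subvs_of M) :
  vsval ((oproj form N \o (t \o vincl M))%VF x) = proj form N (t (vsval x)).
Proof.
by rewrite -(vinclE x) /proj; congr vsval; rewrite -[RHS](comp_lfunE _ t) -[RHS]comp_lfunE comp_lfunA.
Qed.

(** * Invariant subspaces of prescribed dimension *)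

Section InvSubspace.
Variables (C : numClosedFieldType) (V : vectType C) (form : {dot V for Num.conj}).
Variable t : 'End(V).

Import passmx.

Lemma End_eigen (W : vectType C) (S : 'End(W)) : (0 < \dim (fullv : {vspace W}))%N ->
  exists a v, v != 0 /\ S v = a *: v.
Proof.
move=> d0; pose e := vbasis (fullv : {vspace W}).
have [a] := eigenvalue_closed (mxof e e S) d0.
rewrite /eigenvalue => ha.
have be : basis_of fullv e := vbasisP _.
have : leigenspace S a != 0%VS.
  by rewrite (leigenspaceE be) vsof_eq0.
move=> h; exists a, (vpick (leigenspace S a)); split; first by rewrite vpick0.
have := memv_pick (leigenspace S a).
by rewrite memv_ker !lfun_simp subr_eq0 => /eqP.
Qed.

(** The orthogonal complement of [U] in [W], with the compression of [t], serves as the quotient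
    W/U: an eigenvector of the compression is an eigenvector of [t] modulo [U]. *)
Lemma quot_eigen (U W : {vspace V}) : (U <= W)%VS -> (t @: W <= W)%VS -> ~~ (W <= U)%VS ->
  exists a v, [/\ v \in W, v \notin U & t v - a *: v \in U].
Proof.
move=> UW tW nWU; pose D := ominus form W U.
pose S : 'End(subvs_of D) := (oproj form D \o (t \o vincl D))%VF.
have [|a [v [v0 Sv]]] := End_eigen S.
  rewrite dimvf /dim /= lt0n; apply: contraNneq nWU => D0.
  by rewrite -(dimv_leqif_sup UW) -(dim_ominus form UW) D0.
exists a, (vsval v); have /memv_ominus[vW vU] := subvsP v; split=> //.
  apply: contra v0 => vinU; apply/eqP/subvs_inj/(dot_eq0 (form := form)).
  exact: (vU _ vinU).
have vE : proj form D (t (vsval v)) = a *: vsval v.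
  have -> : a *: vsval v = vsval (S v). by rewrite Sv.
  by rewrite -(compressE form D t).
rewrite -vE; move: {vE}(t _) (subvP tW _ (memv_img t vW)) => x xW.
have [y [z [-> yD zU]]] := ominus_decomp form UW xW.
have py : proj form D (y + z) = y.
  apply: proj_uniq => // f /memv_ominus[_ /(_ z zU) fz].
  by rewrite dotDl (dot_eq0C fz) addr0.
by rewrite py addrC addKr.
Qed.

(** Adding to [U] an eigenvector modulo [U] keeps invariance and raises the dimension by exactly
    one, so every intermediate dimension is reached. *)
Lemma inv_between (U W : {vspace V}) k : (U <= W)%VS -> (t @: U <= U)%VS ->
  (t @: W <= W)%VS -> (\dim U <= k <= \dim W)%N ->
  exists K : {vspace V}, [/\ (U <= K)%VS, (K <= W)%VS, (t @: K <= K)%VS & \dim K = k].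
Proof.
move=> UW tU tW /andP[]; move hr: (k - \dim U)%N => r.
elim: r U UW tU hr => [|r IH] U UW tU hr Uk kW.
  exists U; split => //; apply/eqP; rewrite eqn_leq Uk /=.
  by rewrite -subn_eq0 hr.
have kU : (\dim U < k)%N by rewrite -subn_gt0 hr.
have nWU : ~~ (W <= U)%VS.
  by apply: contraL kU => WU; rewrite -leqNgt (leq_trans kW) // dimvS.
have [a [v [vW vU tv]]] := quot_eigen UW tW nWU.
have dU : \dim (U + <[v]>) = (\dim U).+1.
  rewrite dimv_disjoint_sum.
    by rewrite dim_vline; case: eqP vU => [->|_ _]; rewrite ?mem0v ?addn1.
  apply/eqP; rewrite -subv0; apply/subvP => x; rewrite memv_cap => /andP[xU].
  move=> /vlineP[b xb]; rewrite memv0 xb; have [->|b0] := eqVneq b 0.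
    by rewrite scale0r.
  by case/negP: vU; rewrite -(scalerK b0 v) rpredZ // -xb.
have [|||||K [UK KW tK dK]] := IH (U + <[v]>)%VS.
- by rewrite subv_add UW -memvE.
- rewrite limgD subv_add (subv_trans tU) ?addvSl //=.
  rewrite limg_line -memvE -(subrK (a *: v) (t v)).
  by rewrite memv_add // memvZ // memv_line.
- by rewrite dU subnS hr.
- by rewrite dU.
- by [].
by exists K; split => //; rewrite (subv_trans _ UK) // addvSl.
Qed.

End InvSubspace.

Section SubDot.
Variables (C : numClosedFieldType) (V : vectType C) (form : {dot V for Num.conj}).
Variable U : {vspace V}.

(** [opT] acts on [subvs_of] of a subspace, so [inv_between] needs a dot product on that type and
    not on the ambient space. *)
Definition sub_form (x y : subvs_of U) : C := form (vsval x) (vsval y).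

Lemma sub_form_bilinear : bilinear_for *%R (Num.conj \; *%R) sub_form.
Proof.
by split=> [y a u v|y a u v]; rewrite /sub_form -[vsval (a *: u + v)]/(a *: vsval u + vsval v) ?(dotDl, dotDr) ?(dotZl, dotZr).
Qed.
HB.instance Definition _ :=
  bilinear_isBilinear.Build _ _ _ _ _ _ sub_form sub_form_bilinear.
Lemma sub_form_hermitian x y : sub_form x y = (-1) ^+ false * Num.conj (sub_form y x).
Proof. exact: hermC. Qed.
HB.instance Definition _ :=
  isHermitianSesquilinear.Build _ _ _ _ sub_form sub_form_hermitian.
Lemma sub_form_gt0 x : x != 0 -> 0 < sub_form x x.
Proof.
move=> x0; rewrite dnorm_gt0; apply: contra x0 => /eqP h.
by apply/eqP/subvs_inj.
Qed.
HB.instance Definition _ := isDotProduct.Build _ _ sub_form sub_form_gt0.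
Definition sub_dot : {dot (subvs_of U) for Num.conj} := sub_form.
End SubDot.

Section StrictContraction.
Variables (C : numClosedFieldType) (V : vectType C) (form : {dot V for Num.conj}) (W : V -> V).
Hypothesis W_lin : forall a x y, W (a *: x + y) = a *: W x + W y.
Hypothesis W_lt : forall x, x != 0 -> form (W x) (W x) < form x x.

(** The two hypotheses are arguments so that the dot product structure below, whose axioms depend on
    them, can be attached to the constant [defect]. *)
Definition defect of (forall a x y, W (a *: x + y) = a *: W x + W y)
  & (forall x, x != 0 -> form (W x) (W x) < form x x) :=
  fun x y : V => form x y - form (W x) (W y).
Local Notation dif := (defect W_lin W_lt).

Lemma defect_bilinear : bilinear_for *%R (Num.conj \; *%R) dif.
Proof.
by split=> [y a u v|y a u v]; rewrite /defect /= W_lin ?(dotDl, dotDr) ?(dotZl, dotZr);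
  rewrite opprD addrACA -mulrBr.
Qed.
HB.instance Definition _ := bilinear_isBilinear.Build _ _ _ _ _ _ dif defect_bilinear.
Lemma defect_hermitian x y : dif x y = (-1) ^+ false * Num.conj (dif y x).
Proof. by rewrite expr0 mul1r /defect (rmorphB Num.conj) /= -(dotC form x y) -(dotC form (W x)). Qed.
HB.instance Definition _ := isHermitianSesquilinear.Build _ _ _ _ dif defect_hermitian.
Lemma defect_gt0 x : x != 0 -> 0 < dif x x.
Proof. by move=> x0; rewrite subr_gt0 W_lt. Qed.
HB.instance Definition _ := isDotProduct.Build _ _ dif defect_gt0.

(* The defect form is positive definite, hence equivalent to the given one in finite dimension. *)
Lemma strict_contraction : exists r, [/\ 0 <= r, r < 1 &
  forall x, form (W x) (W x) <= r * form x x].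
Proof.
have [B B0 hB] := dot_equiv form (dif : {dot V for Num.conj}).
(* Nothing bounds [B] from below, so [1 - B^-1] could be negative in the zero space; a nonzero
   vector excludes this. *)
have [V0|/existsNP[x0 /eqP x0n]] := pselect (forall x : V, x = 0).
  exists 0; split => // x; rewrite (V0 (W x)) (V0 x) dot0l mul0r //.
have h x : form (W x) (W x) <= (1 - B^-1) * form x x.
  have : B^-1 * form x x <= form x x - form (W x) (W x) by rewrite mulrC ler_pdivrMr // mulrC hB.
  by rewrite mulrBl mul1r lerBrDl addrC -lerBrDl.
exists (1 - B^-1); split => //.
  have f0 : 0 < form x0 x0 by rewrite dnorm_gt0.
  by rewrite -(pmulr_lge0 _ f0); apply: le_trans (h x0); exact: dot_ge0.
by rewrite ltrBlDr ltrDl invr_gt0.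
Qed.
End StrictContraction.

(** * Coefficients of polynomials in two variables and the form of T *)

Section Coef.
Variables (R : realType) (n m : nat).
Local Notation C := R[i].
Local Notation H := (bipoly R n m).
Local Notation P k l := (Psp R n m k l).
Local Notation Mz := (Mz R n m).
Local Notation Mw := (Mw R n m).
Implicit Types (f g h : H) (s t N L : nat).

(** Indices are plain naturals and the value outside the rectangle is 0, so that shifts and degree
    bounds need neither ordinals nor casts. *)
Definition cf f s t : C := if (s <= n)%N && (t <= m)%N then f (inord s) (inord t) else 0.

Lemma cf_ord f (i : 'I_n.+1) (j : 'I_m.+1) : cf f i j = f i j.
Proof. by rewrite /cf -ltnS ltn_ord -ltnS ltn_ord /= !inord_val. Qed.

Lemma cf_inj f g : (forall s t, cf f s t = cf g s t) -> f = g.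
Proof. by move=> h; apply/matrixP => i j; rewrite -!cf_ord h. Qed.

Lemma cf_gt f s t : ~~ ((s <= n)%N && (t <= m)%N) -> cf f s t = 0.
Proof. by rewrite /cf => /negbTE ->. Qed.

Lemma cfP a f g s t : cf (a *: f + g) s t = a * cf f s t + cf g s t.
Proof. by rewrite /cf; case: ifP => _; rewrite ?mxE // mulr0 addr0. Qed.
Lemma cf0 s t : cf 0 s t = 0.
Proof. by rewrite /cf mxE if_same. Qed.
Lemma cfD f g s t : cf (f + g) s t = cf f s t + cf g s t.
Proof. by rewrite -{1}[f]scale1r cfP mul1r. Qed.
Lemma cfZ a f s t : cf (a *: f) s t = a * cf f s t.
Proof. by rewrite -[_ *: _]addr0 cfP cf0 addr0. Qed.
Lemma cfN f s t : cf (- f) s t = - cf f s t.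
Proof. by rewrite -scaleN1r cfZ mulN1r. Qed.
Lemma cfB f g s t : cf (f - g) s t = cf f s t - cf g s t.
Proof. by rewrite cfD cfN. Qed.
Lemma cf_sum (I : Type) (r : seq I) (Q : pred I) (F : I -> H) s t :
  cf (\sum_(i <- r | Q i) F i) s t = \sum_(i <- r | Q i) cf (F i) s t.
Proof. by elim/big_rec2: _ => [|i a b _ <-]; rewrite ?cf0 ?cfD. Qed.

Lemma cf_mon s' t' s t :
  cf (mon R n m s' t') s t = ([&& s == s', t == t', s <= n & t <= m]%N)%:R.
Proof.
rewrite /cf; case: ifP => [/andP[sn tm]|h]; last first.
  by rewrite !andbF.
by rewrite mxE !inordK // andbT.
Qed.

Lemma sum_ord_delta K (F : nat -> C) s :
  \sum_(i < K) F i * (s == i)%:R = if (s < K)%N then F s else 0.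
Proof.
case: ifP => sK.
  rewrite (bigD1 (Ordinal sK)) //= eqxx mulr1 big1 ?addr0 // => i /eqP ne.
  by case: eqP => [E|_]; rewrite ?mulr0 //; case: ne; apply: val_inj.
rewrite big1 // => i _; case: eqP => [E|_]; rewrite ?mulr0 //.
by rewrite E ltn_ord in sK.
Qed.

Lemma mk_cf (F : nat -> nat -> C) s t :
  cf (\matrix_(i, j) F i j) s t = if (s <= n)%N && (t <= m)%N then F s t else 0.
Proof. by rewrite /cf; case: ifP => // /andP[sn tm]; rewrite mxE !inordK. Qed.

Lemma mon_expand f : f = \sum_(s < n.+1) \sum_(t < m.+1) f s t *: mon R n m s t.
Proof.
apply/matrixP => i j; rewrite summxE (bigD1 i) //= summxE (bigD1 j) //= !mxE.
rewrite !eqxx mulr1 !big1 ?addr0 // => k ki.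
  by rewrite summxE big1 // => l _; rewrite !mxE eq_sym (negbTE (_ : k != i :> nat)) ?mulr0.
by rewrite !mxE [j == k :> nat]eq_sym (negbTE (_ : k != j :> nat)) // andbF mulr0.
Qed.

Lemma cf_Mz0 f t : cf (Mz f) 0 t = 0.
Proof.
rewrite MzE cf_sum big1 // => i _; rewrite cf_sum big1 // => j _.
by rewrite cfZ cf_mon mulr0.
Qed.

Lemma cf_MzS f s t : cf (Mz f) s.+1 t = if (s < n)%N then cf f s t else 0.
Proof.
rewrite MzE cf_sum.
under eq_bigr => i _.
  rewrite cf_sum.
  under eq_bigr => j _ do rewrite cfZ cf_mon eqSS -cf_ord.
  over.
case: ifP => sn; last first.
  by rewrite big1 // => i _; rewrite big1 // => j _; rewrite /= !andbF mulr0.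
have [tm|tm] := leqP t m; last first.
  rewrite big1 => [|i _]; last by rewrite big1 // => j _; rewrite !andbF mulr0.
  by rewrite cf_gt // negb_and -(ltnNge m t) tm orbT.
have sn1 : (s < n.+1)%N by apply: ltnW.
rewrite (bigD1 (Ordinal sn1)) //= (bigD1 (Ordinal (tm : (t < m.+1)%N))) //= !eqxx mulr1.
rewrite !big1 ?addr0 // => i ne.
  rewrite big1 // => j _; rewrite (_ : (s == i) = false) ?mulr0 //.
  by apply/negbTE; apply: contra ne => /eqP E; apply/eqP/val_inj.
rewrite (_ : (t == i) = false) ?mulr0 //.
by apply/negbTE; apply: contra ne => /eqP E; apply/eqP/val_inj.
Qed.

Lemma cf_Mw0 f s : cf (Mw f) s 0 = 0.
Proof.
rewrite MwE cf_sum big1 // => i _; rewrite cf_sum big1 // => j _.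
by rewrite cfZ cf_mon andbF mulr0.
Qed.

Lemma cf_MwS f s t : cf (Mw f) s t.+1 = if (t < m)%N then cf f s t else 0.
Proof.
rewrite MwE cf_sum.
under eq_bigr => i _.
  rewrite cf_sum.
  under eq_bigr => j _ do rewrite cfZ cf_mon eqSS -cf_ord.
  over.
case: ifP => tm; last first.
  by rewrite big1 // => i _; rewrite big1 // => j _; rewrite !andbF mulr0.
have [sn|sn] := leqP s n; last first.
  rewrite big1 => [|i _]; last by rewrite big1 // => j _; rewrite !andbF mulr0.
  by rewrite cf_gt // negb_and -(ltnNge n s) sn.
have tm1 : (t < m.+1)%N by apply: ltnW.
rewrite (bigD1 (Ordinal (sn : (s < n.+1)%N))) //= (bigD1 (Ordinal tm1)) //= !eqxx mulr1.
rewrite !big1 ?addr0 // => i ne.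
  rewrite big1 // => j _; rewrite (_ : (s == i) = false) ?mulr0 //.
  by apply/negbTE; apply: contra ne => /eqP E; apply/eqP/val_inj.
rewrite (_ : (t == i) = false) ?andbF ?mulr0 //.
by apply/negbTE; apply: contra ne => /eqP E; apply/eqP/val_inj.
Qed.

(** Degrees are written as N - 1 and L - 1 with natural N and L, so that the zero spaces of degree
    -1 are covered by the same criterion. *)
Lemma mem_Psp N L f :
  reflect (forall s t, ~~ ((s < N)%N && (t < L)%N) -> cf f s t = 0)
          (f \in P (N%:Z - 1) (L%:Z - 1)).
Proof.
have lt1 a b : ((a%:Z <= b%:Z - 1)%R) = (a < b)%N by lia.
apply: (iffP idP) => [|h].
  move=> /memv_sumP[u hu ->] s t st; rewrite cf_sum big1 // => i iN.
  have /memv_sumP[v hv ->] := hu i iN; rewrite cf_sum big1 // => j jL.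
  have /vlineP[a ->] := hv j jL; rewrite cfZ cf_mon.
  case: (s =P i) => [E|_]; last by rewrite mulr0.
  case: (t =P j) => [E'|_]; last by rewrite mulr0.
  by case/negP: st; rewrite E E' -!lt1 iN.
rewrite [f]mon_expand; apply: rpred_sum => i _; apply: rpred_sum => j _.
have [iN|iN] := boolP ((i < N)%N && (j < L)%N); last first.
  by rewrite -cf_ord h // scale0r mem0v.
move: iN => /andP[iN jL].
apply: (subvP (sumv_sup i _ _)); rewrite ?lt1 //=.
apply: (subvP (sumv_sup j _ _)); rewrite ?lt1 //=.
by rewrite memvZ // memv_line.
Qed.

Lemma Z1 k : k.+1%:Z - 1 = k%:Z. Proof. by lia. Qed.

Lemma P_full : P n%:Z m%:Z = fullv.
Proof.
apply/vspaceP => f; rewrite memvf -(Z1 n) -(Z1 m).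
by apply/mem_Psp => s t st; rewrite cf_gt.
Qed.

Lemma mem_wP N f :
  reflect ((forall s, cf f s 0 = 0) /\ (forall s t, (N <= s)%N -> cf f s t = 0))
          (f \in (Mw @: P (N%:Z - 1) (m%:Z - 1))%VS).
Proof.
apply: (iffP memv_imgP) => [[g gP ->]|[h0 hN]].
  split=> [s|s [|t] Ns]; rewrite ?cf_Mw0 ?cf_MwS //.
  move/mem_Psp: gP => -> //; first by rewrite if_same.
  by rewrite negb_and -leqNgt Ns.
exists (\matrix_(i, j) cf f i j.+1).
  apply/mem_Psp => s t st; rewrite (mk_cf (fun i j => cf f i j.+1)); case: ifP => // /andP[sn tm].
  move: st; rewrite negb_and -!leqNgt => /orP[Ns|mt]; first exact: hN.
  by rewrite cf_gt // negb_and -(ltnNge _ t.+1) ltnS mt orbT.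
apply: cf_inj => s [|t]; rewrite ?cf_Mw0 ?h0 // cf_MwS (mk_cf (fun i j => cf f i j.+1)).
case: ifP => [tm|tm]; last first.
  by rewrite cf_gt // negb_and tm orbT.
rewrite (ltnW tm) andbT; case: ifP => // sn.
by rewrite cf_gt // sn.
Qed.

Lemma mem_zP L f :
  reflect ((forall t, cf f 0 t = 0) /\ (forall s t, (L <= t)%N -> cf f s t = 0))
          (f \in (Mz @: P (n%:Z - 1) (L%:Z - 1))%VS).
Proof.
apply: (iffP memv_imgP) => [[g gP ->]|[h0 hN]].
  split=> [t|[|s] t Ns]; rewrite ?cf_Mz0 ?cf_MzS //.
  move/mem_Psp: gP => -> //; first by rewrite if_same.
  by rewrite negb_and -!leqNgt Ns orbT.
exists (\matrix_(i, j) cf f i.+1 j).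
  apply/mem_Psp => s t st; rewrite (mk_cf (fun i j => cf f i.+1 j)); case: ifP => // /andP[sn tm].
  move: st; rewrite negb_and -!leqNgt => /orP[Ns|mt]; last exact: hN.
  by rewrite cf_gt // negb_and -(ltnNge _ s.+1) ltnS Ns.
apply: cf_inj => -[|s] t; rewrite ?cf_Mz0 ?h0 // cf_MzS (mk_cf (fun i j => cf f i.+1 j)).
case: ifP => [tm|tm]; last first.
  by rewrite cf_gt // negb_and tm.
rewrite (ltnW tm) /=; case: ifP => // sn.
by rewrite cf_gt // sn andbF.
Qed.

Lemma Mz_inj f : f \in P (n%:Z - 1) m%:Z -> Mz f = 0 -> f = 0.
Proof.
rewrite -(Z1 m) => /mem_Psp fP zf; apply: cf_inj => s t; rewrite cf0.
have [sn|sn] := ltnP s n; last by apply: fP; rewrite ltnNge sn.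
by move: (cf_MzS f s t); rewrite zf cf0 sn.
Qed.

Lemma MzMw f : Mz (Mw f) = Mw (Mz f).
Proof.
apply: cf_inj => -[|s] [|t]; rewrite ?(cf_Mz0, cf_Mw0, cf_MzS, cf_MwS) ?if_same //.
by case: ifP; case: ifP.
Qed.

Definition pcol f t : {poly C} := \poly_(s < n.+1) cf f s t.
(** The coefficient of w^t in f(z, .). As a linear form in [f] it is what the reproducing kernels of
    a fibre represent. *)
Definition ev (z : C) t f : C := (pcol f t).[z].

Lemma pcolP a f g t : pcol (a *: f + g) t = a *: pcol f t + pcol g t.
Proof.
apply/polyP => i; rewrite coefD coefZ !coef_poly; case: ifP => _; rewrite ?cfP //.
by rewrite mulr0 addr0.
Qed.
Lemma coef_pcol f t i : (pcol f t)`_i = cf f i t.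
Proof.
rewrite coef_poly ltnS; case: ifP => // h; rewrite cf_gt //.
by rewrite negb_and h.
Qed.
Lemma pcolD f g t : pcol (f + g) t = pcol f t + pcol g t.
Proof. by rewrite -{1}[f]scale1r pcolP scale1r. Qed.
Lemma pcol0 t : pcol 0 t = 0.
Proof. by apply/polyP => i; rewrite coef_pcol cf0 coef0. Qed.
Lemma pcolZ a f t : pcol (a *: f) t = a *: pcol f t.
Proof. by rewrite -[_ *: f]addr0 pcolP pcol0 addr0. Qed.
Lemma pcolN f t : pcol (- f) t = - pcol f t.
Proof. by rewrite -scaleN1r pcolZ scaleN1r. Qed.
Lemma pcolB f g t : pcol (f - g) t = pcol f t - pcol g t.
Proof. by rewrite pcolD pcolN. Qed.
Lemma pcol_gt f t : (m < t)%N -> pcol f t = 0.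
Proof.
by move=> mt; apply/polyP => i; rewrite coef_pcol coef0 cf_gt // (leqNgt t) mt andbF.
Qed.

Lemma pcol_Mz f t : f \in P (n%:Z - 1) m%:Z -> pcol (Mz f) t = 'X * pcol f t.
Proof.
rewrite -(Z1 m) => /mem_Psp fP; apply/polyP => -[|s]; rewrite coefXM !coef_pcol ?cf_Mz0 //=.
rewrite cf_MzS; case: ltnP => // sn; rewrite fP //.
by rewrite ltnNge sn.
Qed.

Lemma ev_lin z t a f g : ev z t (a *: f + g) = a * ev z t f + ev z t g.
Proof. by rewrite /ev pcolP hornerD hornerZ. Qed.
Lemma evD z t f g : ev z t (f + g) = ev z t f + ev z t g.
Proof. by rewrite /ev pcolD hornerD. Qed.
Lemma evZ z t a f : ev z t (a *: f) = a * ev z t f.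
Proof. by rewrite /ev pcolZ hornerZ. Qed.
Lemma evB z t f g : ev z t (f - g) = ev z t f - ev z t g.
Proof. by rewrite /ev pcolB hornerD hornerN. Qed.
Lemma ev0 z t : ev z t 0 = 0. Proof. by rewrite /ev pcol0 horner0. Qed.
Lemma ev_sum z t (J : Type) (r : seq J) (Q : pred J) (F : J -> H) :
  ev z t (\sum_(i <- r | Q i) F i) = \sum_(i <- r | Q i) ev z t (F i).
Proof. by elim/big_rec2: _ => [|i a b _ <-]; rewrite ?ev0 ?evD. Qed.
Lemma ev_gt z t f : (m < t)%N -> ev z t f = 0.
Proof. by move=> h; rewrite /ev pcol_gt // horner0. Qed.
Lemma ev_Mz z t f : f \in P (n%:Z - 1) m%:Z -> ev z t (Mz f) = z * ev z t f.
Proof. by move=> fP; rewrite /ev pcol_Mz // hornerM hornerX. Qed.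
Lemma ev_Mw0 z f : ev z 0 (Mw f) = 0.
Proof.
rewrite /ev (_ : pcol _ _ = 0) ?horner0 //; apply/polyP => i.
by rewrite coef_pcol cf_Mw0 coef0.
Qed.
Lemma ev_MwS z t f : (t < m)%N -> ev z t.+1 (Mw f) = ev z t f.
Proof.
move=> tm; rewrite /ev; congr (_.[_]); apply/polyP => i.
by rewrite !coef_pcol cf_MwS tm.
Qed.
Lemma evE z t f : ev z t f = \sum_(s < n.+1) cf f s t * z ^+ s.
Proof. by rewrite /ev horner_poly. Qed.

Lemma slice0E f : slice0 f = pcol f 0.
Proof.
rewrite /slice0 /topoly horner_sum.
apply/polyP => i; rewrite coef_pcol coef_sum.
under eq_bigr => s _.
  rewrite horner_sum (bigD1 ord0) //= hornerZ expr0 hornerC mulr1 big1 => [|j j0]; last first.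
    rewrite hornerZ hornerXn expr0n (negbTE (_ : (j : nat) != 0)) ?mulr0 //.
  rewrite addr0 coefZ coefXn -cf_ord /=.
  over.
rewrite (sum_ord_delta _ (fun s => cf f s 0)); case: ifP => // h; rewrite cf_gt // negb_and.
by rewrite -ltnS h.
Qed.

Lemma eval2E f z w : eval2 f z w = \sum_(t < m.+1) ev z t f * w ^+ t.
Proof.
rewrite /eval2 /topoly.
rewrite horner_sum.
under eq_bigr => s _ do rewrite horner_sum.
rewrite horner_sum.
under eq_bigr => s _.
  rewrite horner_sum.
  under eq_bigr => t _ do rewrite hornerZ hornerXn -rmorphXn /= hornerM hornerC hornerZ hornerXn -cf_ord.
  over.
rewrite exchange_big /=; apply: eq_bigr => t _.
by rewrite evE mulr_suml.
Qed.

End Coef.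

(** * Toeplitz structure of the form, reflection, and the slice w = 0 *)

Section Form.
Variables (R : realType) (n m : nat) (T : {scalar laurent R n m}).
Hypothesis T_gt0 : positive_form T.
Local Notation C := R[i].
Local Notation H := (bipoly R n m).
Local Notation P k l := (Psp R n m k l).
Local Notation Mz := (Mz R n m).
Local Notation Mw := (Mw R n m).
Local Notation form := (dotT T_gt0).
Implicit Types (f g h : H) (s t N L : nat).

Definition tau (j k : int) : C := T (lmon R n m j k).

Lemma dot_expand f g : form f g =
  \sum_(s < n.+1) \sum_(t < m.+1) \sum_(s' < n.+1) \sum_(t' < m.+1)
    cf f s t * (cf g s' t')^* * tau (s%:Z - s'%:Z) (t%:Z - t'%:Z).
Proof.
rewrite /dotT /= /hdot /lprod linear_sum; apply: eq_bigr => s _.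
rewrite linear_sum; apply: eq_bigr => t _.
rewrite linear_sum; apply: eq_bigr => s' _.
rewrite linear_sum; apply: eq_bigr => t' _.
by rewrite linearZ /= !cf_ord.
Qed.

Lemma lprod_mon s t s' t' : (s <= n)%N -> (t <= m)%N -> (s' <= n)%N -> (t' <= m)%N ->
  lprod (mon R n m s t) (mon R n m s' t') = lmon R n m (s%:Z - s'%:Z) (t%:Z - t'%:Z).
Proof.
move=> sn tm sn' tm'; rewrite /lprod.
rewrite (bigD1 (Ordinal (sn : (s < n.+1)%N))) //= (bigD1 (Ordinal (tm : (t < m.+1)%N))) //=.
rewrite (bigD1 (Ordinal (sn' : (s' < n.+1)%N))) //= (bigD1 (Ordinal (tm' : (t' < m.+1)%N))) //=.
rewrite !mxE /= !eqxx mul1r rmorph1 scale1r !big1 ?addr0 // => i ine.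
- rewrite big1 // => j _; rewrite big1 // => k _; rewrite big1 // => l _.
  by rewrite mxE (negbTE (_ : (i != s :> nat))) ?mul0r ?scale0r.
- rewrite big1 // => j _; rewrite big1 // => k _.
  by rewrite !mxE (negbTE (_ : (i != t :> nat))) ?andbF ?mul0r ?scale0r.
- rewrite big1 // => j _.
  by rewrite !mxE (negbTE (_ : (i != s' :> nat))) ?rmorph0 ?mulr0 ?scale0r.
- by rewrite !mxE (negbTE (_ : (i != t' :> nat))) ?andbF ?rmorph0 ?mulr0 ?scale0r.
Qed.

Lemma sum_Q (F : nat -> C) N : (N <= n.+1)%N -> (forall s, (N <= s)%N -> F s = 0) ->
  \sum_(s < n.+1) F s = \sum_(s < N) F s.
Proof.
move=> Nn F0; rewrite (big_ord_widen_cond _ xpredT F Nn) [RHS]big_mkcond /=.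
by apply: eq_bigr => s _; case: ltnP => // /F0.
Qed.

Definition inQ N f := forall s t, (N <= s)%N -> cf f s t = 0.

Lemma dotQ N f g : (N <= n.+1)%N -> inQ N f -> inQ N g ->
  form f g =
  \sum_(s < N) \sum_(t < m.+1) \sum_(s' < N) \sum_(t' < m.+1)
    cf f s t * (cf g s' t')^* * tau (s%:Z - s'%:Z) (t%:Z - t'%:Z).
Proof.
move=> Nn fN gN; rewrite dot_expand.
rewrite (sum_Q (N := N) (F := fun s => \sum_(t < m.+1) \sum_(s' < n.+1) \sum_(t' < m.+1)
    cf f s t * (cf g s' t')^* * tau (s%:Z - s'%:Z) (t%:Z - t'%:Z))) //; last first.
  move=> s Ns; rewrite big1 // => t _; rewrite big1 // => s' _; rewrite big1 // => t' _.
  by rewrite fN // !mul0r.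
apply: eq_bigr => s _; apply: eq_bigr => t _.
rewrite (sum_Q (N := N) (F := fun s' => \sum_(t' < m.+1)
    cf f s t * (cf g s' t')^* * tau (s%:Z - s'%:Z) (t%:Z - t'%:Z))) //.
move=> s' Ns; rewrite big1 // => t' _.
by rewrite gN // rmorph0 mulr0 mul0r.
Qed.

Lemma PQ N f : reflect (inQ N f) (f \in P (N%:Z - 1) m%:Z).
Proof.
rewrite -(Z1 m); apply: (iffP (mem_Psp _ _ _)) => h s t st.
  by apply: h; rewrite negb_and -leqNgt st.
move: st; rewrite negb_and -!leqNgt => /orP[|mt]; first exact: h.
by rewrite cf_gt // negb_and -(ltnNge m) mt orbT.
Qed.

(** The form depends only on differences of exponents. The hypotheses exclude terms in z^n, which
    [Mz] would drop. *)
Lemma shift_z f g : inQ n f -> inQ n g -> form (Mz f) (Mz g) = form f g.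
Proof.
move=> fn gn; rewrite [RHS](dotQ (N := n)) // [LHS]dot_expand big_ord_recl big1 ?add0r => [|t _]; last first.
  by rewrite big1 // => s' _; rewrite big1 // => t' _; rewrite cf_Mz0 !mul0r.
apply: eq_bigr => s _; apply: eq_bigr => t _.
rewrite big_ord_recl big1 ?add0r => [|t' _]; last first.
  by rewrite cf_Mz0 rmorph0 mulr0 mul0r.
apply: eq_bigr => s' _; apply: eq_bigr => t' _.
rewrite !cf_MzS !ltn_ord; congr (_ * _ * tau _ _).
by rewrite /= /bump /=; lia.
Qed.

Lemma shift_w f g : (forall s, cf f s m = 0) -> (forall s, cf g s m = 0) ->
  form (Mw f) (Mw g) = form f g.
Proof.
move=> fn gn; rewrite !dot_expand.
apply: eq_bigr => s _.
rewrite [LHS]big_ord_recl [RHS]big_ord_recr /= big1 ?add0r => [|s' _]; last first.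
  by rewrite big1 // => t' _; rewrite cf_Mw0 !mul0r.
rewrite [X in _ = _ + X]big1 ?addr0 => [|s' _]; last first.
  by rewrite big1 // => t' _; rewrite fn !mul0r.
apply: eq_bigr => t _; apply: eq_bigr => s' _.
rewrite [LHS]big_ord_recl [RHS]big_ord_recr /= cf_Mw0 rmorph0 mulr0 mul0r add0r.
rewrite gn rmorph0 mulr0 mul0r addr0; apply: eq_bigr => t' _.
rewrite /bump /= !add1n !cf_MwS !ltn_ord; congr (_ * _ * tau _ _).
by lia.
Qed.

(* Reflection f |-> z^(N-1) w^m conj f(1/conj z, 1/conj w) of P_{N-1,m}. *)
Definition refl N f : H :=
  \matrix_(s, t) (if (s < N)%N then (cf f (N.-1 - s) (m - t))^* else 0).

Lemma cf_refl N f s t : (N <= n.+1)%N ->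
  cf (refl N f) s t = if (s < N)%N && (t <= m)%N then (cf f (N.-1 - s) (m - t))^* else 0.
Proof.
move=> Nn; rewrite (mk_cf _ _ (fun s t => if (s < N)%N then (cf f (N.-1 - s) (m - t))^* else 0)).
case: (ltnP s N) => sN; rewrite /= ?if_same //.
by rewrite -ltnS (leq_trans sN).
Qed.

Lemma refl_inQ N f : (N <= n.+1)%N -> inQ N (refl N f).
Proof. by move=> Nn s t Ns; rewrite cf_refl // ltnNge Ns. Qed.

(** Reversing the exponents and conjugating the coefficients exchanges the two arguments in the
    Toeplitz sum, so the reflection is antiunitary. *)
Lemma refl_dot N f g : (N <= n.+1)%N -> inQ N f -> inQ N g ->
  form (refl N f) (refl N g) = form g f.
Proof.
move=> Nn fN gN; rewrite !(dotQ (N := N)) //; try exact: refl_inQ.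
pose G s t s' t' := cf g s t * (cf f s' t')^* * tau (s%:Z - s'%:Z) (t%:Z - t'%:Z).
have rv K (x : 'I_K) : (rev_ord x = K.-1 - x :> nat)%N by rewrite /= subnS -subn1; lia.
transitivity (\sum_(s < N) \sum_(t < m.+1) \sum_(s' < N) \sum_(t' < m.+1)
   G (rev_ord s') (rev_ord t') (rev_ord s) (rev_ord t)).
  apply: eq_bigr => s _; apply: eq_bigr => t _; apply: eq_bigr => s' _; apply: eq_bigr => t' _.
  rewrite /G !rv !cf_refl // !ltn_ord !leq_ord /= conjCK [_^* * _]mulrC.
  by congr (_ * _ * tau _ _); have := ltn_ord s; have := ltn_ord s';
     have := ltn_ord t; have := ltn_ord t'; lia.
have ri K (F : 'I_K -> C) : \sum_(i < K) F (rev_ord i) = \sum_(i < K) F i.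
  by rewrite [RHS](reindex_inj rev_ord_inj).
transitivity (\sum_(s < N) \sum_(t < m.+1) \sum_(s' < N) \sum_(t' < m.+1)
   G s' t' s t).
  rewrite (ri _ (fun s : 'I_N => \sum_(t < m.+1) \sum_(s' < N) \sum_(t' < m.+1) G (rev_ord s') (rev_ord t') s (rev_ord t))).
  apply: eq_bigr => s _.
  rewrite (ri _ (fun t : 'I_m.+1 => \sum_(s' < N) \sum_(t' < m.+1) G (rev_ord s') (rev_ord t') s t)).
  apply: eq_bigr => t _.
  rewrite (ri _ (fun s' : 'I_N => \sum_(t' < m.+1) G s' (rev_ord t') s t)).
  by apply: eq_bigr => s' _; rewrite (ri _ (fun t' : 'I_m.+1 => G s' t' s t)).
transitivity (\sum_(s < N) \sum_(s' < N) \sum_(t < m.+1) \sum_(t' < m.+1) G s' t' s t).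
  by apply: eq_bigr => s _; rewrite exchange_big.
rewrite exchange_big; apply: eq_bigr => s _.
rewrite [RHS]exchange_big; apply: eq_bigr => s' _.
by rewrite exchange_big.
Qed.

Lemma ev_refl N z t f : (N <= n.+1)%N -> `|z| = 1 -> (t <= m)%N -> inQ N f ->
  ev z (m - t) (refl N f) = z ^+ N / z * (ev z t f)^*.
Proof.
move=> Nn z1 tm fN; have z0 : z != 0 by rewrite -normr_eq0 z1 oner_eq0.
rewrite !evE (sum_Q (N := N) (F := fun s => cf (refl N f) s (m - t) * z ^+ s)) //; last first.
  by move=> s Ns; rewrite refl_inQ // mul0r.
rewrite (sum_Q (N := N) (F := fun s => cf f s t * z ^+ s)) //; last first.
  by move=> s Ns; rewrite fN // mul0r.
rewrite rmorph_sum mulr_sumr [RHS](reindex_inj rev_ord_inj); apply: eq_bigr => s _.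
have zc : z^* = z^-1 by rewrite invC_norm z1 expr1n invr1 mul1r.
rewrite cf_refl // ltn_ord leq_subr /= subKn // rmorphM /= rmorphXn /= zc.
have -> : (N.-1 - s = N - s.+1)%N by lia.
have -> : z ^+ N = z ^+ (N - s.+1) * z ^+ s * z.
  by rewrite -exprD -exprSr; congr (_ ^+ _); have := ltn_ord s; lia.
by rewrite exprVn; field; rewrite expf_neq0.
Qed.

Lemma memE1 N f : (N <= n.+1)%N ->
  reflect (inQ N f /\ forall g, (forall s, cf g s 0 = 0) -> inQ N g -> form f g = 0)
    (f \in E1 T_gt0 (N%:Z - 1) m%:Z).
Proof.
move=> Nn; apply: (iffP (memv_ominus _ _ _ _)) => -[/PQ fN h]; split => //.
  by move=> g g0 gN; apply: h; apply/mem_wP; split.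
by move=> g /mem_wP[g0 gN]; apply: h.
Qed.

(** Removing the component in w P_{N-1,m-1} does not change the slice w = 0. Together with [E1_inj]
    this identifies E^1_{N-1,m} with the polynomials in z of degree below N, and every dimension
    count below goes through this identification. *)
Lemma lift_ex N (q : {poly C}) : (N <= n.+1)%N -> (size q <= N)%N ->
  exists2 f, f \in E1 T_gt0 (N%:Z - 1) m%:Z & pcol f 0 = q.
Proof.
move=> Nn qN.
pose f0 : H := \matrix_(s, t) (if t == 0 :> nat then q`_s else 0).
have f0E s t : cf f0 s t = if t == 0 then q`_s else 0.
  rewrite (mk_cf _ _ (fun s t => if t == 0 then q`_s else 0)).
  case: (t =P 0) => [->|_]; last by rewrite if_same.
  rewrite andbT; case: ifP => // /negbT; rewrite -ltnNge => h.
  by rewrite nth_default // (leq_trans qN) // (leq_trans Nn).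
have f0P : f0 \in P (N%:Z - 1) m%:Z.
  apply/PQ => s t Ns; rewrite f0E; case: ifP => // _.
  by rewrite nth_default // (leq_trans qN).
have wP : (Mw @: P (N%:Z - 1) (m%:Z - 1) <= P (N%:Z - 1) m%:Z)%VS.
  by apply/subvP => g /mem_wP[_ gN]; apply/PQ.
have [y [z [f0yz yE zw]]] := ominus_decomp form wP f0P.
exists y => //; apply/polyP => i; rewrite coef_pcol.
have /mem_wP[z0 _] := zw.
by have := f0E i 0; rewrite f0yz cfD z0 addr0.
Qed.

Lemma E1_inj N f : (N <= n.+1)%N -> f \in E1 T_gt0 (N%:Z - 1) m%:Z -> pcol f 0 = 0 -> f = 0.
Proof.
move=> Nn /(memE1 _ Nn)[fN h] f0; apply: (dot_eq0 (form := form)); apply: h => // s.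
by rewrite -coef_pcol f0 coef0.
Qed.

Lemma size_pcol N f t : inQ N f -> (size (pcol f t) <= N)%N.
Proof. by move=> fN; apply/leq_sizeP => j Nj; rewrite coef_pcol fN. Qed.

End Form.

Section PolyDim.
Variables (R : realType) (n m : nat).
Local Notation C := R[i].
Local Notation H := (bipoly R n m).

Lemma dim_inj_le (F : fieldType) (V W : vectType F) (U : {vspace V}) (X : {vspace W})
  (L : 'Hom(V, W)) : (forall f, f \in U -> L f = 0 -> f = 0) ->
  (forall f, f \in U -> L f \in X) -> (\dim U <= \dim X)%N.
Proof.
move=> inj im; rewrite -(limg_dim_eq (f := L)).
  by apply: dimvS; apply/subvP => y /memv_imgP[x xU ->]; apply: im.
apply/eqP; rewrite -subv0; apply/subvP => x; rewrite memv_cap memv_ker => /andP[xU /eqP].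
by move=> /(inj _ xU) ->; rewrite mem0v.
Qed.

(** The quotient by [D] is linear in the dividend also where [D] does not divide, so it defines a
    linear map on the whole of H, to be restricted to [U] afterwards; the same map serves in
    [dim_ge_div]. *)
Lemma dim_le_div (U : {vspace H}) (D : {poly C}) k :
  (forall f, f \in U -> pcol f 0 = 0 -> f = 0) -> D != 0 ->
  (forall f, f \in U -> exists2 q, pcol f 0 = D * q & (size q <= k)%N) ->
  (\dim U <= k)%N.
Proof.
move=> inj D0 hU.
pose q (f : H) := (pcol f 0 %/ D)%R.
pose L0 (f : H) : 'rV[C]_k := \row_(i < k) (q f)`_i.
have lL : linear L0.
  by move=> a x y; apply/rowP => i; rewrite !mxE /q pcolP divpD divpZl coefD coefZ.
pose h1 := GRing.isLinear.Build _ _ _ _ L0 lL.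
pose L : {linear H -> 'rV[C]_k} := HB.pack L0 h1.
have -> : k = \dim (fullv : {vspace 'rV[C]_k}) by rewrite dimvf /dim /= mul1n.
apply: (dim_inj_le (L := linfun L)) => [f fU|f fU]; last exact: memvf.
rewrite lfunE => /rowP h; have [r fr sr] := hU f fU.
apply: inj => //; rewrite fr; suff -> : r = 0 by rewrite mulr0.
apply/polyP => i; rewrite coef0; have [ik|ki] := ltnP i k.
  by have := h (Ordinal ik); rewrite !mxE /q fr mulKp.
by rewrite nth_default // (leq_trans sr).
Qed.

Lemma dim_ge_div (U : {vspace H}) (D : {poly C}) k : D != 0 ->
  (forall q : {poly C}, (size q <= k)%N -> exists2 f, f \in U & pcol f 0 = D * q) ->
  (k <= \dim U)%N.
Proof.
move=> D0 hU.
pose q (f : H) := (pcol f 0 %/ D)%R.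
pose L0 (f : H) : 'rV[C]_k := \row_(i < k) (q f)`_i.
have lL : linear L0.
  by move=> a x y; apply/rowP => i; rewrite !mxE /q pcolP divpD divpZl coefD coefZ.
pose h1 := GRing.isLinear.Build _ _ _ _ L0 lL.
pose L : {linear H -> 'rV[C]_k} := HB.pack L0 h1.
have {1}-> : k = \dim (fullv : {vspace 'rV[C]_k}) by rewrite dimvf /dim /= mul1n.
apply: (@leq_trans (\dim (linfun L @: U)%VS)); last first.
  by rewrite -(limg_ker_dim (linfun L) U) leq_addl.
apply: dimvS; apply/subvP => v _; have [|f fU fE] := hU (rVpoly v).
  exact: size_poly.
apply/memv_imgP; exists f => //; rewrite lfunE; apply/rowP => i; rewrite mxE /q fE mulKp //.
by rewrite coef_rVpoly_ord.
Qed.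

End PolyDim.

(** * The split-shift and matrix conditions *)

Section SplitMatrix.
Variables (R : realType) (n m : nat) (T : {scalar laurent R n m}).
Hypothesis T_gt0 : positive_form T.
Local Notation H := (bipoly R n m).
Local Notation P k l := (Psp R n m k l).
Local Notation Mz := (Mz R n m).
Local Notation Mw := (Mw R n m).
Local Notation form := (dotT T_gt0).
Local Notation D := (domT T_gt0).
Local Notation opT := (opT T_gt0).
Local Notation opA := (opA T_gt0).
Local Notation opB := (opB T_gt0).
Local Notation wE2 := (wE2 T_gt0).
Local Notation wF2 := (wF2 T_gt0).
Implicit Types (f g h : H) (s t N L : nat) (K : {vspace H}).

Lemma dim_E1 N : (N <= n.+1)%N -> \dim (E1 T_gt0 (N%:Z - 1) m%:Z) = N.
Proof.
move=> Nn; apply/eqP; rewrite eqn_leq; apply/andP; split.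
  apply: (@dim_le_div _ _ _ _ 1); rewrite ?oner_eq0 //.
    by move=> f; apply: E1_inj.
  move=> f /(memE1 _ _ Nn)[fN _]; exists (pcol f 0); first by rewrite mul1r.
  exact: size_pcol.
apply: (@dim_ge_div _ _ _ _ 1); rewrite ?oner_eq0 //.
move=> q qN; have [f fE f0] := lift_ex T_gt0 Nn qN.
by exists f; rewrite ?mul1r.
Qed.

Lemma dim_D : \dim D = n. Proof. exact: dim_E1. Qed.

Lemma memD f : reflect (inQ n f /\ forall g, (forall s, cf g s 0 = 0) -> inQ n g -> form f g = 0)
    (f \in D).
Proof. exact: memE1. Qed.

Lemma memE1n f : reflect (forall g, (forall s, cf g s 0 = 0) -> form f g = 0)
    (f \in E1 T_gt0 n%:Z m%:Z).
Proof.
have all g : inQ n.+1 g.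
  by move=> s t sn; rewrite cf_gt // negb_and -(ltnNge n) sn.
rewrite -(Z1 n); apply: (iffP (memE1 _ _ (leqnn _))) => [[_ h] g g0|h]; first exact: h.
by split => // g g0 _; apply: h.
Qed.

(** For f in E^1_{n-1,m}, the vector z f is orthogonal to the summand [Mz h] by Toeplitz invariance.
    Only the summand in [wE2], the one seen by [opA], decides whether z f lies in E^1_{n,m}. *)
Lemma wP_decompE g : (forall s, cf g s 0 = 0) -> exists h u,
  [/\ g = Mz h + u, u \in wE2, forall s, cf h s 0 = 0 & inQ n h].
Proof.
move=> g0; have : g \in (Mw @: P n%:Z (m%:Z - 1))%VS.
  rewrite -(Z1 n); apply/mem_wP; split => // s t sn.
  by rewrite cf_gt // negb_and -(ltnNge n) sn.
move=> /memv_imgP[g' g'P ->].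
have zP : (Mz @: P (n%:Z - 1) (m%:Z - 1) <= P n%:Z (m%:Z - 1))%VS.
  apply/subvP => x /mem_zP[_ h]; rewrite -(Z1 n); apply/mem_Psp => s t.
  rewrite negb_and -!leqNgt => /orP[sn|]; last exact: h.
  by rewrite cf_gt // negb_and -(ltnNge n) sn.
have [y [z [-> yE /memv_imgP[z' z'P ->]]]] := ominus_decomp form zP g'P.
exists (Mw z'), (Mw y); rewrite MzMw linearD addrC; split => //.
- exact: memv_img.
- by move=> s; rewrite cf_Mw0.
- by have /mem_wP[] : Mw z' \in (Mw @: P (n%:Z - 1) (m%:Z - 1))%VS by apply: memv_img.
Qed.

(** The unshifted counterpart: whether f itself lies in E^1_{n,m} is decided by its products with
    [wF2], hence by the range of [opB]. *)
Lemma wP_decompF g : (forall s, cf g s 0 = 0) -> exists h u,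
  [/\ g = h + u, u \in wF2, forall s, cf h s 0 = 0 & inQ n h].
Proof.
move=> g0; have : g \in (Mw @: P n%:Z (m%:Z - 1))%VS.
  rewrite -(Z1 n); apply/mem_wP; split => // s t sn.
  by rewrite cf_gt // negb_and -(ltnNge n) sn.
move=> /memv_imgP[g' g'P ->].
have zP : (P (n%:Z - 1) (m%:Z - 1) <= P n%:Z (m%:Z - 1))%VS.
  apply/subvP => x /mem_Psp h; rewrite -(Z1 n); apply/mem_Psp => s t.
  rewrite negb_and -!leqNgt => st; apply: h; rewrite negb_and -!leqNgt.
  by case/orP: st => [/ltnW ->|->]; rewrite ?orbT.
have [y [z [-> yE zz]]] := ominus_decomp form zP g'P.
exists (Mw z), (Mw y); rewrite linearD addrC; split => //.
- exact: memv_img.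
- by move=> s; rewrite cf_Mw0.
- by have /mem_wP[] : Mw z \in (Mw @: P (n%:Z - 1) (m%:Z - 1))%VS by apply: memv_img.
Qed.

Lemma wE2_0 g : g \in wE2 -> forall s, cf g s 0 = 0.
Proof. by move=> /memv_imgP[g' _ ->] s; rewrite cf_Mw0. Qed.
Lemma wF2_0 g : g \in wF2 -> forall s, cf g s 0 = 0.
Proof. by move=> /memv_imgP[g' _ ->] s; rewrite cf_Mw0. Qed.

Lemma opTE x : vsval (opT x) = proj form D (Mz (vsval x)).
Proof. exact: compressE. Qed.
Lemma opAE x : vsval (opA x) = proj form wE2 (Mz (vsval x)).
Proof. exact: compressE. Qed.
Lemma opBE x : vsval (opB x) = proj form D (vsval x).
Proof. by rewrite -[vsval x]vinclE /proj -[in RHS]comp_lfunE. Qed.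

Lemma subvs_dim_le (U : {vspace H}) (X : {vspace subvs_of U}) K :
  (forall x, x \in X -> vsval x \in K) -> (\dim X <= \dim K)%N.
Proof.
move=> h; apply: (dim_inj_le (L := vincl U)) => x xX; last by rewrite vinclE h.
by rewrite vinclE => x0; apply: subvs_inj.
Qed.

Lemma split_matrix d : split_shift T_gt0 d -> matrix_condition T_gt0 d.
Proof.
move=> [K1 [K2 [[DK /orthS K12] /orthS K1z K1E zK2E dK1]]].
rewrite -/D in DK.
have K1D : (K1 <= D)%VS by rewrite DK addvSl.
have K2D : (K2 <= D)%VS by rewrite DK addvSr.
have inK2 y : y \in D -> (forall k, k \in K1 -> form k y = 0) -> y \in K2.
  rewrite DK => /memv_addP[a aK [b bK ->]] h.
  suff -> : a = 0 by rewrite add0r.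
  by apply: (dot_eq0 (form := form)); have := h a aK; rewrite dotDr (K12 a b) // addr0.
have inK1 y : y \in D -> (forall k, k \in K2 -> form k y = 0) -> y \in K1.
  rewrite DK => /memv_addP[a aK [b bK ->]] h.
  suff -> : b = 0 by rewrite addr0.
  apply: (dot_eq0 (form := form)); have := h b bK.
  by rewrite dotDr (dot_eq0C (K12 a b aK bK)) add0r.
pose X2 := (vincl D @^-1: K2)%VS; pose X1 := (vincl D @^-1: K1)%VS.
have X2P x : (x \in X2) = (vsval x \in K2) by rewrite -memv_preim vinclE.
have X1P x : (x \in X1) = (vsval x \in K1) by rewrite -memv_preim vinclE.
(* The conditions of (2) translate one by one: K1 orthogonal to z K2 gives the invariance of K2, K1
   inside E^1_{n,m} puts the range of [opB] in K2, and z K2 inside E^1_{n,m} makes [opA] vanish on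
   K2. *)
have TX2 x : x \in X2 -> opT x \in X2.
  rewrite !X2P => xK; apply: inK2; first exact: subvsP.
  move=> k kK; rewrite opTE proj_dotr ?(subvP K1D) // K1z //.
  exact: memv_img.
have BX2 x : opB x \in X2.
  rewrite X2P; apply: inK2; first exact: subvsP.
  move=> k kK; rewrite opBE proj_dotr ?(subvP K1D) //.
  have /memE1n := subvP K1E _ kK; apply; apply: wF2_0; exact: subvsP.
have AX2 x : x \in X2 -> opA x = 0.
  rewrite X2P => xK; apply: subvs_inj; rewrite opAE.
  apply: proj_uniq; first exact: mem0v.
  move=> f fE; rewrite dot0l.
  have /memE1n := subvP zK2E _ (memv_img Mz xK); apply; exact: wE2_0.
(* Dually, the adjoints map into K1 and preserve it, as K1 is the orthogonal complement of K2 in the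
   domain. *)
have AsX1 (f : subvs_of wE2) : adjoint form opA f \in X1.
  rewrite X1P; apply: inK1; first exact: subvsP.
  move=> k kK; have -> : k = vsval (vsproj D k) by rewrite vsprojK // (subvP K2D).
  rewrite -adjointP AX2 ?dot0l // X2P vsprojK // (subvP K2D) //.
have TsX1 x : x \in X1 -> adjoint form opT x \in X1.
  rewrite !X1P => xK; apply: inK1; first exact: subvsP.
  move=> k kK; have -> : k = vsval (vsproj D k) by rewrite vsprojK // (subvP K2D).
  rewrite -adjointP; apply: (dot_eq0C (form := form)).
  apply: K12 => //; rewrite -X2P; apply: TX2.
  by rewrite X2P vsprojK // (subvP K2D).
have dK : (\dim K1 + \dim K2)%N = n.
  apply: etrans dim_D; rewrite DK dimv_disjoint_sum //.
  apply/eqP; rewrite -subv0; apply/subvP => x; rewrite memv_cap => /andP[x1 x2].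
  by rewrite memv0; apply/eqP/(dot_eq0 (form := form))/K12.
have dX1 : (\dim X1 <= d)%N.
  by rewrite -dK1; apply: subvs_dim_le => x; rewrite X1P.
have dX2 : (\dim X2 <= \dim K2)%N.
  by apply: subvs_dim_le => x; rewrite X2P.
split.
  apply: (@subv_trans _ _ X2).
    have [_] := invspaceP opT (limg opB); apply; apply/andP; split.
      by apply/subvP => y /memv_imgP[x _ ->].
    by apply/subvP => y /memv_imgP[x xX ->]; apply: TX2.
  by apply/subvP => x /AX2; rewrite memv_ker => ->.
have hA : (calA T_gt0 <= X1)%VS.
  have [_] := vspanP [set x | exists (j : nat) (f : subvs_of wE2),
    x = iter j (adjoint form opT) (adjoint form opA f)]%classic.
  apply=> x [j [f ->]]; elim: j => [|j IH] /=; first exact: AsX1.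
  exact: TsX1.
have hB : (calB T_gt0 <= X2)%VS.
  have [_] := vspanP [set x | exists (j : nat) (f : subvs_of wF2),
    x = iter j opT (opB f)]%classic.
  apply=> x [j [f ->]]; elim: j => [|j IH] /=; first exact: BX2.
  exact: TX2.
have := leq_trans (dimvS hA) dX1; have := leq_trans (dimvS hB) dX2.
by move: dK; rewrite dK1; lia.
Qed.

Lemma matrix_split d : matrix_condition T_gt0 d -> split_shift T_gt0 d.
Proof.
move=> [hI hd].
have hdn : (d <= n)%N by move: hd => /andP[_]; move: (\dim _) => b; lia.
pose cA := calA T_gt0; pose cB := calB T_gt0.
have [cAin cAmin] := vspanP [set x | exists (j : nat) (f : subvs_of wE2),
    x = iter j (adjoint form opT) (adjoint form opA f)]%classic.
have [cBin cBmin] := vspanP [set x | exists (j : nat) (f : subvs_of wF2),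
    x = iter j opT (opB f)]%classic.
rewrite -/cA in cAin cAmin; rewrite -/cB in cBin cBmin.
have TsA x : x \in cA -> adjoint form opT x \in cA.
  have : (cA <= (adjoint form opT @^-1: cA))%VS.
    apply: cAmin => y [j [f ->]]; rewrite -memv_preim; apply: cAin.
    by exists j.+1, f.
  by move=> /subvP h /h; rewrite -memv_preim.
have TB x : x \in cB -> opT x \in cB.
  have : (cB <= (opT @^-1: cB))%VS.
    apply: cBmin => y [j [f ->]]; rewrite -memv_preim; apply: cBin.
    by exists j.+1, f.
  by move=> /subvP h /h; rewrite -memv_preim.
(* The orthogonal complement of [calA], pulled back to the type on which [opT] acts: the largest
   candidate for K2, as [calB] is the smallest. *)
pose W := (vincl D @^-1: orthov form (vincl D @: cA))%VS.
have WP x : reflect (forall a, a \in cA -> form (vsval x) (vsval a) = 0) (x \in W).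
  rewrite -memv_preim vinclE; apply: (iffP (orthP _ _ _)) => h a aA.
    by apply: h; rewrite -vinclE memv_img.
  by have /memv_imgP[b bA ->] := aA; rewrite vinclE h.
have TW : (opT @: W <= W)%VS.
  apply/subvP => y /memv_imgP[x /WP xW ->]; apply/WP => a aA.
  by rewrite adjointP xW // TsA.
have [/andP[RI TI] _] := invspaceP opT (limg opB).
have BI : (cB <= invspace opT (limg opB))%VS.
  apply: cBmin => y [j [f ->]]; elim: j => [|j IH] /=.
    by rewrite (subvP RI) // memv_img // memvf.
  by rewrite (subvP TI) // memv_img.
have BA x : x \in cB -> opA x = 0.
  by move=> /(subvP BI)/(subvP hI); rewrite memv_ker => /eqP.
(* Moving the adjoints across turns a product with a generator of [calA] into a product with [opA]
   of a vector of [calB], which is 0. *)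
have BW : (cB <= W)%VS.
  apply/subvP => x xB; apply/WP.
  move=> a aA; have : (cA <= (vincl D @^-1: orthov form (vincl D @: cB)))%VS.
    apply: cAmin => y [j [f ->]]; rewrite -memv_preim vinclE; apply/orthP => b.
    move=> /memv_imgP[b' b'B ->]; rewrite vinclE; apply: (dot_eq0C (form := form)).
    elim: j b' b'B => [|j IH] b' b'B /=.
      by rewrite -adjointP BA // dot0l.
    by rewrite -adjointP IH // TB.
  move=> /subvP/(_ _ aA); rewrite -memv_preim vinclE => /orthP h.
  by apply: (dot_eq0C (form := form)); apply: h; rewrite -vinclE memv_img.
have dW : (n <= \dim W + \dim cA)%N.
  apply: (@leq_trans (\dim D)); first by rewrite dim_D.
  have -> : \dim D = \dim (ominus form D (vincl D @: cA)%VS + (vincl D @: cA))%VS.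
    congr (\dim _); apply/eqP; rewrite eqEsubv; apply/andP; split.
      apply/subvP => x xD; have AD : (vincl D @: cA <= D)%VS.
        by apply/subvP => y /memv_imgP[z _ ->]; rewrite vinclE subvsP.
      have [y [z [-> yO zA]]] := ominus_decomp form AD xD; exact: memv_add.
    rewrite subv_add capvSl; apply/subvP => y /memv_imgP[z _ ->].
    by rewrite vinclE subvsP.
  apply: leq_trans (dimv_add_leqif _ _) _; apply: leq_add; last first.
    by rewrite -(limg_ker_dim (vincl D) cA) leq_addl.
  apply: (@leq_trans (\dim (vincl D @: W)%VS)); last first.
    by rewrite -(limg_ker_dim (vincl D) W) leq_addl.
  apply: dimvS; apply/subvP => x /memv_ominus[xD xO].
  rewrite -(vsprojK xD) -vinclE; apply: memv_img; apply/WP => a aA.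
  by rewrite vsprojK // xO // -vinclE memv_img.
have TBs : (opT @: cB <= cB)%VS.
  by apply/subvP => y /memv_imgP[x xB ->]; apply: TB.
(* The dimension n - d is admissible: [calB] has dimension at most n - d, and [W] has at least n
   minus that of [calA], hence at least n - d. *)
have [|K2' [BK KW TK dK]] := @inv_between _ _ (sub_dot form D) opT _ _ (n - d)%N BW TBs TW.
  move: hd dW; rewrite -/cA -/cB; move: (\dim cA) (\dim cB) (\dim W) => a b c.
  by move=> /andP[]; rewrite -[d%:Z <= _]/(d%:Z <= n%:Z - b%:Z)%R; lia.
pose K2 := (vincl D @: K2')%VS.
have inK2 x : vsval x \in K2 = (x \in K2').
  apply/idP/idP => [/memv_imgP[y yK]|xK]; last by rewrite -vinclE memv_img.
  by rewrite vinclE => /subvs_inj ->.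
have K2D : (K2 <= D)%VS by apply/subvP => x /memv_imgP[y _ ->]; rewrite vinclE subvsP.
have K2P k : k \in K2 -> exists2 x : subvs_of D, k = vsval x & x \in K2'.
  by move=> /memv_imgP[x xK ->]; exists x; rewrite ?vinclE.
exists (ominus form D K2), K2; split.
- split.
    apply/eqP; rewrite eqEsubv; apply/andP; split.
      by apply/subvP => x xD; have [y [z [-> ? ?]]] := ominus_decomp form K2D xD; apply: memv_add.
    by rewrite subv_add capvSl.
  by apply/orthS => x y /memv_ominus[_ h] /h.
- apply/orthS => x y /memv_ominus[xD xO] /memv_imgP[k kK ->].
  have [k' kE kK'] := K2P k kK.
  rewrite -(proj_dotr form (Mz k) xD) kE -opTE; apply: xO.
  by rewrite inK2 (subvP TK) // memv_img.
- apply/subvP => x /memv_ominus[xD xO]; apply/memE1n => g /wP_decompF[h [u [-> uF h0 hn]]].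
  rewrite dotDr; have /memD[_ ->//] := xD; rewrite add0r.
  rewrite -(proj_dotr form u xD) -(vsprojK uF) -opBE; apply: xO.
  by rewrite inK2 (subvP BK) //; apply: cBin; exists 0, (vsproj wF2 u).
- apply/subvP => y /memv_imgP[k kK ->]; have [k' kE kK'] := K2P k kK.
  apply/memE1n => g /wP_decompE[h [u [-> uE h0 hn]]].
  have kD := subvP K2D _ kK; have /memD[kn kO] := kD.
  rewrite dotDr shift_z // kO // add0r -(proj_dotl form (Mz k) uE) kE -opAE.
  have /WP hW := subvP KW _ kK'.
  rewrite -(vsprojK uE) adjointP; apply: hW; apply: cAin.
  by exists 0, (vsproj wE2 u).
have dK2 : \dim K2 = (n - d)%N.
  rewrite -dK limg_dim_eq //; apply/eqP; rewrite -subv0; apply/subvP => x.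
  rewrite memv_cap memv_ker vinclE => /andP[_ /eqP x0]; rewrite memv0.
  by apply/eqP/subvs_inj.
have := dim_ominus form K2D; rewrite dim_D dK2.
by move=> h; apply/eqP; rewrite -(eqn_add2r (n - d)) h subnKC.
Qed.

End SplitMatrix.

(** * Means over the circle and the torus *)

Section ComplexIntegral.
Context d (T : measurableType d) (R : realType).
Variables (mu : {measure set T -> \bar R}) (D : set T).
Hypotheses (mD : measurable D) (muD : (mu D < +oo)%E).
Local Notation C := R[i].
Implicit Types (h k : T -> C).

(** Over a set of finite measure these functions are integrable and form an algebra stable under
    conjugation, so integrability is settled once. Only the bound is restricted to [D], where
    functions to be inverted are bounded away from 0. *)
Definition bmeas h := [/\ measurable_fun setT (fun x => complex.Re (h x)),
  measurable_fun setT (fun x => complex.Im (h x))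
  & exists M : C, forall x, D x -> `|h x| <= M].

Definition cint h : C :=
  ((\int[mu]_(x in D) complex.Re (h x)) +i* (\int[mu]_(x in D) complex.Im (h x)))%C.

Lemma ReM (x y : C) : complex.Re (x * y) =
  complex.Re x * complex.Re y - complex.Im x * complex.Im y.
Proof. by case: x y => [a b] [a' b']. Qed.
Lemma ImM (x y : C) : complex.Im (x * y) =
  complex.Re x * complex.Im y + complex.Im x * complex.Re y.
Proof. by case: x y => [a b] [a' b']. Qed.
Lemma ReD (x y : C) : complex.Re (x + y) = complex.Re x + complex.Re y.
Proof. by case: x y => [a b] [a' b']. Qed.
Lemma ImD (x y : C) : complex.Im (x + y) = complex.Im x + complex.Im y.
Proof. by case: x y => [a b] [a' b']. Qed.
Lemma Reconj (x : C) : complex.Re x^* = complex.Re x. Proof. by case: x. Qed.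
Lemma Imconj (x : C) : complex.Im x^* = - complex.Im x. Proof. by case: x. Qed.

Lemma Re_le (x M : C) : `|x| <= M -> `|complex.Re x| <= complex.Re M.
Proof.
move=> h; have := le_trans (normc_ge_Re x) h.
by rewrite lecE /= => /andP[_].
Qed.
Lemma Im_le (x M : C) : `|x| <= M -> `|complex.Im x| <= complex.Re M.
Proof.
move=> h; have -> : `|complex.Im x| = `|complex.Re (x * 'i%C)| by rewrite ReiNIm normrN.
apply: Re_le; rewrite normrM; suff -> : `|'i%C : C| = 1 by rewrite mulr1.
by rewrite complexiE normCi.
Qed.

Lemma normc_le (x : C) (M : R) : `|complex.Re x| <= M -> `|complex.Im x| <= M ->
  `|x| <= (2 * M)%:C%C.
Proof.
move=> h1 h2; have -> : x = (complex.Re x)%:C%C + 'i * (complex.Im x)%:C%C.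
  by rewrite -complexiE -complexE.
apply: le_trans (ler_normD _ _) _; rewrite normrM normCi mul1r.
have nr (r : R) : `|r%:C%C| = (`|r|)%:C%C :> C.
  by rewrite normc_def /= expr0n addr0 sqrtr_sqr.
by rewrite !nr -rmorphD lecR mulr_natl mulr2n lerD.
Qed.

Lemma bmeas_int h : bmeas h -> mu.-integrable D (EFin \o (fun x => complex.Re (h x))) /\
   mu.-integrable D (EFin \o (fun x => complex.Im (h x))).
Proof.
move=> [mR mI [M hM]]; split; apply: measurable_bounded_integrable => //.
- exact: measurable_funS mR.
- exists (complex.Re M); split; first exact: num_real.
  by move=> y My x Dx /=; apply: le_trans (ltW My); apply: Re_le; apply: hM.
- exact: measurable_funS mI.
- exists (complex.Re M); split; first exact: num_real.
  by move=> y My x Dx /=; apply: le_trans (ltW My); apply: Im_le; apply: hM.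
Qed.

Lemma bmeas_cst c : bmeas (fun=> c).
Proof.
split; [exact: measurable_cst|exact: measurable_cst|].
by exists `|c| => x _.
Qed.

Lemma bmeasD h k : bmeas h -> bmeas k -> bmeas (fun x => h x + k x).
Proof.
move=> [hR hI [M hM]] [kR kI [N kN]]; split.
- under eq_fun do rewrite ReD; exact: measurable_funD.
- under eq_fun do rewrite ImD; exact: measurable_funD.
exists (M + N) => x Dx; apply: le_trans (ler_normD _ _) _.
by apply: lerD; [apply: hM|apply: kN].
Qed.

Lemma bmeasM h k : bmeas h -> bmeas k -> bmeas (fun x => h x * k x).
Proof.
move=> [hR hI [M hM]] [kR kI [N kN]]; split.
- by under eq_fun do rewrite ReM; apply: measurable_funB; apply: measurable_funM.
- by under eq_fun do rewrite ImM; apply: measurable_funD; apply: measurable_funM.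
exists (M * N) => x Dx; rewrite normrM.
by apply: ler_pM => //; [apply: hM|apply: kN].
Qed.

Lemma bmeas_conj h : bmeas h -> bmeas (fun x => (h x)^*).
Proof.
move=> [hR hI [M hM]]; split.
- by under eq_fun do rewrite Reconj.
- by under eq_fun do rewrite Imconj; apply: measurable_funN.
by exists M => x Dx; rewrite norm_conjC; apply: hM.
Qed.

Lemma bmeasN h : bmeas h -> bmeas (fun x => - h x).
Proof.
move=> hh; have := bmeasM (bmeas_cst (-1)) hh.
by under eq_fun do rewrite mulN1r.
Qed.

Lemma bmeasB h k : bmeas h -> bmeas k -> bmeas (fun x => h x - k x).
Proof. by move=> hh hk; apply: bmeasD => //; apply: bmeasN. Qed.

Lemma bmeas_sum (I : Type) (r : seq I) (P : pred I) (F : I -> T -> C) :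
  (forall i, P i -> bmeas (F i)) -> bmeas (fun x => \sum_(i <- r | P i) F i x).
Proof.
move=> hF; elim: r => [|i r IH].
  by under eq_fun do rewrite big_nil; exact: bmeas_cst.
under eq_fun do rewrite big_cons.
by case Pi: (P i) => //; apply: bmeasD => //; apply: hF.
Qed.

Lemma bmeasX h n : bmeas h -> bmeas (fun x => h x ^+ n).
Proof.
move=> hh; elim: n => [|n IH].
  by under eq_fun do rewrite expr0; exact: bmeas_cst.
by under eq_fun do rewrite exprS; exact: bmeasM.
Qed.

Lemma bmeas_inv h (c : C) : bmeas h -> 0 < c -> (forall x, D x -> c <= `|h x|) ->
  bmeas (fun x => (h x)^-1).
Proof.
move=> [hR hI [M hM]] c0 hc.
pose n2 x := complex.Re (h x) ^+ 2 + complex.Im (h x) ^+ 2.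
have n2_ge0 x : 0 <= n2 x by rewrite addr_ge0 ?sqr_ge0.
have mi : measurable_fun setT (fun x => (n2 x)^-1).
  (* Measurability of the inverse is obtained from that of real powers. *)
  have -> : (fun x => (n2 x)^-1) = (fun x => n2 x `^ (-1)).
    by apply/funext => x; rewrite powR_inv1.
  have mn : measurable_fun setT n2.
    by apply: measurable_funD; apply: measurable_funX.
  exact: (measurableT_comp (@measurable_powR R (-1)) mn).
split.
- have -> : (fun x => complex.Re (h x)^-1) = (fun x => complex.Re (h x) * (n2 x)^-1).
    by apply/funext => x; rewrite /n2; case: (h x).
  exact: measurable_funM.
- have -> : (fun x => complex.Im (h x)^-1) = (fun x => - (complex.Im (h x) * (n2 x)^-1)).
    by apply/funext => x; rewrite /n2; case: (h x).
  by apply: measurable_funN; apply: measurable_funM.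
exists c^-1 => x Dx; rewrite normfV lef_pV2 ?posrE //; first exact: hc.
by apply: lt_le_trans (hc _ Dx).
Qed.

Lemma eq_cint h k : (forall x, D x -> h x = k x) -> cint h = cint k.
Proof.
by move=> hk; rewrite /cint; congr (_ +i* _)%C; apply: eq_Rintegral => x /set_mem Dx; rewrite hk.
Qed.

Lemma cintD h k : bmeas h -> bmeas k -> cint (fun x => h x + k x) = cint h + cint k.
Proof.
move=> /bmeas_int[hR hI] /bmeas_int[kR kI]; rewrite /cint.
under eq_Rintegral do rewrite ReD; under [X in (_ +i* X)%C]eq_Rintegral do rewrite ImD.
by rewrite !RintegralD.
Qed.

Lemma cintZ c h : bmeas h -> cint (fun x => c * h x) = c * cint h.
Proof.
move=> /bmeas_int[hR hI]; rewrite /cint.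
have iZ r f : mu.-integrable D (EFin \o f) -> mu.-integrable D (EFin \o (fun x => r * f x)).
  by move=> /(integrableZl mD r).
under eq_Rintegral do rewrite ReM; under [X in (_ +i* X)%C]eq_Rintegral do rewrite ImM.
rewrite RintegralB ?RintegralD //; try exact: iZ.
by rewrite !RintegralZl //; case: c.
Qed.

Lemma cint_conj h : bmeas h -> cint (fun x => (h x)^*) = (cint h)^*.
Proof.
move=> /bmeas_int[hR hI]; rewrite /cint.
under eq_Rintegral do rewrite Reconj.
under [X in (_ +i* X)%C]eq_Rintegral do rewrite Imconj -mulN1r.
by rewrite RintegralZl // mulN1r.
Qed.

Lemma cint0 : cint (fun=> 0) = 0.
Proof. by rewrite -[RHS](mul0r (cint (fun=> 0))) -cintZ ?mul0r //; exact: bmeas_cst. Qed.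

Lemma cint_sum (I : Type) (r : seq I) (P : pred I) (F : I -> T -> C) :
  (forall i, P i -> bmeas (F i)) ->
  cint (fun x => \sum_(i <- r | P i) F i x) = \sum_(i <- r | P i) cint (F i).
Proof.
move=> hF; elim: r => [|i r IH].
  by under eq_fun do rewrite big_nil; rewrite big_nil cint0.
rewrite big_cons; under eq_fun do rewrite big_cons.
by case Pi: (P i) => //; rewrite cintD ?IH //; [apply: hF|apply: bmeas_sum].
Qed.

Lemma cint_ge0 h : (forall x, D x -> 0 <= h x) -> 0 <= cint h.
Proof.
move=> h0; rewrite lecE /=; apply/andP; split.
  rewrite (@eq_Rintegral _ _ _ mu D (fun=> 0)); last first.
    by move=> x /set_mem Dx; have := h0 x Dx; rewrite lecE /= => /andP[/eqP].
  by rewrite Rintegral_cst // mul0r.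
by apply: Rintegral_ge0 => x Dx; have := h0 x Dx; rewrite lecE => /andP[].
Qed.

(** The factor 2 comes from estimating real and imaginary parts separately; this is harmless, since
    the bound only serves to show that errors tend to 0. *)
Lemma cint_bound h (M : C) : bmeas h -> (forall x, D x -> `|h x| <= M) ->
  `|cint h| <= 2 * M * (fine (mu D))%:C%C.
Proof.
move=> bh hM; have [hR hI] := bmeas_int bh.
(* If [D] is empty, [M] may be negative or not real. *)
have [[x0 Dx0]|D0] := pselect (exists x, D x); last first.
  have -> : cint h = 0.
    by rewrite -cint0; apply: eq_cint => x Dx; case: D0; exists x.
  have -> : D = set0 by apply/seteqP; split => x // Dx; case: D0; exists x.
  by rewrite measure0 mulr0 normr0.
have M0 : 0 <= M by apply: le_trans (hM _ Dx0).
have ME : M = (complex.Re M)%:C%C by rewrite RRe_real // ger0_real.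
have b f : mu.-integrable D (EFin \o f) -> (forall x, D x -> `|f x| <= complex.Re M) ->
   `|\int[mu]_(x in D) f x| <= complex.Re M * fine (mu D).
  move=> iF bF; apply: le_trans (le_normr_Rintegral mD iF) _.
  rewrite -(Rintegral_cst mu mD); apply: le_Rintegral => //.
    by have := integrable_norm iF.
  by apply: measurable_bounded_integrable => //; exists (complex.Re M); split => [|y /ltW My x _ /=];
     rewrite ?num_real // ger0_norm //; rewrite lecE in M0; case/andP: M0.
apply: le_trans (normc_le (M := complex.Re M * fine (mu D)) _ _) _ => /=.
- by apply: b => // x Dx; apply: Re_le; apply: hM.
- by apply: b => // x Dx; apply: Im_le; apply: hM.
by rewrite [in leRHS]ME !rmorphM /= mulrA rmorph_nat.
Qed.

End ComplexIntegral.

Section Circle.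
Context (R : realType).
Local Notation C := R[i].
Local Notation mu := (@lebesgue_measure R).
Local Notation I := (`[0%R, 2 * pi : R]%classic : set R).
Local Notation I2 := (I `*` I)%classic.
Local Notation mu2 := (mu \x mu)%E.
Definition pi2 : C := ((2 * pi : R)%:C)%C.
Implicit Types (g k : C -> C) (F G : C -> C -> C) (z w : C).
Import numFieldNormedType.Exports.
Local Open Scope classical_set_scope.

Lemma pi2_gt0 : 0 < pi2. Proof. by rewrite ltcR mulr_gt0 // pi_gt0. Qed.
Lemma pi2_neq0 : pi2 != 0. Proof. by rewrite gt_eqF // pi2_gt0. Qed.

Lemma mI : measurable I. Proof. exact: measurable_itv. Qed.
Lemma muI : mu I = (2 * pi)%:E.
Proof. by rewrite lebesgue_measure_itv /= lte_fin mulr_gt0 ?pi_gt0 // EFinN sube0. Qed.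
Lemma muIoo : (mu I < +oo)%E. Proof. by rewrite muI ltry. Qed.
Lemma mI2 : measurable I2. Proof. by apply: measurableX; exact: mI. Qed.
Lemma muI2 : mu2 I2 = ((2 * pi) * (2 * pi))%:E.
Proof.
transitivity (mu I * mu I)%E; last by rewrite muI EFinM.
by apply: product_measure1E; exact: mI.
Qed.
Lemma muI2oo : (mu2 I2 < +oo)%E. Proof. by rewrite muI2 ltry. Qed.

#[local] Hint Resolve mI mI2 muIoo muI2oo : core.

Lemma expi_norm (x : R) : `|expi x| = 1 :> C.
Proof. by rewrite /expi normc_def /= cos2Dsin2 sqrtr1. Qed.
Lemma expiX (x : R) n : expi x ^+ n = expi (n%:R * x).
Proof.
elim: n => [|n IH]; first by rewrite expr0 mul0r /expi cos0 sin0.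
rewrite exprS IH -natr1 mulrDl mul1r /expi cosD sinD.
by apply/eqP; rewrite eq_complex /= !(mulrC (_ (_ * x))) addrC; apply/andP; split; apply/eqP; ring.
Qed.

Definition cmean g : C := cint mu I (fun x => g (expi x)) / pi2.
Definition tmean F : C := torus_int F / pi2 ^+ 2.
Definition cok g := bmeas I (fun x : R => g (expi x)).
Definition tok F := bmeas I2 (fun x : R * R => F (expi x.1) (expi x.2)).

Lemma torus_cint F : torus_int F = cint mu2 I2 (fun x => F (expi x.1) (expi x.2)).
Proof. by []. Qed.

Lemma cok_ext g k : (forall z, `|z| = 1 -> g z = k z) -> cok g -> cok k.
Proof.
move=> gk; rewrite /cok (_ : (fun x => g (expi x)) = (fun x => k (expi x))) //.
by apply/funext => x; apply: gk; exact: expi_norm.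
Qed.
Lemma tok_ext F G : (forall z w, `|z| = 1 -> `|w| = 1 -> F z w = G z w) -> tok F -> tok G.
Proof.
move=> gk; rewrite /tok.
rewrite (_ : (fun x : R * R => F (expi x.1) (expi x.2)) = (fun x => G (expi x.1) (expi x.2))) //.
by apply/funext => x; apply: gk; exact: expi_norm.
Qed.

Lemma cok_id : cok id.
Proof.
split.
- exact: (continuous_measurable_fun (@continuous_cos R)).
- exact: (continuous_measurable_fun (@continuous_sin R)).
by exists 1 => x _; rewrite expi_norm.
Qed.

Lemma cok_tokz g : cok g -> tok (fun z _ => g z).
Proof.
move=> [gR gI [M hM]]; split.
- exact: (measurableT_comp gR measurable_fst).
- exact: (measurableT_comp gI measurable_fst).
by exists M => x [x1 _]; apply: hM.
Qed.
Lemma cok_tokw g : cok g -> tok (fun _ w => g w).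
Proof.
move=> [gR gI [M hM]]; split.
- exact: (measurableT_comp gR measurable_snd).
- exact: (measurableT_comp gI measurable_snd).
by exists M => x [_ x2]; apply: hM.
Qed.

Lemma cok_cst c : cok (fun=> c). Proof. exact: bmeas_cst. Qed.
Lemma cokM g k : cok g -> cok k -> cok (fun z => g z * k z). Proof. exact: bmeasM. Qed.
Lemma cokB g k : cok g -> cok k -> cok (fun z => g z - k z). Proof. exact: bmeasB. Qed.
Lemma cok_conj g : cok g -> cok (fun z => (g z)^*). Proof. exact: bmeas_conj. Qed.
Lemma cokX n : cok (fun z => z ^+ n). Proof. exact: bmeasX cok_id. Qed.
Lemma cok_sum (J : Type) (r : seq J) (P : pred J) (H : J -> C -> C) :
  (forall i, P i -> cok (H i)) -> cok (fun z => \sum_(i <- r | P i) H i z).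
Proof. exact: bmeas_sum. Qed.
Lemma cok_inv g c : cok g -> 0 < c -> (forall z, `|z| = 1 -> c <= `|g z|) ->
  cok (fun z => (g z)^-1).
Proof. by move=> hg c0 gc; apply: (bmeas_inv hg c0) => x _; apply: gc; exact: expi_norm. Qed.
Lemma cok_poly (p : {poly C}) : cok (horner p).
Proof.
apply: (@cok_ext (fun z => \sum_(i < size p) p`_i * z ^+ i)) => [z _|].
  by rewrite horner_coef.
by apply: cok_sum => i _; apply: cokM; [exact: cok_cst|exact: cokX].
Qed.
Lemma circ_conj z : `|z| = 1 -> z^* = z^-1.
Proof. by move=> z1; rewrite invC_norm z1 expr1n invr1 mul1r. Qed.
Lemma circ_neq0 z : `|z| = 1 -> z != 0.
Proof. by move=> z1; rewrite -normr_eq0 z1 oner_eq0. Qed.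
Lemma circ_conjX z (j : int) : `|z| = 1 -> (z ^ j)^* = z ^ (- j).
Proof. by move=> z1; rewrite (rmorphXz Num.conj) ?unitfE ?circ_neq0 //= circ_conj // exprz_inv. Qed.
Lemma cokXz (j : int) : cok (fun z => z ^ j).
Proof.
case: j => n; first exact: cokX.
apply: (@cok_ext (fun z => (z ^+ n.+1)^*)); last exact/cok_conj/cokX.
by move=> z z1; rewrite rmorphXn /= circ_conj // exprVn.
Qed.

Lemma tok_cst c : tok (fun _ _ => c). Proof. exact: bmeas_cst. Qed.
Lemma tokD F G : tok F -> tok G -> tok (fun z w => F z w + G z w). Proof. exact: bmeasD. Qed.
Lemma tokM F G : tok F -> tok G -> tok (fun z w => F z w * G z w). Proof. exact: bmeasM. Qed.
Lemma tokB F G : tok F -> tok G -> tok (fun z w => F z w - G z w). Proof. exact: bmeasB. Qed.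
Lemma tok_conj F : tok F -> tok (fun z w => (F z w)^*). Proof. exact: bmeas_conj. Qed.
Lemma tok_sum (J : Type) (r : seq J) (P : pred J) (H : J -> C -> C -> C) :
  (forall i, P i -> tok (H i)) -> tok (fun z w => \sum_(i <- r | P i) H i z w).
Proof.
move=> h; exact: (@bmeas_sum _ _ _ I2 J r P (fun i x => H i (expi x.1) (expi x.2))).
Qed.
Lemma tok_inv F c : tok F -> 0 < c -> (forall x, I2 x -> c <= `|F (expi x.1) (expi x.2)|) ->
  tok (fun z w => (F z w)^-1).
Proof. by move=> hg c0 gc; apply: (bmeas_inv hg c0) => x; apply: gc. Qed.

Lemma eq_cmean g k : (forall z, `|z| = 1 -> g z = k z) -> cmean g = cmean k.
Proof.
by move=> gk; rewrite /cmean; congr (_ / _); apply: eq_cint => x _; apply: gk; exact: expi_norm.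
Qed.
Lemma cmeanD g k : cok g -> cok k -> cmean (fun z => g z + k z) = cmean g + cmean k.
Proof. by move=> hg hk; rewrite /cmean cintD // -mulrDl. Qed.
Lemma cmeanZ c g : cok g -> cmean (fun z => c * g z) = c * cmean g.
Proof. by move=> hg; rewrite /cmean cintZ // mulrA. Qed.
Lemma cmean_conj g : cok g -> cmean (fun z => (g z)^*) = (cmean g)^*.
Proof.
move=> hg; rewrite /cmean cint_conj //.
by rewrite (rmorphM Num.conj) (fmorphV Num.conj) /= (conj_Creal (gtr0_real pi2_gt0)).
Qed.
Lemma cmean_sum (J : Type) (r : seq J) (P : pred J) (H : J -> C -> C) :
  (forall i, P i -> cok (H i)) ->
  cmean (fun z => \sum_(i <- r | P i) H i z) = \sum_(i <- r | P i) cmean (H i).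
Proof.
move=> h; rewrite /cmean -mulr_suml; congr (_ / _).
by rewrite (@cint_sum _ _ _ mu I mI muIoo J r P (fun i x => H i (expi x))).
Qed.
Lemma cmean_bound g M : cok g -> (forall z, `|z| = 1 -> `|g z| <= M) -> `|cmean g| <= 2 * M.
Proof.
move=> hg gM; rewrite /cmean normrM normfV (gtr0_norm pi2_gt0) ler_pdivrMr ?pi2_gt0 //.
have h : `|cint mu I (fun x => g (expi x))| <= 2 * M * (fine (mu I))%:C%C.
  by apply: cint_bound => // x _; apply: gM; exact: expi_norm.
by move: h; rewrite [X in fine X]muI.
Qed.
Lemma cmean_cst c : cmean (fun=> c) = c.
Proof.
rewrite /cmean /cint !Rintegral_cst ?muI //.
apply: (mulIf pi2_neq0); rewrite divfK ?pi2_neq0 //.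
apply/eqP; rewrite eq_complex /=; case: c => a b /=; by apply/andP; split; apply/eqP; rewrite [mu _]muI /=; ring.
Qed.

Lemma eq_tmean F G : (forall z w, `|z| = 1 -> `|w| = 1 -> F z w = G z w) -> tmean F = tmean G.
Proof.
move=> FG; rewrite /tmean !torus_cint; congr (_ / _).
by apply: eq_cint => x _; apply: FG; exact: expi_norm.
Qed.
Lemma tmeanD F G : tok F -> tok G -> tmean (fun z w => F z w + G z w) = tmean F + tmean G.
Proof.
move=> hF hG; rewrite /tmean !torus_cint -mulrDl; congr (_ / _).
by apply: cintD.
Qed.
Lemma tmeanZ c F : tok F -> tmean (fun z w => c * F z w) = c * tmean F.
Proof.
move=> hF; rewrite /tmean !torus_cint mulrA; congr (_ / _).
by apply: cintZ.
Qed.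
Lemma tmeanB F G : tok F -> tok G -> tmean (fun z w => F z w - G z w) = tmean F - tmean G.
Proof.
move=> hg hk; rewrite -mulN1r -tmeanZ // -tmeanD //; last first.
  by apply: tokM => //; exact: tok_cst.
by apply: eq_tmean => z w _ _; rewrite mulN1r.
Qed.
Lemma tmean_conj F : tok F -> tmean (fun z w => (F z w)^*) = (tmean F)^*.
Proof.
move=> hF; rewrite /tmean !torus_cint (rmorphM Num.conj) (fmorphV Num.conj) (rmorphXn Num.conj) /= (conj_Creal (gtr0_real pi2_gt0)).
by congr (_ / _); apply: cint_conj.
Qed.
Lemma tmean_sum (J : Type) (r : seq J) (P : pred J) (H : J -> C -> C -> C) :
  (forall i, P i -> tok (H i)) ->
  tmean (fun z w => \sum_(i <- r | P i) H i z w) = \sum_(i <- r | P i) tmean (H i).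
Proof.
move=> h; rewrite /tmean -mulr_suml; congr (_ / _).
by rewrite torus_cint (@cint_sum _ _ _ mu2 I2 mI2 muI2oo J r P (fun i (x : R * R) => H i (expi x.1) (expi x.2))).
Qed.
Lemma tmean_ge0 F : (forall z w, `|z| = 1 -> `|w| = 1 -> 0 <= F z w) -> 0 <= tmean F.
Proof.
move=> F0; rewrite /tmean torus_cint divr_ge0 ?exprn_ge0 ?(ltW pi2_gt0) //.
by apply: cint_ge0 => // x _; apply: F0; exact: expi_norm.
Qed.

(** The inner mean is supplied as a function [g] already known to be bounded and measurable, and
    agreement is asked only on the circle; measurability of the parametric integral never has to be
    proved. *)
Lemma torus_fubini F g : tok F -> cok g -> (forall z, `|z| = 1 -> cmean (F z) = g z) ->
  tmean F = cmean g.
Proof.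
move=> tF cg Fg.
have sec (x : R) : I x -> bmeas I (fun y => F (expi x) (expi y)).
  move=> Ix; case: tF => [mR mI' [M hM]]; split.
  - exact: (measurableT_comp mR (pair1_measurable x)).
  - exact: (measurableT_comp mI' (pair1_measurable x)).
  by exists M => y Iy; apply: (hM (x, y)).
have part (f : R * R -> R) (u : R -> R) :
    mu2.-integrable I2 (EFin \o f) ->
    (forall x, I x -> mu.-integrable I (EFin \o (fun y => f (x, y)))) ->
    mu.-integrable I (EFin \o u) ->
    (forall x, I x -> \int[mu]_(y in I) f (x, y) = u x * (2 * pi)) ->
    \int[mu2]_(x in I2) f x = (\int[mu]_(x in I) u x) * (2 * pi).
  move=> intf secf intu fu; rewrite -RintegralZr //.
  rewrite /Rintegral; congr fine.
  rewrite [LHS]integral_mkcond -integral12_prod_meas1; last first.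
    exact: (proj1 (integrable_mkcond (mu := mu2) (EFin \o f) mI2) intf).
  rewrite [RHS]integral_mkcond; apply: eq_integral => x _; rewrite /fubini_F /=.
  rewrite patchE; case: ifPn => [/set_mem Ix|/negP nIx].
    rewrite -fu // /Rintegral fineK; last first.
      apply: integrable_fin_num; [exact: mI|exact: secf].
    rewrite [RHS]integral_mkcond; apply: eq_integral => y _; rewrite !patchE.
    by rewrite (_ : ((x, y) \in I2) = (y \in I)) //; apply/idP/idP => /set_mem h;
       apply/mem_set => //; case: h.
  rewrite integral0_eq // => y _; rewrite patchE; case: ifPn => // /set_mem [Ix _].
  by case: nIx; apply/mem_set.
rewrite /tmean /cmean torus_cint /cint.
have [FR FI] := @bmeas_int _ _ _ mu2 I2 mI2 muI2oo _ tF; have [gR gI] := @bmeas_int _ _ _ mu I mI muIoo _ cg.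
have E x : cint mu I (fun y => F (expi x) (expi y)) = g (expi x) * pi2.
  by rewrite -Fg ?expi_norm // /cmean divfK // pi2_neq0.
rewrite (part _ (fun x => complex.Re (g (expi x)))) //; last 2 first.
- by move=> x Ix; have [] := @bmeas_int _ _ _ mu I mI muIoo _ (sec x Ix).
- move=> x Ix; have := congr1 (@complex.Re R) (E x).
  by rewrite /cint /= => ->; case: (g _) => a b /=; rewrite mulr0 subr0.
rewrite (part _ (fun x => complex.Im (g (expi x)))) //; last 2 first.
- by move=> x Ix; have [] := @bmeas_int _ _ _ mu I mI muIoo _ (sec x Ix).
- move=> x Ix; have := congr1 (@complex.Im R) (E x).
  by rewrite /cint /= => ->; case: (g _) => a b /=; rewrite mulr0 add0r.
set a := \int[mu]_(x in I) _; set b := \int[mu]_(x in I) _.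
have -> : ((a * (2 * pi)) +i* (b * (2 * pi)))%C = (a +i* b)%C * pi2.
  by apply/eqP; rewrite eq_complex /=; apply/andP; split; apply/eqP; ring.
by rewrite expr2 invfM mulrA mulfK // pi2_neq0.
Qed.

Lemma Rint_deriv (f G : R -> R) : continuous f ->
  (forall x : R, is_derive x 1 G (f x)) ->
  \int[mu]_(x in I) f x = G (2 * pi) - G 0.
Proof.
move=> cf dG; have ab : 0 < 2 * pi :> R by rewrite mulr_gt0 // pi_gt0.
have cG : continuous G.
  move=> x; apply: differentiable_continuous; apply/derivable1_diffP.
  by have [] := dG x.
rewrite /Rintegral (@continuous_FTC2 R f G 0 (2 * pi) ab) //.
- exact: continuous_subspaceT.
- split.
  + by move=> x _; have [] := dG x.
  + exact: cvg_at_right_filter (cG _).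
  + exact: cvg_at_left_filter (cG _).
- by move=> x _; rewrite derive1E; have [_ ->] := dG x.
Qed.

Lemma expi2pi n : expi (n%:R * (2 * pi)) = 1 :> C.
Proof.
rewrite -expiX (_ : expi (2 * pi) = 1) ?expr1n //.
by rewrite mulr_natl /expi cos2pi sin2pi.
Qed.

Lemma cmeanX n : cmean (fun z => z ^+ n) = (n == 0%N)%:R.
Proof.
case: n => [|n] /=; first by rewrite (@eq_cmean _ (fun=> 1)) ?cmean_cst // => z _; rewrite expr0.
rewrite /cmean; suff -> : cint mu I (fun x => expi x ^+ n.+1) = 0 by rewrite mul0r.
set N : R := n.+1%:R; have N0 : N != 0 by rewrite pnatr_eq0.
rewrite (@eq_cint _ _ _ mu I _ (fun x => expi (N * x))); last by move=> x _; rewrite expiX.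
have lin (x : R) : is_derive x 1 (fun x : R => N * x) N.
  have := is_deriveZ N (is_derive_id x (1 : R)).
  by rewrite /GRing.scale /= mulr1.
have [c1 s1] : cos (N * (2 * pi)) = 1 /\ sin (N * (2 * pi)) = 0.
  by have /eqP := expi2pi n.+1; rewrite eq_complex /= => /andP[/eqP -> /eqP ->].
have cN : continuous (fun x : R => N * x).
  by move=> x; apply: mulrl_continuous.
rewrite /cint /expi /=.
have cc : continuous (fun x : R => cos (N * x)).
  by move=> x; apply: continuous_comp; [exact: cN|exact: continuous_cos].
have cs : continuous (fun x : R => sin (N * x)).
  by move=> x; apply: continuous_comp; [exact: cN|exact: continuous_sin].
have dc (x : R) : is_derive x 1 (fun x => N^-1 * sin (N * x)) (cos (N * x)).
  have := is_deriveZ N^-1 (is_derive1_comp (is_derive_sin (N * x)) (lin x)).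
  by rewrite /GRing.scale /= mulrCA mulVf // mulr1.
have ds (x : R) : is_derive x 1 (fun x => (- N^-1) * cos (N * x)) (sin (N * x)).
  have := is_deriveZ (- N^-1) (is_derive1_comp (is_derive_cos (N * x)) (lin x)).
  by rewrite /GRing.scale /= mulNr mulNr mulrN opprK mulrC mulfK.
have -> := @Rint_deriv _ _ cc dc; have -> := @Rint_deriv _ _ cs ds.
by rewrite c1 s1 !mulr0 cos0 sin0 !mulr0 !subrr.
Qed.

Lemma cmeanXz (j : int) : cmean (fun z => z ^ j) = (j == 0)%:R.
Proof.
case: j => n; first exact: cmeanX.
rewrite (@eq_cmean _ (fun z => (z ^+ n.+1)^*)).
  by rewrite cmean_conj ?cmeanX /= ?rmorph0 //; exact: cokX.
by move=> z z1; rewrite (rmorphXn Num.conj) /= circ_conj // exprVn.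
Qed.

End Circle.

(** * Uniform approximation on the disk and Cauchy's formula at 0 *)

Section Approx.
Context (R : realType).
Local Notation C := R[i].
Implicit Types (f g : C -> C) (z w : C).

Lemma small0 (x K : C) : 0 <= K -> (forall e : C, 0 < e -> `|x| <= K * e) -> x = 0.
Proof.
move=> K0 h; apply/eqP; rewrite -normr_le0.
have [->|x0] := eqVneq x 0; first by rewrite normr0.
have nx : 0 < `|x| by rewrite normr_gt0.
have K1 : 0 < K + 1 by rewrite ltr_wpDl.
have := h (`|x| / (2 * (K + 1))) (divr_gt0 nx (mulr_gt0 (ltr0n _ 2) K1)).
rewrite mulrCA -[leLHS]mulr1 ler_pM2l // ler_pdivlMr ?mulr_gt0 ?ltr0n // mul1r => h2.
suff : K < K by rewrite ltxx.
apply: lt_le_trans h2; rewrite mulrDr mulr1 mulr_natl mulr2n -addrA ltrDl.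
by rewrite ltr_wpDl // ltr0n.
Qed.

Lemma geom_small (x e : C) : 0 <= x -> x < 1 -> 0 < e -> exists N, x ^+ N <= e.
Proof.
move=> x0 x1 e0.
(* Comparable to 0 means real, so the claim passes to R, which is archimedean. *)
have xE : x = (complex.Re x)%:C%C by rewrite RRe_real // ger0_real.
have eE : e = (complex.Re e)%:C%C by rewrite RRe_real // gtr0_real.
have {}x0 : 0 <= complex.Re x by rewrite -lecR -xE rmorph0.
have {}x1 : complex.Re x < 1 by rewrite -ltcR -xE rmorph1.
have {}e0 : 0 < complex.Re e by rewrite -ltcR -eE rmorph0.
rewrite xE eE; move: (complex.Re x) (complex.Re e) x0 x1 e0 => {xE eE}{}x {}e x0 x1 e0.
have [-> |xn0] := eqVneq x 0; first by exists 1%N; rewrite expr1 lecR ltW.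
have xp : 0 < x by rewrite lt_def xn0.
pose y := x^-1 - 1; have y0 : 0 < y by rewrite subr_gt0 invf_gt1.
have [N hN] : exists N : nat, e^-1 < N%:R * y.
  exists (Num.bound (e^-1 / y)); rewrite -ltr_pdivrMr //.
  by apply: archi_boundP; rewrite divr_ge0 // ?invr_ge0 ltW.
(* Bernoulli's inequality for 1/x = 1 + y. *)
have bern k : 1 + k%:R * y <= x^-1 ^+ k.
  elim: k => [|k IH]; first by rewrite mul0r addr0 expr0.
  have xy : x^-1 = 1 + y by rewrite /y addrC subrK.
  have : (1 + y) * (1 + k%:R * y) <= x^-1 ^+ k.+1.
    by rewrite exprS {1}xy ler_wpM2l // addr_ge0 // ltW.
  apply: le_trans; rewrite -natr1 -subr_ge0.
  have -> : (1 + y) * (1 + k%:R * y) - (1 + (k%:R + 1) * y) = k%:R * y ^+ 2 by ring.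
  by rewrite mulr_ge0 ?ler0n ?sqr_ge0.
exists N; rewrite -rmorphXn lecR.
rewrite -[x]invrK exprVn -[e]invrK lef_pV2 ?posrE ?exprn_gt0 ?invr_gt0 //.
apply: ltW; apply: lt_le_trans hN _; apply: le_trans (bern N).
by rewrite lerDr.
Qed.

(* The disk algebra, described by uniform approximation so that no complex differentiation is needed. *)
Definition diskalg f := forall e : C, 0 < e ->
  exists a : {poly C}, forall z, `|z| <= 1 -> `|f z - a.[z]| <= e.

Lemma diskalg_poly (a : {poly C}) : diskalg (horner a).
Proof. by move=> e e0; exists a => z _; rewrite subrr normr0 ltW. Qed.

Lemma poly_bounded (a : {poly C}) : exists2 M, 0 < M & forall z, `|z| <= 1 -> `|a.[z]| <= M.
Proof.
exists (1 + \sum_(i < size a) `|a`_i|); first by rewrite ltr_pwDl // sumr_ge0.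
move=> z z1; rewrite horner_coef; apply: le_trans (ler_norm_sum _ _ _) _.
apply: ler_wpDl => //; apply: ler_sum => i _; rewrite normrM normrX.
by rewrite -[leRHS]mulr1; apply: ler_wpM2l => //; apply: exprn_ile1.
Qed.

Lemma diskalg_bounded f : diskalg f -> exists2 M, 0 < M & forall z, `|z| <= 1 -> `|f z| <= M.
Proof.
move=> /(_ 1 ltr01)[a ha]; have [M M0 hM] := poly_bounded a.
exists (1 + M); first by rewrite addr_gt0.
move=> z z1; rewrite -[f z](subrK a.[z]); apply: le_trans (ler_normD _ _) _.
by apply: lerD; [apply: ha|apply: hM].
Qed.

Lemma diskalg_ext f g : (forall z, `|z| <= 1 -> f z = g z) -> diskalg f -> diskalg g.
Proof.
move=> fg hf e e0; have [a ha] := hf e e0; exists a => z z1.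
by rewrite -fg // ha.
Qed.

Lemma diskalg_mul f g : diskalg f -> diskalg g -> diskalg (fun z => f z * g z).
Proof.
move=> hf hg e e0.
have [M M0 hM] := diskalg_bounded hf.
have e1 : 0 < e / (2 * M) by rewrite divr_gt0 // mulr_gt0.
have [b hb] := hg _ e1.
have [N N0 hN] := poly_bounded b.
have e2 : 0 < e / (2 * N) by rewrite divr_gt0 // mulr_gt0.
have [a ha] := hf _ e2.
exists (a * b) => z z1; rewrite hornerM.
have -> : f z * g z - a.[z] * b.[z] = f z * (g z - b.[z]) + (f z - a.[z]) * b.[z] by ring.
apply: le_trans (ler_normD _ _) _; rewrite !normrM.
have -> : e = M * (e / (2 * M)) + e / (2 * N) * N.
  by field; rewrite !gt_eqF.
by apply: lerD; apply: ler_pM; rewrite ?normr_ge0 //; [exact: hM|exact: hb|exact: ha|exact: hN].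
Qed.

Lemma norm_sub_gt (r z : C) : 1 < `|r| -> `|z| <= 1 -> `|r| - 1 <= `|z - r|.
Proof.
move=> r1 z1; rewrite distrC; apply: le_trans (lerB_dist _ _).
by rewrite lerD2l lerN2.
Qed.

Lemma diskalg_inv1 (r : C) : 1 < `|r| -> diskalg (fun z => (z - r)^-1).
Proof.
move=> r1 e e0.
have r0 : r != 0 by rewrite -normr_gt0 (lt_trans ltr01).
have rr : 0 < `|r| - 1 by rewrite subr_gt0.
have x0 : 0 <= `|r|^-1 by rewrite invr_ge0.
have x1 : `|r|^-1 < 1 by rewrite invf_lt1 // (lt_trans ltr01).
(* Partial sums of the geometric series of -(1/r) / (1 - z/r); the remainder is (z/r)^N / (z - r),
   and |z - r| >= |r| - 1 fixes the precision asked of N. *)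
have [N hN] := geom_small x0 x1 (mulr_gt0 e0 rr).
exists (\sum_(j < N) (- r^-1) *: (r^-1 *: 'X) ^+ j) => z z1.
have zr : z - r != 0.
  by rewrite -normr_gt0; apply: lt_le_trans (norm_sub_gt r1 z1).
have -> : (z - r)^-1 - (\sum_(j < N) (- r^-1) *: (r^-1 *: 'X) ^+ j).[z] =
    (r^-1 * z) ^+ N / (z - r).
  rewrite horner_sum; under eq_bigr do rewrite hornerZ horner_exp hornerZ hornerX.
  rewrite -mulr_sumr; have := subrX1 (r^-1 * z) N.
  set S := \sum_(_ < N) _ => h; apply: (mulIf zr).
  rewrite mulrBl mulVf // divfK //.
  have -> : - r^-1 * S * (z - r) = - ((r^-1 * z - 1) * S) by field.
  by rewrite -h opprK subrKC.
rewrite normrM normfV normrX ler_pdivrMr ?normr_gt0 //.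
apply: le_trans (_ : e * (`|r| - 1) <= _); last first.
  by apply: ler_wpM2l; [exact: ltW|exact: norm_sub_gt].
apply: le_trans hN; rewrite normrM exprMn normfV -[leRHS]mulr1.
by apply: ler_wpM2l; rewrite ?exprn_ge0 // exprn_ile1.
Qed.

Lemma diskalg_prod (s : seq C) : (forall r, r \in s -> 1 < `|r|) ->
  diskalg (fun z => (\prod_(r <- s) (z - r))^-1).
Proof.
elim: s => [|r s IH] h.
  apply: (@diskalg_ext (horner 1)); last exact: diskalg_poly.
  by move=> z _; rewrite big_nil invr1 hornerC.
apply: (@diskalg_ext (fun z => (z - r)^-1 * (\prod_(r <- s) (z - r))^-1)).
  by move=> z _; rewrite big_cons invfM.
apply: diskalg_mul; first by apply: diskalg_inv1; apply: h; rewrite mem_head.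
by apply: IH => x xs; apply: h; rewrite in_cons xs orbT.
Qed.

Lemma cok_inv1 (r : C) : `|r| != 1 -> cok (fun z => (z - r)^-1).
Proof.
move=> r1; apply: (@cok_inv _ _ (`|1 - `|r| |)).
- by apply: cokB; [exact: cok_id|exact: cok_cst].
- by rewrite normr_gt0 subr_eq0 eq_sym.
move=> z z1; rewrite -{1}z1; exact: ler_dist_dist.
Qed.

Lemma cok_prod (s : seq C) : (forall r, r \in s -> `|r| != 1) ->
  cok (fun z => (\prod_(r <- s) (z - r))^-1).
Proof.
elim: s => [|r s IH] h.
  apply: (@cok_ext _ (fun=> 1)); last exact: cok_cst.
  by move=> z _; rewrite big_nil invr1.
apply: (@cok_ext _ (fun z => (z - r)^-1 * (\prod_(r <- s) (z - r))^-1)).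
  by move=> z _; rewrite big_cons invfM.
apply: cokM; first by apply: cok_inv1; apply: h; rewrite mem_head.
by apply: IH => x xs; apply: h; rewrite in_cons xs orbT.
Qed.

Lemma poly_factor (q : {poly C}) : q != 0 ->
  exists s : seq C, (forall z, q.[z] = lead_coef q * \prod_(r <- s) (z - r)) /\
   (forall r, r \in s -> q.[r] = 0).
Proof.
move=> q0; case: (closed_field_poly_normal q) => s qE; exists s; split.
  move=> z; rewrite {1}qE hornerZ horner_prod; congr (_ * _).
  by apply: eq_bigr => r _; rewrite hornerXsubC.
move=> r rs; apply/eqP; rewrite -[_ == 0]/(root q r) qE rootZ ?lead_coef_eq0 //.
by rewrite root_prod_XsubC.
Qed.

Lemma cok_polyV (q : {poly C}) : (forall z, `|z| = 1 -> q.[z] != 0) -> cok (fun z => (q.[z])^-1).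
Proof.
move=> qz; have q0 : q != 0.
  by apply: contraNneq (qz 1 (normr1 _)) => ->; rewrite horner0.
have [s [qE qs]] := poly_factor q0.
apply: (@cok_ext _ (fun z => (lead_coef q)^-1 * (\prod_(r <- s) (z - r))^-1)).
  by move=> z _; rewrite qE invfM.
apply: cokM; first exact: cok_cst.
apply: cok_prod => r /qs qr; apply/eqP => r1.
by have := qz r r1; rewrite qr eqxx.
Qed.

Lemma diskalg_polyV (q : {poly C}) : (forall z, `|z| <= 1 -> q.[z] != 0) -> diskalg (fun z => (q.[z])^-1).
Proof.
move=> qz; have q0 : q != 0.
  by apply: contraNneq (qz 1 _) => [->|]; rewrite ?horner0 // normr1.
have [s [qE qs]] := poly_factor q0.
apply: (@diskalg_ext (fun z => ((lead_coef q)^-1%:P).[z] * (\prod_(r <- s) (z - r))^-1)).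
  by move=> z _; rewrite qE invfM hornerC.
apply: diskalg_mul; first exact: diskalg_poly.
apply: diskalg_prod => r /qs qr; rewrite real_ltNge ?normr_real ?real1 //.
by apply/negP => r1; have := qz r r1; rewrite qr eqxx.
Qed.

Lemma cmean_poly k (a : {poly C}) : cmean (fun z => z ^+ k * a.[z]) = (k == 0%N)%:R * a.[0].
Proof.
transitivity (cmean (fun z => \sum_(i < size a) a`_i * z ^+ (k + i))).
  apply: eq_cmean => z _; rewrite horner_coef mulr_sumr.
  by apply: eq_bigr => i _; rewrite mulrCA -exprD.
rewrite cmean_sum => [|i _]; last by apply: cokM; [exact: cok_cst|exact: cokX].
under eq_bigr => i _ do rewrite (cmeanZ _ (@cokX R _)) cmeanX.
case: k => [|k] /=; last by rewrite mul0r big1 // => i _; rewrite mulr0.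
rewrite mul1r horner_coef; apply: eq_bigr => i _.
by rewrite add0n expr0n.
Qed.

Lemma cmean_hol k f : cok f -> diskalg f -> cmean (fun z => z ^+ k * f z) = (k == 0%N)%:R * f 0.
Proof.
move=> cf hf; apply/eqP; rewrite -subr_eq0; apply/eqP.
(* The constant is 2 from [cmean_bound] plus 1 for the error of the approximation at the point 0. *)
apply: (@small0 _ 3) => [|e e0]; first exact: ler0n.
have [a ha] := hf e e0.
have -> : cmean (fun z => z ^+ k * f z) - (k == 0%N)%:R * f 0 =
  cmean (fun z => z ^+ k * (f z - a.[z])) + (k == 0%N)%:R * (a.[0] - f 0).
  rewrite mulrBr -cmean_poly addrA; congr (_ - _).
  rewrite -cmeanD; first by apply: eq_cmean => z _; ring.
  - by apply: cokM; [exact: cokX|apply: cokB => //; exact: cok_poly].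
  - by apply: cokM; [exact: cokX|exact: cok_poly].
apply: le_trans (ler_normD _ _) _.
have -> : 3 * e = 2 * e + e by ring.
apply: lerD.
  apply: cmean_bound => [|z z1].
    by apply: cokM; [exact: cokX|apply: cokB => //; exact: cok_poly].
  by rewrite normrM normrX z1 expr1n mul1r ha // z1.
rewrite normrM distrC; case: (k == 0%N); rewrite ?normr1 ?normr0 ?mul1r ?mul0r.
  by apply: ha; rewrite normr0.
exact: ltW.
Qed.

(* Cauchy's formula at 0. *)
Lemma cmean_quot k (h q : {poly C}) : (forall z, `|z| <= 1 -> q.[z] != 0) ->
  cmean (fun z => z ^+ k * (h.[z] / q.[z])) = (k == 0%N)%:R * (h.[0] / q.[0]).
Proof.
move=> qz; apply: (@cmean_hol k (fun z => h.[z] / q.[z])).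
  by apply: cokM; [exact: cok_poly|apply: cok_polyV => z z1; apply: qz; rewrite z1].
by apply: diskalg_mul; [exact: diskalg_poly|exact: diskalg_polyV].
Qed.

End Approx.

(** * Lower bounds on the torus by compactness *)

Section TorusLower.
Context (R : realType).
Local Notation C := R[i].
Import numFieldNormedType.Exports.
Local Open Scope classical_set_scope.
Local Notation I := (`[0%R, 2 * pi : R] : set R).
Local Notation I2 := (I `*` I).

(** Continuity is that of the pullback to the parameter plane, where the square of parameters is
    compact. *)
Definition rcont (F : C -> C -> C) :=
  continuous (fun x : R * R => complex.Re (F (expi x.1) (expi x.2))) /\
  continuous (fun x : R * R => complex.Im (F (expi x.1) (expi x.2))).

Lemma rcont_cst c : rcont (fun _ _ => c).
Proof. by split=> x; apply: cvg_cst. Qed.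
Lemma rcont_z : rcont (fun z _ => z).
Proof.
split=> x /=; apply: (@continuous_comp _ _ _ fst).
- exact: cvg_fst.
- exact: continuous_cos.
- exact: cvg_fst.
- exact: continuous_sin.
Qed.
Lemma rcont_w : rcont (fun _ w => w).
Proof.
split=> x /=; apply: (@continuous_comp _ _ _ snd).
- exact: cvg_snd.
- exact: continuous_cos.
- exact: cvg_snd.
- exact: continuous_sin.
Qed.
Lemma rcontD F G : rcont F -> rcont G -> rcont (fun z w => F z w + G z w).
Proof.
move=> [a b] [c d]; split=> x.
  by under eq_fun do rewrite ReD; apply: continuousD; [exact: a|exact: c].
by under eq_fun do rewrite ImD; apply: continuousD; [exact: b|exact: d].
Qed.
Lemma rcontM F G : rcont F -> rcont G -> rcont (fun z w => F z w * G z w).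
Proof.
move=> [a b] [c d]; split=> x.
  under eq_fun do rewrite ReM; apply: cvgB; apply: cvgM.
  - exact: a.
  - exact: c.
  - exact: b.
  - exact: d.
under eq_fun do rewrite ImM; apply: cvgD; apply: cvgM.
- exact: a.
- exact: d.
- exact: b.
- exact: c.
Qed.
Lemma rcont_sum (J : Type) (r : seq J) (P : pred J) (H : J -> C -> C -> C) :
  (forall i, rcont (H i)) -> rcont (fun z w => \sum_(i <- r | P i) H i z w).
Proof.
move=> h; elim: r => [|i r [a b]].
  by split; under eq_fun do rewrite big_nil; move=> x; apply: cvg_cst.
suff -> : (fun z w => \sum_(j <- (i :: r) | P j) H j z w) =
  (fun z w => (if P i then H i z w else 0) + \sum_(j <- r | P j) H j z w).
  by apply: rcontD => //; case: (P i) => //; exact: rcont_cst.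
apply/funext => z; apply/funext => w; rewrite big_cons.
by case: (P i); rewrite ?add0r.
Qed.
Lemma rcontX F n : rcont F -> rcont (fun z w => F z w ^+ n).
Proof.
move=> hF; elim: n => [|n IH].
  exact: (rcont_cst 1).
suff -> : (fun z w => F z w ^+ n.+1) = (fun z w => F z w * F z w ^+ n) by exact: rcontM.
by apply/funext => z; apply/funext => w; rewrite exprS.
Qed.

(** Compactness is applied to the reciprocal of |F|^2, so that the lower bound becomes the
    boundedness of a continuous image. *)
Lemma torus_lower F : rcont F -> (forall z w, `|z| = 1 -> `|w| = 1 -> F z w != 0) ->
  exists2 c : C, 0 < c & forall x, I2 x -> c <= `|F (expi x.1) (expi x.2)|.
Proof.
move=> [a b] F0.
pose n2 (x : R * R) := complex.Re (F (expi x.1) (expi x.2)) ^+ 2 + complex.Im (F (expi x.1) (expi x.2)) ^+ 2.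
have nE x : (n2 x)%:C%C = `|F (expi x.1) (expi x.2)| ^+ 2 by rewrite add_Re2_Im2.
have n2_gt0 x : 0 < n2 x.
  by rewrite -ltcR nE exprn_gt0 // normr_gt0 F0 // expi_norm.
have cn : continuous (fun x => (n2 x)^-1 : R).
  move=> x; apply: (@continuousV _ _ n2); first by rewrite gt_eqF.
  have sq (u : R * R -> R) : continuous u -> continuous (fun x => u x ^+ 2).
    move=> cu y; rewrite (_ : (fun x => u x ^+ 2) = (fun x => u x * u x)).
      by apply: cvgM; exact: cu.
    by apply/funext => ?; rewrite expr2.
  by apply: cvgD; apply: sq.
have cpt : compact ((fun x => (n2 x)^-1 : R) @` I2).
  apply: continuous_compact; first exact: continuous_subspaceT.
  by apply: compact_setX; exact: segment_compact.
have [M [_ hM]] := compact_bounded cpt.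
pose M1 := `|M| + 1; have M1M : M < M1.
  by rewrite /M1 ltr_pwDr // ler_norm.
have M10 : 0 < M1 by rewrite /M1 ltr_wpDl.
have hx x : I2 x -> M1^-1 <= n2 x.
  move=> Ix; rewrite -[n2 x]invrK lef_pV2 ?posrE ?invr_gt0 //.
  by apply: le_trans (ler_norm _) _; apply: (hM _ M1M); exists x.
exists (Num.sqrt M1^-1)%:C%C.
  by rewrite -(rmorph0 (real_complex R)) ltcR sqrtr_gt0 invr_gt0.
move=> x Ix; rewrite normc_def lecR ler_sqrt; first exact: hx.
exact: ltW (n2_gt0 x).
Qed.

End TorusLower.

(** * The Christoffel-Darboux kernel and the Bernstein-Szego form *)

Section ToeplitzInverse.
Variables (C : numClosedFieldType) (m : nat) (q : nat -> C) (mu : int -> C).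
Implicit Types (X : nat -> nat -> C).

(* The Christoffel-Darboux recursion for the inverse of the Toeplitz matrix of 1/|q|^2. *)
Definition cd_kernel X :=
  [/\ forall t, (t <= m)%N -> X 0%N t = q 0%N * (q t)^*,
      forall t s, (t < m)%N -> (s < m)%N ->
        X t.+1 s.+1 = X t s + q t.+1 * (q s.+1)^* - (q (m - t)%N)^* * q (m - s)%N,
      forall t s, (t <= m)%N -> (s <= m)%N -> X t s = (X s t)^*
    & forall t s, (t <= m)%N -> (s <= m)%N -> X t s = X (m - s)%N (m - t)%N].

(** The recursion of [cd_kernel] solved from its first row and column. Only products of one value of
    [q] with one conjugate are added, which is why the kernel of a fibre is a Laurent polynomial in
    z of controlled degree. *)
Fixpoint cdX t s : C :=
  match t, s with
  | 0%N, _ => q 0%N * (q s)^*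
  | t'.+1, 0%N => q t * (q 0%N)^*
  | t'.+1, s'.+1 => cdX t' s' + q t * (q s)^* - (q (m - t')%N)^* * q (m - s')%N
  end.

Lemma cdX_herm t s : cdX t s = (cdX s t)^*.
Proof.
have cM (x y : C) : (x * y^*)^* = y * x^* by rewrite rmorphM /= conjCK mulrC.
have cM' (x y : C) : (x^* * y)^* = y^* * x by rewrite rmorphM /= conjCK mulrC.
elim: t s => [|t IH] [|s]; [by rewrite /= cM|by rewrite /= cM|by rewrite /= cM|].
by rewrite /= rmorphB rmorphD /= cM cM' -IH.
Qed.

Lemma cdX_diag a j : (a + j <= m)%N -> cdX a (a + j)%N = q 0%N * (q j)^* +
  \sum_(u < a) (q u.+1 * (q (u.+1 + j)%N)^* - (q (m - u)%N)^* * q (m - (u + j))%N).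
Proof.
elim: a => [|a IH] h; first by rewrite big_ord0 addr0.
rewrite addSn /= IH; last by apply: ltnW.
by rewrite big_ord_recr /= !addrA.
Qed.

(** Along a full diagonal the two products of the recursion run through the same terms in opposite
    order and cancel. This is the boundary case from which the symmetry about the antidiagonal is
    propagated. *)
Lemma cdX_edge j : (j <= m)%N -> cdX (m - j)%N m = q 0%N * (q j)^*.
Proof.
move=> jm; have := @cdX_diag (m - j) j; rewrite subnK // => ->; last exact: leqnn.
rewrite sumrB [X in _ - X](reindex_inj rev_ord_inj) /=.
rewrite [X in _ - X](eq_bigr (fun u : 'I_(m - j) => q u.+1 * (q (u.+1 + j)%N)^*)) ?subrr ?addr0 //.
move=> u _; rewrite mulrC; have := ltn_ord u => ul.
by congr (q _ * (q _)^*); lia.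
Qed.

Lemma cdX_persym t s : (t <= m)%N -> (s <= m)%N -> cdX t s = cdX (m - s)%N (m - t)%N.
Proof.
elim: t s => [|t IH] [|s] tm sm.
- by rewrite !subn0; have /= := @cdX_edge 0 (leq0n m); rewrite subn0.
- by rewrite subn0 cdX_edge.
- by rewrite subn0 [RHS]cdX_herm cdX_edge // rmorphM /= conjCK mulrC.
rewrite /= (IH _ (ltnW tm) (ltnW sm)).
have -> : (m - s = (m - s.+1).+1)%N by lia.
have -> : (m - t = (m - t.+1).+1)%N by lia.
rewrite /=; have -> : (m - (m - s.+1) = s.+1)%N by lia.
have -> : (m - (m - t.+1) = t.+1)%N by lia.
by ring.
Qed.

Lemma cdX_kernel : cd_kernel cdX.
Proof.
split=> // [t s _ _|t s tm sm]; first exact: cdX_herm.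
exact: cdX_persym.
Qed.

Hypothesis mu_conj : forall k, mu (- k) = (mu k)^*.
Hypothesis q0 : q 0%N != 0.
(** The [mu k] stand for the Fourier coefficients of 1/|q|^2 on the circle: conj(q) / |q|^2 = 1/q is
    analytic when q has no zero in the closed disk, and the right side is Cauchy's formula at 0. *)
Hypothesis mu_q : forall k : nat,
  \sum_(t < m.+1) (q t)^* * mu (k%:Z - t%:Z) = (k == 0%N)%:R / q 0%N.

Lemma mu_qc (k : nat) : (0 < k)%N -> \sum_(t < m.+1) q t * mu (t%:Z - k%:Z) = 0.
Proof.
move=> k0; transitivity ((\sum_(t < m.+1) (q t)^* * mu (k%:Z - t%:Z))^*); last first.
  by rewrite mu_q -[k == 0%N]negbK -lt0n k0 mul0r rmorph0.
rewrite rmorph_sum; apply: eq_bigr => t _.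
by rewrite rmorphM /= conjCK -mu_conj opprB.
Qed.

Section Kernel.
Variable X : nat -> nat -> C.
Hypothesis hX : cd_kernel X.

Let Y (l : int) i := \sum_(t < m.+1) X i t * mu (l - t%:Z).

Let X0 t : (t <= m)%N -> X 0%N t = q 0%N * (q t)^*. Proof. by case: hX => h _ _ _; apply: h. Qed.
Let Xrec t s : (t < m)%N -> (s < m)%N ->
  X t.+1 s.+1 = X t s + q t.+1 * (q s.+1)^* - (q (m - t)%N)^* * q (m - s)%N.
Proof. by case: hX => _ h _ _; apply: h. Qed.
Let Xh t s : (t <= m)%N -> (s <= m)%N -> X t s = (X s t)^*. Proof. by case: hX => _ _ h _; apply: h. Qed.
Let Xp t s : (t <= m)%N -> (s <= m)%N -> X t s = X (m - s)%N (m - t)%N.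
Proof. by case: hX => _ _ _ h; apply: h. Qed.
Let Xt0 t : (t <= m)%N -> X t 0%N = q t * (q 0%N)^*.
Proof. by move=> tm; rewrite Xh // X0 // rmorphM /= conjCK mulrC. Qed.
Let Xm t : (t <= m)%N -> X t m = q 0%N * (q (m - t)%N)^*.
Proof. by move=> tm; rewrite Xp // subnn X0 // leq_subr. Qed.

Lemma mu_rev (l : nat) : (l < m)%N -> \sum_(t < m.+1) q (m - t)%N * mu (l%:Z - t%:Z) = 0.
Proof.
move=> lm; rewrite (reindex_inj rev_ord_inj) /= -[RHS](@mu_qc (m - l)); last by rewrite subn_gt0.
apply: eq_bigr => t _; have := ltn_ord t => tm; rewrite subSS subKn //.
by congr (_ * mu _); lia.
Qed.

(** The two correction terms of the recursion are multiples of the orthogonality relations of [q]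
    and of the reversed [q]; what is left of them cancels against the boundary terms of the shifted
    sum. *)
Let Yrec l i : (l < m)%N -> (i < m)%N -> Y l.+1%:Z i.+1 = Y l%:Z i.
Proof.
move=> lm im; rewrite /Y big_ord_recl /= [RHS]big_ord_recr /=.
rewrite Xt0 // Xm ?(ltnW im) //.
have -> : \sum_(j < m) X i.+1 (bump 0 j) * mu (l.+1%:Z - (bump 0 j)%:Z) =
  \sum_(j < m) X i j * mu (l%:Z - j%:Z)
  + q i.+1 * \sum_(j < m) (q j.+1)^* * mu (l.+1%:Z - j.+1%:Z)
  - (q (m - i)%N)^* * \sum_(j < m) q (m - j)%N * mu (l%:Z - j%:Z).
  rewrite !mulr_sumr -!big_split -sumrB /=; apply: eq_bigr => j _.
  rewrite /bump add1n Xrec //; have -> : l.+1%:Z - j.+1%:Z = l%:Z - j%:Z by lia.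
  by ring.
have h1 := mu_q l.+1; rewrite big_ord_recl /= mul0r in h1.
have h2 := mu_rev lm; rewrite big_ord_recr /= subnn in h2.
have e1 : \sum_(j < m) (q j.+1)^* * mu (l.+1%:Z - j.+1%:Z) = - ((q 0%N)^* * mu (l.+1%:Z - 0%:Z)).
  by apply/eqP; rewrite -addr_eq0 addrC; apply/eqP.
have e2 : \sum_(j < m) q (m - j)%N * mu (l%:Z - j%:Z) = - (q 0%N * mu (l%:Z - m%:Z)).
  by apply/eqP; rewrite -addr_eq0; apply/eqP.
by rewrite e1 e2; ring.
Qed.

Let Yref l i : (l <= m)%N -> (i <= m)%N -> Y l%:Z i = (Y (m - l)%N%:Z (m - i)%N)^*.
Proof.
move=> lm im; rewrite /Y rmorph_sum (reindex_inj rev_ord_inj) /=; apply: eq_bigr => t _.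
have := ltn_ord t; rewrite ltnS => tm; rewrite subSS (rmorphM Num.conj) /= -mu_conj.
congr (_ * mu _); last by lia.
by rewrite Xp ?leq_subr // subKn // Xh // leq_subr.
Qed.

(** Row 0 is the relation [mu_q]; [Yrec] carries it along the diagonals to all i <= l, and the
    reflection [Yref] gives i > l. *)
Lemma kernel_inv i l : (i <= m)%N -> (l <= m)%N ->
  \sum_(t < m.+1) X i t * mu (l%:Z - t%:Z) = (i == l)%:R.
Proof.
have base l' : (l' <= m)%N -> Y l'%:Z 0%N = (l' == 0%N)%:R.
  move=> lm; rewrite /Y; have -> : (l' == 0%N)%:R = q 0%N * ((l' == 0%N)%:R / q 0%N) :> C.
    by rewrite mulrC divfK.
  rewrite -mu_q mulr_sumr; apply: eq_bigr => t _.
  by rewrite X0 ?mulrA // -ltnS.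
have low i' l' : (i' <= l')%N -> (l' <= m)%N -> Y l'%:Z i' = (i' == l')%:R.
  elim: i' l' => [|i' IH] [|l'] // il lm; rewrite ?base //.
  by rewrite Yrec // ?IH //; [exact: ltnW|exact: leq_trans il lm].
move=> im lm; rewrite -/(Y l%:Z i); have [il|il] := leqP i l; first exact: low.
rewrite Yref // low ?leq_subr //; last by rewrite leq_sub2l // ltnW.
rewrite conjC_nat; congr (_%:R); congr nat_of_bool.
by apply/eqP/eqP; lia.
Qed.

(* The same kernel one degree lower: it inverts the m x m Toeplitz matrix of 1/|q|^2. *)
Definition kap i t := X i t - (q (m - i)%N)^* * q (m - t)%N.

Lemma kap_inv i l : (i < m)%N -> (l < m)%N ->
  \sum_(t < m) kap i t * mu (l%:Z - t%:Z) = (i == l)%:R.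
Proof.
move=> im lm; rewrite -kernel_inv ?(ltnW im) ?(ltnW lm) // [RHS]big_ord_recr /= Xm ?(ltnW im) //.
have h2 := mu_rev lm; rewrite big_ord_recr /= subnn in h2.
have e2 : \sum_(j < m) q (m - j)%N * mu (l%:Z - j%:Z) = - (q 0%N * mu (l%:Z - m%:Z)).
  by apply/eqP; rewrite -addr_eq0; apply/eqP.
under eq_bigr => t _ do rewrite /kap mulrBl -mulrA.
by rewrite sumrB -mulr_sumr e2; ring.
Qed.

(** Row i + 1 of the larger inverse at column 0, minus [q i.+1] times the relation [mu_q 0]. The
    index -1 occurs when the coefficient of w^0 is tested against w times the kernel. *)
Lemma kap_inv0 i : (i < m)%N -> \sum_(t < m) kap i t * mu (- 1 - t%:Z) = - (q i.+1 / q 0%N).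
Proof.
move=> im; have h1 := kernel_inv (leq0n m) im.
have {h1} := @kernel_inv i.+1 0%N im isT; rewrite big_ord_recl /= Xt0 // => h1.
have h2 := mu_q 0%N; rewrite big_ord_recl /= mul1r in h2.
have -> : \sum_(t < m) kap i t * mu (-1 - t%:Z) =
   \sum_(t < m) X i.+1 (bump 0 t) * mu (0 - (bump 0 t)%:Z) -
   q i.+1 * \sum_(t < m) (q (bump 0 t))^* * mu (0 - (bump 0 t)%:Z).
  rewrite mulr_sumr -sumrB; apply: eq_bigr => t _.
  rewrite /bump add1n /kap Xrec //; have -> : 0 - t.+1%:Z = -1 - t%:Z by lia.
  by ring.
have -> : \sum_(t < m) X i.+1 (bump 0 t) * mu (0 - (bump 0 t)%:Z) = - (q i.+1 * (q 0%N)^* * mu (0%:Z - 0%:Z)).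
  by apply/eqP; rewrite -addr_eq0 addrC; apply/eqP.
have -> : \sum_(t < m) (q (bump 0 t))^* * mu (0 - (bump 0 t)%:Z) = (q 0%N)^-1 - (q 0%N)^* * mu (0%:Z - 0%:Z).
  by apply/eqP; rewrite eq_sym subr_eq addrC eq_sym; apply/eqP.
by ring.
Qed.

End Kernel.
End ToeplitzInverse.

(** * The kernel at a zero of q *)

Section KernelZero.
Variables (C : numClosedFieldType) (m : nat) (q : nat -> C) (X : nat -> nat -> C) (eta : C).
Hypotheses (hX : cd_kernel m q X) (eta1 : `|eta| <= 1).
Hypothesis Q0 : \sum_(t < m.+1) q t * eta ^+ t = 0.

Let A t := \sum_(s < m.+1) X t s * (eta ^+ s)^*.
Let B := \sum_(s < m.+1) q (m - s)%N * (eta ^+ s)^*.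

Let QC : \sum_(t < m.+1) (q t)^* * (eta ^+ t)^* = 0.
Proof.
transitivity ((\sum_(t < m.+1) q t * eta ^+ t)^*); last by rewrite Q0 rmorph0.
by rewrite rmorph_sum; apply: eq_bigr => t _; rewrite rmorphM.
Qed.

Let A0 : A 0%N = 0.
Proof.
case: hX => X0 _ _ _; rewrite /A; transitivity (q 0%N * \sum_(t < m.+1) (q t)^* * (eta ^+ t)^*).
  by rewrite mulr_sumr; apply: eq_bigr => s _; rewrite X0 ?mulrA // -ltnS.
by rewrite QC mulr0.
Qed.

Let Am : A m = (q 0%N)^* * B.
Proof.
case: hX => X0 _ Xh Xp; rewrite /A mulr_sumr; apply: eq_bigr => s _.
have sm : (s <= m)%N by rewrite -ltnS.
by rewrite Xp // subnn Xh ?leq_subr // X0 ?leq_subr // rmorphM /= conjCK mulrA.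
Qed.

Let AS t : (t < m)%N -> A t.+1 = eta^* * (A t - (q (m - t)%N)^* * B).
Proof.
move=> tm; case: hX => X0 XS Xh Xp.
rewrite /A /B big_ord_recl [in RHS]big_ord_recr [X in _ - _ * X]big_ord_recr /= subnn.
have -> : X t.+1 0%N = q t.+1 * (q 0%N)^*.
  by rewrite Xh // X0 // rmorphM /= conjCK mulrC.
have -> : X t m = q 0%N * (q (m - t)%N)^*.
  by rewrite Xp ?(ltnW tm) // subnn X0 // leq_subr.
have -> : \sum_(i < m) X t.+1 (bump 0 i) * (eta ^+ bump 0 i)^* =
   eta^* * \sum_(i < m) X t i * (eta ^+ i)^*
   + q t.+1 * \sum_(i < m) (q (bump 0 i))^* * (eta ^+ bump 0 i)^*
   - eta^* * (q (m - t)%N)^* * \sum_(i < m) q (m - i)%N * (eta ^+ i)^*.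
  rewrite !mulr_sumr -big_split -sumrB /=; apply: eq_bigr => i _.
  by rewrite /bump add1n XS // exprS rmorphM /=; ring.
have := QC; rewrite big_ord_recl /= => /eqP; rewrite addr_eq0 eq_sym eqr_oppLR => /eqP ->.
by rewrite expr0 rmorph1; ring.
Qed.

Let S := \sum_(t < m.+1) A t * eta ^+ t.

(** The Christoffel-Darboux identity on the diagonal, from which the term in |q(eta)|^2 has dropped
    out because [eta] is a zero. *)
Let S_eq : (1 - `|eta| ^+ 2) * S = - (`|eta| ^+ 2 * `|B| ^+ 2).
Proof.
have BC : \sum_(t < m) (q (m - t)%N)^* * eta ^+ t = B^* - (q 0%N)^* * eta ^+ m.
  have -> : B^* = \sum_(t < m.+1) (q (m - t)%N)^* * eta ^+ t.
    by rewrite /B rmorph_sum; apply: eq_bigr => t _; rewrite (rmorphM Num.conj) /= conjCK.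
  by rewrite big_ord_recr /= subnn addrK.
have E : S = `|eta| ^+ 2 * (S - A m * eta ^+ m - B * (B^* - (q 0%N)^* * eta ^+ m)).
  rewrite {1}/S big_ord_recl A0 mul0r add0r -BC /S big_ord_recr /= addrK mulr_sumr -sumrB mulr_sumr.
  by apply: eq_bigr => t _; rewrite /bump add1n AS // normCK exprS; ring.
rewrite mulrBl mul1r {1}E Am normCK [`|B| ^+ 2]normCK; ring.
Qed.

(** For |eta| < 1 the identity contradicts [0 <= S] unless S = 0. For |eta| = 1 it degenerates to B
    = 0, and then the recursion [AS] annihilates all the [A t] in turn. *)
Lemma cd_zero : 0 <= S -> S = 0.
Proof.
move=> S0; have [e1|e1] := eqVneq `|eta| 1.
  have B0 : B = 0.
    have /eqP := S_eq; rewrite e1 expr1n subrr mul0r mul1r eq_sym oppr_eq0 expf_eq0 /=.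
    by rewrite normr_eq0 => /eqP.
  have A00 t : (t <= m)%N -> A t = 0.
    elim: t => [|t IH] tm; first exact: A0.
    by rewrite AS // IH ?(ltnW tm) // B0 mulr0 subrr mulr0.
  by rewrite /S big1 // => t _; rewrite A00 ?mul0r // -ltnS.
have p0 : 0 < 1 - `|eta| ^+ 2.
  by rewrite subr_gt0 exprn_ilt1 // lt_def eq_sym e1 eta1.
apply/eqP; rewrite eq_le S0 andbT -(pmulr_rle0 _ p0) S_eq oppr_le0.
by rewrite mulr_ge0 // exprn_ge0.
Qed.
End KernelZero.

(** * The inner product of 1/|p|^2 on the torus and on its fibres *)

Section TorusForm.
Context (R : realType) (n m : nat).
Local Notation C := R[i].
Local Notation H := (bipoly R n m).
Variable p : H.
Hypothesis p_nz : forall z w : C, `|z| = 1 -> `|w| <= 1 -> eval2 p z w != 0.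
Local Notation q := (fun z t => ev z t p).
Implicit Types (z w : C) (u v : C -> C -> C).

Lemma tok_z : tok (fun z _ : C => z). Proof. by apply: cok_tokz; exact: cok_id. Qed.
Lemma tok_zX k : tok (fun z _ : C => z ^+ k). Proof. by apply: cok_tokz; exact: cokX. Qed.
Lemma tok_wX k : tok (fun _ w : C => w ^+ k). Proof. by apply: cok_tokw; exact: cokX. Qed.
Lemma tok_zXz k : tok (fun z _ : C => z ^ k). Proof. by apply: cok_tokz; exact: cokXz. Qed.
Lemma tok_wXz k : tok (fun _ w : C => w ^ k). Proof. by apply: cok_tokw; exact: cokXz. Qed.
Lemma cok_ev t (f : H) : cok (fun z => ev z t f). Proof. exact: cok_poly. Qed.

Lemma tok_eval2 (f : H) : tok (eval2 f).
Proof.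
apply: (@tok_ext _ (fun z w => \sum_(t < m.+1) ev z t f * w ^+ t)).
  by move=> z w _ _; rewrite eval2E.
by apply: tok_sum => t _; apply: tokM; [apply: cok_tokz; exact: cok_ev|exact: tok_wX].
Qed.

Lemma rcont_eval2 (f : H) : rcont (eval2 f).
Proof.
have -> : eval2 f = (fun z w => \sum_(t < m.+1) (\sum_(s < n.+1) cf f s t * z ^+ s) * w ^+ t).
  by apply/funext => z; apply/funext => w; rewrite eval2E; apply: eq_bigr => t _; rewrite evE.
apply: rcont_sum => t; apply: rcontM; last by apply: rcontX; exact: rcont_w.
apply: rcont_sum => s; apply: rcontM; first exact: rcont_cst.
by apply: rcontX; exact: rcont_z.
Qed.

Definition dens z w : C := (`|eval2 p z w| ^+ 2)^-1.

Lemma dens_ge0 z w : 0 <= dens z w.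
Proof. by rewrite /dens invr_ge0 exprn_ge0. Qed.
Lemma densE z w : dens z w = (eval2 p z w * (eval2 p z w)^*)^-1.
Proof. by rewrite /dens normCK. Qed.
Lemma dens_conj z w : (dens z w)^* = dens z w.
Proof. by rewrite conj_Creal // ger0_real // dens_ge0. Qed.

Lemma tok_dens : tok dens.
Proof.
have [c c0 hc] : exists2 c : C, 0 < c & forall x, (`[0%R, 2 * pi] `*` `[0%R, 2 * pi])%classic x ->
    c <= `|eval2 p (expi x.1) (expi x.2)|.
  apply: torus_lower; first exact: rcont_eval2.
  by move=> z w z1 w1; apply: p_nz => //; rewrite w1.
apply: (@tok_inv _ _ (c ^+ 2)).
- apply: (@tok_ext _ (fun z w => eval2 p z w * (eval2 p z w)^*)).
    by move=> z w _ _; rewrite normCK.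
  by apply: tokM; [|apply: tok_conj]; exact: tok_eval2.
- exact: exprn_gt0.
move=> x Ix; rewrite ger0_norm ?exprn_ge0 // lerXn2r ?nnegrE ?(ltW c0) //.
exact: hc.
Qed.

Definition wpoly z : {poly C} := \poly_(t < m.+1) q z t.
Lemma wpolyE z w : (wpoly z).[w] = eval2 p z w.
Proof. by rewrite horner_poly eval2E. Qed.

Lemma cok_fiber z : `|z| = 1 -> cok (dens z).
Proof.
move=> z1; have nz w : `|w| = 1 -> (wpoly z).[w] != 0.
  by move=> w1; rewrite wpolyE p_nz // w1.
apply: (@cok_ext _ (fun w => ((wpoly z).[w])^-1 * (((wpoly z).[w])^-1)^*)).
  by move=> w _; rewrite densE wpolyE invfM fmorphV.
by apply: cokM; [|apply: cok_conj]; exact: cok_polyV.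
Qed.

Definition mu z (k : int) : C := cmean (fun w => w ^ k * dens z w).

Lemma cok_mu z k : `|z| = 1 -> cok (fun w => w ^ k * dens z w).
Proof. by move=> z1; apply: cokM; [exact: cokXz|exact: cok_fiber]. Qed.

Lemma mu_conj z k : `|z| = 1 -> mu z (- k) = (mu z k)^*.
Proof.
move=> z1; rewrite /mu -cmean_conj; last exact: cok_mu.
by apply: eq_cmean => w w1; rewrite rmorphM /= circ_conjX // dens_conj.
Qed.

(** The conjugate of p cancels one factor of |p|^2 on the circle and leaves w^k / p(z, .); this is
    where p must have no zero with |w| < 1 either. *)
Lemma mu_q_fiber z (k : nat) : `|z| = 1 ->
  \sum_(t < m.+1) (q z t)^* * mu z (k%:Z - t%:Z) = (k == 0%N)%:R / q z 0%N.
Proof.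
move=> z1; transitivity (cmean (fun w => w ^+ k * ((1 : {poly C}).[w] / (wpoly z).[w]))).
  transitivity (\sum_(t < m.+1) cmean (fun w => (q z t)^* * (w ^ (k%:Z - t%:Z) * dens z w))).
    by apply: eq_bigr => t _; rewrite cmeanZ //; exact: cok_mu.
  rewrite -(@cmean_sum R _ _ _ (fun (t : 'I_m.+1) w => (q z t)^* * (w ^ (k%:Z - t%:Z) * dens z w))); last first.
    by move=> t _; apply: cokM; [exact: cok_cst|exact: cok_mu].
  apply: eq_cmean => w w1; have w0 := circ_neq0 w1.
  have pz : eval2 p z w != 0 by rewrite p_nz // w1.
  rewrite wpolyE hornerC.
  have -> : \sum_(t < m.+1) (q z t)^* * (w ^ (k%:Z - t%:Z) * dens z w) =
     w ^+ k * (eval2 p z w)^* * dens z w.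
    rewrite eval2E rmorph_sum mulr_sumr mulr_suml; apply: eq_bigr => t _.
    by rewrite expfzDr // -exprnN (rmorphM Num.conj) (rmorphXn Num.conj) /= (circ_conj w1) exprVn -exprnP; ring.
  by rewrite densE; field; rewrite pz fmorph_eq0.
rewrite cmean_quot; last by move=> w w1; rewrite wpolyE p_nz.
rewrite hornerC wpolyE eval2E big_ord_recl /= expr0 mulr1 big1 ?addr0 ?mul1r // => t _.
by rewrite expr0n mulr0.
Qed.

Lemma q0_neq0 z : `|z| = 1 -> q z 0%N != 0.
Proof.
move=> z1; have := p_nz z1 (_ : `|0| <= 1); rewrite normr0 => /(_ ler01).
by rewrite eval2E big_ord_recl /= expr0 mulr1 big1 ?addr0 // => t _; rewrite expr0n mulr0.
Qed.

Lemma fiber_sum z A B (a b : nat -> C) (sa sb : int) : `|z| = 1 ->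
  cmean (fun w => (\sum_(i < A) a i * w ^ (i%:Z + sa)) * (\sum_(j < B) b j * w ^ (j%:Z + sb))^* * dens z w) =
  \sum_(i < A) \sum_(j < B) a i * (b j)^* * mu z (i%:Z + sa - (j%:Z + sb)).
Proof.
move=> z1.
transitivity (cmean (fun w => \sum_(i < A) \sum_(j < B) a i * (b j)^* * (w ^ (i%:Z + sa - (j%:Z + sb)) * dens z w))).
  apply: eq_cmean => w w1; have w0 := circ_neq0 w1.
  rewrite -mulrA mulr_suml; apply: eq_bigr => i _.
  rewrite mulrA rmorph_sum mulr_sumr mulr_suml; apply: eq_bigr => j _.
  have -> : w ^ (i%:Z + sa - (j%:Z + sb)) = w ^ (i%:Z + sa) * w ^ (- (j%:Z + sb)).
    by rewrite -expfzDr.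
  by rewrite rmorphM /= (circ_conjX _ w1); ring.
have ck i j : cok (fun w => a i * (b j)^* * (w ^ (i%:Z + sa - (j%:Z + sb)) * dens z w)).
  by apply: cokM; [exact: cok_cst|exact: cok_mu].
rewrite cmean_sum; last by move=> i _; apply: cok_sum => j _.
apply: eq_bigr => i _; rewrite cmean_sum //; apply: eq_bigr => j _.
by rewrite cmeanZ //; exact: cok_mu.
Qed.

Definition G u v : C := tmean (fun z w => u z w * (v z w)^* * dens z w).

Lemma tokG u v : tok u -> tok v -> tok (fun z w => u z w * (v z w)^* * dens z w).
Proof. by move=> hu hv; apply: tokM; [apply: tokM => //; exact: tok_conj|exact: tok_dens]. Qed.

Lemma eqG u u' v v' : (forall z w, `|z| = 1 -> `|w| = 1 -> u z w = u' z w) ->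
  (forall z w, `|z| = 1 -> `|w| = 1 -> v z w = v' z w) -> G u v = G u' v'.
Proof. by move=> h1 h2; apply: eq_tmean => z w z1 w1; rewrite h1 // h2. Qed.

Lemma G_conj u v : tok u -> tok v -> G v u = (G u v)^*.
Proof.
move=> hu hv; rewrite /G -tmean_conj; last exact: tokG.
by apply: eq_tmean => z w _ _; rewrite !rmorphM /= conjCK dens_conj [(u z w)^* * _]mulrC.
Qed.
Lemma GDl u u' v : tok u -> tok u' -> tok v ->
  G (fun z w => u z w + u' z w) v = G u v + G u' v.
Proof.
move=> h1 h2 h3; rewrite /G -tmeanD; [|exact: tokG..].
by apply: eq_tmean => z w _ _; ring.
Qed.
Lemma GZl c u v : tok u -> tok v -> G (fun z w => c * u z w) v = c * G u v.
Proof.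
move=> h1 h3; rewrite /G -tmeanZ; [|exact: tokG..].
by apply: eq_tmean => z w _ _; ring.
Qed.
Lemma GDr u v v' : tok u -> tok v -> tok v' ->
  G u (fun z w => v z w + v' z w) = G u v + G u v'.
Proof.
move=> h1 h2 h3; rewrite /G -tmeanD; [|exact: tokG..].
by apply: eq_tmean => z w _ _; rewrite rmorphD; ring.
Qed.
Lemma GZr c u v : tok u -> tok v -> G u (fun z w => c * v z w) = c^* * G u v.
Proof.
move=> h1 h3; rewrite /G -tmeanZ; [|exact: tokG..].
by apply: eq_tmean => z w _ _; rewrite rmorphM; ring.
Qed.
Lemma G_suml (J : Type) (r : seq J) (P : pred J) (U : J -> C -> C -> C) v :
  (forall i, P i -> tok (U i)) -> tok v ->
  G (fun z w => \sum_(i <- r | P i) U i z w) v = \sum_(i <- r | P i) G (U i) v.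
Proof.
move=> hU hv; rewrite /G -tmean_sum; last by move=> i Pi; apply: tokG => //; exact: hU.
by apply: eq_tmean => z w _ _; rewrite !mulr_suml.
Qed.
Lemma G_sumr (J : Type) (r : seq J) (P : pred J) (U : J -> C -> C -> C) v :
  (forall i, P i -> tok (U i)) -> tok v ->
  G v (fun z w => \sum_(i <- r | P i) U i z w) = \sum_(i <- r | P i) G v (U i).
Proof.
move=> hU hv; rewrite /G -tmean_sum; last by move=> i Pi; apply: tokG => //; exact: hU.
by apply: eq_tmean => z w _ _; rewrite rmorph_sum mulr_sumr mulr_suml.
Qed.
Lemma G_ge0 u : 0 <= G u u.
Proof.
apply: tmean_ge0 => z w _ _; apply: mulr_ge0; last exact: dens_ge0.
by rewrite -normCK exprn_ge0.
Qed.

(** [G] acts on functions, where it is only semidefinite. If G v v = 0, a second test combination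
    shows that G u v = 0. *)
Lemma G_CS u v : tok u -> tok v -> `|G u v| ^+ 2 <= G u u * G v v.
Proof.
move=> hu hv; set a := G u u; set b := G u v; set c := G v v.
have a0 : 0 <= a := G_ge0 u; have c0 : 0 <= c := G_ge0 v.
have key (x y : C) : 0 <= `|x| ^+ 2 * a - (x * y^* * b + x^* * y * b^*) + `|y| ^+ 2 * c.
  have := G_ge0 (fun z w => x * u z w + - y * v z w).
  have t1 : tok (fun z w => x * u z w) by apply: tokM => //; exact: tok_cst.
  have t2 : tok (fun z w => - y * v z w) by apply: tokM => //; exact: tok_cst.
  have t3 := tokD t1 t2.
  rewrite (GDl t1 t2 t3) (GDr t1 t1 t2) (GDr t2 t1 t2) !GZl // !GZr // (G_conj hu hv) -/a -/b -/c !normCK.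
  by move=> h; apply: le_trans h _; rewrite le_eqVlt; apply/orP; left; apply/eqP; rewrite rmorphN; ring.
have [cE|cn] := eqVneq c 0.
  have [bE|bn] := eqVneq b 0; first by rewrite bE normr0 expr0n cE mulr0.
  have ar : a^* = a by rewrite conj_Creal // ger0_real.
  have bc : b^* != 0 by rewrite fmorph_eq0.
  (* With this coefficient the expression in [key] equals a - 2 (a + 1) = -(a + 2), which is
     negative. *)
  have yE : ((a + 1) / b^*)^* = (a + 1) / b.
    by rewrite (rmorphM Num.conj) (fmorphV Num.conj) /= conjCK (rmorphD Num.conj) (rmorph1 Num.conj) /= ar.
  have := key 1 ((a + 1) / b^*); rewrite yE cE mulr0 addr0 normr1 expr1n rmorph1 !mul1r.
  rewrite !divfK // => h.
  have a2 : 0 < a + 2 by rewrite ltr_wpDl // ltr0n.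
  suff : a + 2 <= 0 by move=> /(lt_le_trans a2); rewrite ltxx.
  rewrite -oppr_ge0; apply: le_trans h _; rewrite le_eqVlt; apply/orP; left; apply/eqP; ring.
have cp : 0 < c by rewrite lt_def cn.
have cr : c^* = c by rewrite conj_Creal // ger0_real.
have := key c b; rewrite !normCK cr => h.
rewrite -subr_ge0 -(pmulr_rge0 _ cp); apply: le_trans h _.
by rewrite le_eqVlt; apply/orP; left; apply/eqP; ring.
Qed.

Lemma G_fiber u v g : tok u -> tok v -> cok g ->
  (forall z, `|z| = 1 -> cmean (fun w => u z w * (v z w)^* * dens z w) = g z) ->
  G u v = cmean g.
Proof. by move=> hu hv hg h; apply: torus_fubini => //; exact: tokG. Qed.

Lemma torus_moment (j k : int) : torus_int (fun z w =>
     z ^ j * w ^ k / (pi2 R ^+ 2 * `|eval2 p z w| ^+ 2)) =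
   tmean (fun z w => z ^ j * w ^ k * dens z w).
Proof.
have tk : tok (fun z w => z ^ j * w ^ k * dens z w).
  by apply: tokM; [apply: tokM; [exact: tok_zXz|exact: tok_wXz]|exact: tok_dens].
have p0 : pi2 R ^+ 2 != 0 by rewrite expf_neq0 // pi2_neq0.
apply: (mulIf (invr_neq0 p0)); rewrite -[LHS]/(tmean _) mulrC -tmeanZ //.
by apply: eq_tmean => z w _ _; rewrite invfM mulrA [RHS]mulrC /dens; ring.
Qed.

End TorusForm.

(** * From the split-shift condition to the Bernstein-Szego condition *)

Section Representers.
Variables (R : realType) (n m : nat) (T : {scalar laurent R n m}).
Hypothesis T_gt0 : positive_form T.
Local Notation C := R[i].
Local Notation H := (bipoly R n m).
Local Notation P k l := (Psp R n m k l).
Local Notation Mw := (Mw R n m).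
Local Notation form := (dotT T_gt0).
Implicit Types (f g h x y : H) (s t N L : nat) (M : {vspace H}).
Variable z : C.
Hypothesis z1 : `|z| = 1.

Lemma reflK N f : (N <= n.+1)%N -> inQ N f -> refl N (refl N f) = f.
Proof.
move=> Nn fN; apply: cf_inj => s t; rewrite cf_refl //.
have [sN|sN] := ltnP s N; last by rewrite fN.
have [tm|tm] := leqP t m; last by rewrite /= cf_gt // negb_and -(ltnNge m) tm orbT.
have s1 : (s <= N.-1)%N by rewrite -ltnS prednK // (leq_ltn_trans _ sN).
rewrite /= cf_refl // leq_subr andbT subKn // subKn //.
by rewrite (leq_ltn_trans (leq_subr _ _)) ?conjCK // prednK // (leq_ltn_trans _ sN).
Qed.

(** For fixed t, the t-th element of the reproducing kernel of [M] on the fibre over z. The entries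
    of the kernel are [ev z t] of the representer of index s. *)
Definition rep M t x := x \in M /\ forall f, f \in M -> form f x = ev z t f.

Lemma rep_ex M t : exists x, rep M t x.
Proof.
have [y hy] := @riesz _ _ form (ev z t) (ev_lin z t).
exists (proj form M y); split; first exact: proj_mem.
by move=> f fM; rewrite proj_dotr // hy.
Qed.

Lemma rep_uniq M t x y : rep M t x -> rep M t y -> x = y.
Proof. by move=> [xM hx] [yM hy]; apply: (@orth_uniq _ _ form M) => // f fM; rewrite hx ?hy. Qed.

Lemma rep_sum (M1 M2 K : {vspace H}) t x y :
  (forall f, f \in K -> exists a b, [/\ f = a + b, a \in M1 & b \in M2]) ->
  (M1 <= K)%VS -> (M2 <= K)%VS ->
  (forall a b, a \in M1 -> b \in M2 -> form a b = 0) ->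
  rep M1 t x -> rep M2 t y -> rep K t (x + y).
Proof.
move=> dec MK NK orth [xM hx] [yN hy]; split.
  by apply: rpredD; [apply: (subvP MK)|apply: (subvP NK)].
move=> f /dec[a [b [-> aM bN]]].
by rewrite dotDl !dotDr (hx a aM) (hy b bN) (orth a y aM yN) (dot_eq0C (orth _ _ xM bN)) addr0 add0r evD.
Qed.

(** The conjugate of the unimodular factor in [ev_refl]: it multiplies the representer, in which the
    form is conjugate-linear. *)
Definition cN N : C := (z ^+ N / z)^*.
Lemma cN_norm N : cN N * (cN N)^* = 1.
Proof. by rewrite -normCK /cN norm_conjC normrM normfV normrX z1 expr1n divr1 expr1n. Qed.

Section Step.
Variable N : nat.
Hypothesis Nn : (N <= n.+1)%N.
Local Notation Q := (P (N%:Z - 1) m%:Z).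
Local Notation Q' := (P (N%:Z - 1) (m%:Z - 1)).
Local Notation E := (E1 T_gt0 (N%:Z - 1) m%:Z).
Variables y e : nat -> H.
Hypotheses (hy : forall t, (t <= m)%N -> rep Q t (y t)) (he : forall t, (t <= m)%N -> rep E t (e t)).

Let wQ : (Mw @: Q' <= Q)%VS.
Proof. by apply/subvP => g /mem_wP[_ gN]; apply/PQ. Qed.

Let Q'P f : reflect (inQ N f /\ forall s, cf f s m = 0) (f \in Q').
Proof.
have [m0|m0] := posnP m.
  apply: (iffP idP) => [|[_ h]]; last first.
    suff -> : f = 0 by rewrite mem0v.
    apply: cf_inj => s [|t]; rewrite cf0; first by have := h s; rewrite [X in cf f s X]m0.
    by rewrite cf_gt // negb_and -(ltnNge m) m0 orbT.
  move=> /mem_Psp h; split => [s t _|s]; apply: h; rewrite m0 andbF //.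
apply: (iffP (mem_Psp _ _ _)) => [h|[h1 h2] s t].
  split=> [s t Ns|s]; apply: h; first by rewrite ltnNge Ns.
  by rewrite ltnn andbF.
rewrite negb_and -!leqNgt => /orP[|mt]; first exact: h1.
have [->|tm] := eqVneq t m; first exact: h2.
by rewrite cf_gt // negb_and -(ltnNge m) ltn_neqAle eq_sym tm mt orbT.
Qed.

Let rep_refl t : (t <= m)%N -> y (m - t)%N = cN N *: refl N (y t).
Proof.
move=> tm; apply: (@rep_uniq Q (m - t)); first by apply: hy; exact: leq_subr.
have [yQ hyt] := hy tm; have yN := elimT (PQ _ _) yQ; split.
  by rewrite rpredZ //; apply/PQ; exact: refl_inQ.
move=> f /PQ fN.
rewrite -[f](reflK Nn fN).
rewrite dotZr refl_dot //; try exact: refl_inQ.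
rewrite ev_refl //; last exact: refl_inQ.
rewrite /cN conjCK dotC hyt //; apply/PQ; exact: refl_inQ.
Qed.

Lemma rep_herm t s : (t <= m)%N -> (s <= m)%N -> ev z t (y s) = (ev z s (y t))^*.
Proof.
move=> tm sm; have [yt ht] := hy tm; have [ys hs] := hy sm.
by rewrite -ht // -hs // -dotC.
Qed.

Lemma rep_persym t s : (t <= m)%N -> (s <= m)%N ->
  ev z t (y s) = ev z (m - s) (y (m - t)%N).
Proof.
move=> tm sm; have -> : y s = y (m - (m - s))%N by rewrite subKn.
rewrite rep_refl ?leq_subr // evZ.
have [/PQ yN _] := hy (leq_subr s m).
have -> : ev z t (refl N (y (m - s)%N)) = ev z (m - (m - t)) (refl N (y (m - s)%N)) by rewrite subKn.
rewrite ev_refl ?leq_subr // mulrA.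
have -> : z ^+ N / z = (cN N)^* by rewrite /cN conjCK.
by rewrite cN_norm mul1r -rep_herm // leq_subr.
Qed.

(** P_{N-1,m} is the orthogonal sum of E^1_{N-1,m} and w P_{N-1,m-1}, and multiplication by w is
    isometric; the representer splits accordingly. The last clause is the symmetry about the
    antidiagonal for the kernel of P_{N-1,m-1}. *)
Lemma rep_w : (forall t, (t < m)%N -> exists b, [/\ rep Q' t b, y t.+1 = e t.+1 + Mw b &
   forall s, (s < m)%N -> forall b', rep Q' (m - s.+1) b' -> ev z s b = ev z (m - t.+1) b'])
   /\ y 0%N = e 0%N.
Proof.
have dec f : f \in Q -> exists a b, [/\ f = a + b, a \in E & b \in (Mw @: Q')%VS].
  by move=> fQ; have [a [b [? ? ?]]] := ominus_decomp form wQ fQ; exists a, b.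
have EQ : (E <= Q)%VS by rewrite /E1 capvSl.
have orth a b : a \in E -> b \in (Mw @: Q')%VS -> form a b = 0.
  by move=> /memv_ominus[_ h] /h.
split; last first.
  apply: (@rep_uniq Q 0); first exact: hy.
  rewrite -[e 0%N]addr0; apply: (rep_sum dec EQ wQ orth); first exact: he.
  split; first exact: mem0v.
  by move=> f /memv_imgP[g _ ->]; rewrite dot0r ev_Mw0.
move=> t tm; have [b hb] := rep_ex Q' t; exists b.
have [bQ hb'] := hb; have /Q'P[bN bmeas] := bQ.
have repw t' b' : (t' < m)%N -> rep Q' t' b' -> rep (Mw @: Q') t'.+1 (Mw b').
  move=> tm' [bQ' hbb]; split; first exact: memv_img.
  have /Q'P[bN' bm'] := bQ'.
  move=> f /memv_imgP[g gQ ->]; have /Q'P[gN gm] := gQ.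
  by rewrite shift_w // hbb // ev_MwS.
split => //.
  apply: (@rep_uniq Q t.+1); first exact: hy.
  by apply: (rep_sum dec EQ wQ orth); [exact: he|exact: repw].
move=> s sm b' hb2.
have [bQ2 hbb] := hb2; have /Q'P[b2N b2m] := bQ2.
have wN g : inQ N g -> inQ N (Mw g).
  by move=> gN s' [|t'] Ns; rewrite ?cf_Mw0 ?cf_MwS // gN // if_same.
(* [refl N (Mw b)] is the reflection of [b] in degree (N - 1, m - 1), written with the one of degree
   (N - 1, m). *)
have r1 : rep Q' (m - t.+1) (cN N *: refl N (Mw b)).
  split.
    rewrite rpredZ //; apply/Q'P; split; first exact: refl_inQ.
    by move=> s'; rewrite cf_refl // subnn cf_Mw0 rmorph0 if_same.
  move=> f /Q'P[fN fm].
  have rfQ : refl N f \in (Mw @: Q')%VS.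
    apply/mem_wP; split; last exact: refl_inQ.
    by move=> s'; rewrite cf_refl // subn0 fm rmorph0 if_same.
  rewrite -[f](reflK Nn fN).
  have [_ hw] := repw t b tm hb.
  rewrite dotZr refl_dot //; [|exact: refl_inQ|exact: wN].
  by rewrite ev_refl //; [rewrite /cN conjCK dotC hw|exact: refl_inQ].
have E1 : ev z (m - s.+1) (cN N *: refl N (Mw b)) = (ev z s b)^*.
  rewrite evZ ev_refl //; last exact: wN.
  have -> : z ^+ N / z = (cN N)^* by rewrite /cN conjCK.
  by rewrite mulrA cN_norm mul1r ev_MwS.
rewrite -[LHS]conjCK -E1 -hbb; last by case: r1.
by have [_ hr] := r1; rewrite -dotC hr.
Qed.

(** Both sides are the entry (t, s) of the kernel of P_{N-1,m-1}: the left one by removing E^1 and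
    dividing by w, the right one by doing the same at the reflected indices. Taking the difference
    for N = n + 1 and N = n yields the Christoffel-Darboux recursion. *)
Lemma rep_rec t s : (t < m)%N -> (s < m)%N ->
  ev z t.+1 (y s.+1) - ev z t.+1 (e s.+1) = ev z t (y s) - ev z (m - s) (e (m - t)%N).
Proof.
move=> tm sm; have [hw _] := rep_w.
have [b [hb yb sym]] := hw s sm.
have mt : (m - t.+1 < m)%N by rewrite ltn_subrL /= (leq_ltn_trans _ tm).
have [b' [hb' yb' _]] := hw (m - t.+1)%N mt.
have E1 : (m - t.+1).+1 = (m - t)%N by rewrite subnSK.
rewrite yb evD addrAC subrr add0r ev_MwS //.
rewrite (sym t tm b' hb').
rewrite (rep_persym (ltnW tm) (ltnW sm)) -E1 yb' evD.
have ms : (m - s.+1 < m)%N by rewrite ltn_subrL /= (leq_ltn_trans _ sm).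
have := ev_MwS z b' ms; rewrite subnSK // => ->.
move: (ev z (m - s) _) (ev z (m - s.+1) _) => A B.
by rewrite addrAC subrr add0r.
Qed.

Lemma rep_rec0 s : (s <= m)%N -> ev z 0 (y s) = ev z 0 (e s).
Proof.
have [hw h0] := rep_w; case: s => [|s] sm; first by rewrite h0.
by have [b [_ -> _]] := hw s sm; rewrite evD ev_Mw0 addr0.
Qed.

End Step.
End Representers.

(** * The polynomial p of a split and the zeros of p(z, 0) *)

Section SplitToBS.
Variables (R : realType) (n m : nat) (T : {scalar laurent R n m}).
Hypothesis T_gt0 : positive_form T.
Local Notation C := R[i].
Local Notation H := (bipoly R n m).
Local Notation P k l := (Psp R n m k l).
Local Notation Mz := (Mz R n m).
Local Notation Mw := (Mw R n m).
Local Notation form := (dotT T_gt0).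
Local Notation D := (domT T_gt0).
Local Notation EN := (E1 T_gt0 n%:Z m%:Z).
Local Notation Pn := (P (n%:Z - 1) m%:Z).
Implicit Types (f g h x y : H) (s t N L : nat) (z w : C).
Variables (d : nat) (K1 K2 : {vspace H}).
Hypotheses (DK : D = (K1 + K2)%VS)
  (K12 : forall x y, x \in K1 -> y \in K2 -> form x y = 0)
  (K1z : forall x y, x \in K1 -> y \in K2 -> form x (Mz y) = 0)
  (K1E : (K1 <= EN)%VS) (zK2E : (Mz @: K2 <= EN)%VS) (dK1 : \dim K1 = d).

Let K1D : (K1 <= D)%VS. Proof. by rewrite DK addvSl. Qed.
Let K2D : (K2 <= D)%VS. Proof. by rewrite DK addvSr. Qed.
Let D_inQ f : f \in D -> inQ n f. Proof. by move=> /memD[]. Qed.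
Let K1Q f : f \in K1 -> inQ n f. Proof. by move=> /(subvP K1D)/D_inQ. Qed.
Let K2Q f : f \in K2 -> inQ n f. Proof. by move=> /(subvP K2D)/D_inQ. Qed.
Let PnQ f : reflect (inQ n f) (f \in Pn). Proof. exact: PQ. Qed.

Lemma dim_K12 : (\dim K1 + \dim K2)%N = n.
Proof.
apply: etrans (dim_D T_gt0); rewrite DK dimv_disjoint_sum //.
apply/eqP; rewrite -subv0; apply/subvP => x; rewrite memv_cap => /andP[x1 x2].
by rewrite memv0; apply/eqP/(dot_eq0 (form := form))/K12.
Qed.

Let dEN : \dim EN = n.+1. Proof. by rewrite -(Z1 n) dim_E1. Qed.

Let dim_zK2 : \dim (Mz @: K2)%VS = \dim K2.
Proof.
apply: limg_dim_eq; apply/eqP; rewrite -subv0; apply/subvP => x.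
rewrite memv_cap memv_ker => /andP[xK /eqP zx]; rewrite memv0; apply/eqP.
by apply: Mz_inj zx; apply/PnQ; exact: K2Q.
Qed.

Let KK := (K1 + Mz @: K2)%VS.
Let dKK : \dim KK = n.
Proof.
rewrite dimv_disjoint_sum ?dim_zK2 ?dim_K12 //.
apply/eqP; rewrite -subv0; apply/subvP => x; rewrite memv_cap => /andP[x1 /memv_imgP[y yK xy]].
by rewrite memv0; apply/eqP/(dot_eq0 (form := form)); rewrite {2}xy K1z.
Qed.
Let KKE : (KK <= EN)%VS. Proof. by rewrite subv_add K1E. Qed.

(** K1 + z K2 has dimension n inside E^1_{n,m}, which has dimension n + 1; p spans what is left. *)
Lemma poly_ex : exists p, [/\ p \in EN, form p p = 1,
  (forall k, k \in K1 -> form p k = 0), (forall k, k \in K2 -> form p (Mz k) = 0) &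
  forall f, f \in EN -> exists a b c, [/\ f = a + Mz b + c *: p, a \in K1 & b \in K2]].
Proof.
have dO : \dim (ominus form EN KK) = 1%N.
  by apply/eqP; rewrite -(eqn_add2r (\dim KK)) dim_ominus // dKK dEN.
pose v := vpick (ominus form EN KK).
have v0 : v != 0 by rewrite vpick0 -dimv_eq0 dO.
have vO : v \in ominus form EN KK := memv_pick _.
have vv : 0 < form v v by rewrite dnorm_gt0.
have c0 : sqrtC (form v v) != 0 by rewrite sqrtC_eq0 gt_eqF.
have ON : ominus form EN KK = <[v]>%VS.
  by apply/eqP; rewrite eq_sym eqEdim -memvE vO dim_vline v0 dO.
exists ((sqrtC (form v v))^-1 *: v).
have /memv_ominus[vE vK] := vO.
split.
- exact: rpredZ.
- rewrite dotZZ normfV ger0_norm ?sqrtC_ge0 ?ltW // exprVn sqrtCK mulVf //.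
  by rewrite gt_eqF.
- by move=> k kK; rewrite dotZl vK ?mulr0 // (subvP (addvSl _ _)).
- by move=> k kK; rewrite dotZl vK ?mulr0 // (subvP (addvSr _ _)) // memv_img.
move=> f /(ominus_decomp form KKE)[y [x [-> yO /memv_addP[a aK [zb /memv_imgP[b bK ->] ->]]]]].
move: yO; rewrite ON => /vlineP[c ->].
exists a, b, (c * sqrtC (form v v)); split => //.
by rewrite scalerA mulfK // addrC.
Qed.

Section WithP.
Variable p : H.
Hypotheses (pE : p \in EN) (pp : form p p = 1)
  (pK1 : forall k, k \in K1 -> form p k = 0) (pK2 : forall k, k \in K2 -> form p (Mz k) = 0)
  (Edec : forall f, f \in EN -> exists a b c, [/\ f = a + Mz b + c *: p, a \in K1 & b \in K2]).

Let wPE f : exists y x, [/\ f = y + x, y \in EN & forall s, cf x s 0 = 0].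
Proof.
have wP : (Mw @: P n%:Z (m%:Z - 1) <= P n%:Z m%:Z)%VS by rewrite P_full subvf.
have [|y [x [-> yE xw]]] := ominus_decomp (x := f) form wP; first by rewrite P_full memvf.
exists y, x; split => //; move: xw; rewrite -(Z1 n) => /mem_wP[]//.
Qed.

Let EN0 f x : f \in EN -> (forall s, cf x s 0 = 0) -> form f x = 0.
Proof. by move=> /memE1n; apply. Qed.

Let pcol_w x : (forall s, cf x s 0 = 0) -> pcol x 0 = 0.
Proof. by move=> h; apply/polyP => i; rewrite coef_pcol h coef0. Qed.

Let p0 := pcol p 0.

Let norm3 a b c : a \in K1 -> b \in K2 ->
  form (a + Mz b + c *: p) (a + Mz b + c *: p) = form a a + form b b + `|c| ^+ 2.
Proof.
move=> aK bK; rewrite dot_pyth; last first.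
  by rewrite dotDl !dotZr (dot_eq0C (pK1 aK)) (dot_eq0C (pK2 bK)) !mulr0 addr0.
rewrite dot_pyth ?(K1z aK bK) // shift_z ?dotZZ ?pp ?mulr1 //; exact: K2Q.
Qed.

(* At w = 0 the shifts of K1 and K2 act, modulo p(z,0), through contractions. *)
Lemma K2_step f : f \in K2 -> exists f' u, [/\ f' \in K2, form f' f' <= form f f &
   pcol f 0 = 'X * pcol f' 0 + u *: p0].
Proof.
move=> fK; have [y [x [fyx yE x0]]] := wPE f.
have [a [b [c [yabc aK bK]]]] := Edec yE.
(* [a] is orthogonal to f in K2, to x because [a] lies in E^1_{n,m}, and to the other two components
   of y; so its product with itself is 0. *)
have a0 : a = 0.
  apply: (dot_eq0 (form := form)); have h : form a f = 0 by apply: K12.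
  move: h; rewrite fyx dotDr (EN0 (subvP K1E _ aK) x0) addr0 yabc !dotDr dotZr.
  by rewrite (K1z aK bK) (dot_eq0C (pK1 aK)) mulr0 !addr0.
exists b, c; split => //.
  rewrite fyx (dot_pyth (EN0 yE x0)) yabc norm3 // a0 dot0l add0r -addrA lerDl.
  by rewrite addr_ge0 ?exprn_ge0 ?dot_ge0.
rewrite fyx pcolD (pcol_w x0) addr0 yabc a0 add0r pcolD pcolZ pcol_Mz //.
by apply/PnQ; exact: K2Q.
Qed.

Lemma K1_step g : g \in K1 -> exists g' u, [/\ g' \in K1, form g' g' <= form g g &
   'X * pcol g 0 = pcol g' 0 + u *: p0].
Proof.
move=> gK; have [y [x [fyx yE x0]]] := wPE (Mz g).
have [a [b [c [yabc aK bK]]]] := Edec yE.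
have b0 : b = 0.
  (* By Toeplitz invariance z b is orthogonal to z g, as b is to g; the other components do not
     contribute. *)
  apply: (dot_eq0 (form := form)); rewrite -shift_z; try exact: K2Q.
  have h : form (Mz b) (Mz g) = 0.
    rewrite shift_z; [|exact: K2Q|exact: K1Q].
    by apply: (dot_eq0C (form := form)); apply: K12.
  have zbE : Mz b \in EN by rewrite (subvP zK2E) // memv_img.
  move: h; rewrite fyx dotDr (EN0 zbE x0) addr0 yabc !dotDr dotZr.
  by rewrite (dot_eq0C (K1z aK bK)) (dot_eq0C (pK2 bK)) mulr0 add0r addr0.
exists a, c; split => //.
  rewrite -[form g g]shift_z; try exact: K1Q.
  rewrite fyx (dot_pyth (EN0 yE x0)) yabc norm3 // b0 dot0l addr0 -addrA lerDl.
  by rewrite addr_ge0 ?exprn_ge0 ?dot_ge0.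
rewrite -pcol_Mz; last by apply/PnQ; exact: K1Q.
by rewrite fyx pcolD (pcol_w x0) addr0 yabc b0 linear0 addr0 pcolD pcolZ.
Qed.

(* Evaluating the hypothesis at a root r bounds |f(r,0)| by a geometric sequence along f, f', f'', etc. *)
Lemma div_roots (W : {vspace H}) (A B : {poly C}) (R0 : {poly C}) (s : seq C) :
  p0 = R0 * \prod_(r <- s) ('X - r%:P) ->
  (forall f, f \in W -> exists f' u, [/\ f' \in W, form f' f' <= form f f &
    A * pcol f 0 = B * pcol f' 0 + u *: p0]) ->
  (forall r, r \in s -> `|B.[r]| < `|A.[r]|) ->
  forall f, f \in W -> \prod_(r <- s) ('X - r%:P) %| pcol f 0.
Proof.
elim: s R0 => [|r s IH] R0 pE0 step AB f fW; first by rewrite big_nil dvd1p.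
have IHs : forall f, f \in W -> \prod_(r <- s) ('X - r%:P) %| pcol f 0.
  apply: (IH (R0 * ('X - r%:P))) => //.
    by rewrite pE0 big_cons mulrA.
  by move=> x xs; apply: AB; rewrite in_cons xs orbT.
set D0 := \prod_(r <- s) ('X - r%:P) in IHs.
have D0n : D0 != 0 by rewrite /D0 monic_neq0 // monic_prod_XsubC.
(* Evaluating after division by the factors already treated takes care of multiple roots. *)
pose L h := (pcol h 0 %/ D0).[r].
have [a x y|Bd Bd0 hBd] := @form_bound _ _ form L.
  by rewrite /L pcolP divpD divpZl hornerD hornerZ.
have Ar : 0 < `|A.[r]| by apply: le_lt_trans (AB r _); rewrite ?mem_head.
pose th := `|B.[r]| / `|A.[r]|.
have th0 : 0 <= th by rewrite divr_ge0.
have th1 : th < 1 by rewrite ltr_pdivrMr // mul1r AB // mem_head.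
have Lstep h : h \in W -> exists h', [/\ h' \in W, form h' h' <= form h h & `|L h| = th * `|L h'|].
  move=> hW; have [h' [u [h'W le E]]] := step h hW; exists h'; split => //.
  have E1 : A * (pcol h 0 %/ D0) = B * (pcol h' 0 %/ D0) + u *: (R0 * ('X - r%:P)).
    apply: (mulIf D0n); rewrite mulrDl -!mulrA !divpK ?IHs // E pE0 big_cons -/D0.
    by rewrite -scalerAl !mulrA.
  have E2 : A.[r] * L h = B.[r] * L h'.
    have := congr1 (horner^~ r) E1.
    by rewrite /= hornerD hornerZ !hornerM hornerXsubC subrr !mulr0 addr0.
  by rewrite /th mulrAC -normrM -E2 normrM mulrC mulKf // gt_eqF.
have Lb N h : h \in W -> `|L h| ^+ 2 <= (th ^+ 2) ^+ N * (Bd * form h h).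
  elim: N h => [|N IHN] h hW; first by rewrite expr0 mul1r.
  have [h' [h'W le ->]] := Lstep h hW.
  rewrite exprMn (exprS (th ^+ 2)) -[leRHS]mulrA; apply: ler_wpM2l; first exact: exprn_ge0.
  apply: le_trans (IHN h' h'W) _; apply: ler_wpM2l; first by rewrite exprn_ge0 ?exprn_ge0.
  exact: (ler_wpM2l Bd0 le).
have L0 : L f = 0.
  suff : `|L f| ^+ 2 = 0 by move/eqP; rewrite expf_eq0 /= normr_eq0 => /eqP.
  apply: (@small0 R _ (Bd * form f f)); first by rewrite mulr_ge0 ?dot_ge0.
  move=> e e0; have [N hN] : exists N, (th ^+ 2) ^+ N <= e.
    by apply: geom_small => //; [exact: exprn_ge0|exact: exprn_ilt1].
  rewrite ger0_norm ?exprn_ge0 //; apply: le_trans (Lb N f fW) _.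
  by rewrite mulrC; apply: ler_wpM2l => //; rewrite mulr_ge0 ?dot_ge0.
rewrite big_cons -/D0 -(divpK (IHs f fW)) dvdp_mul2r //.
by rewrite dvdp_XsubCl; apply/rootP.
Qed.

(** In z g(z, 0) = g'(z, 0) + u p(z, 0) the left side gains a degree while a common bound on the
    degrees does not, so any excess over deg p(z, 0) - 1 can be lowered. This accounts for the case
    deg p(z, 0) < n, where zeros sit at infinity. *)
Lemma K1_size (N : nat) : (forall g, g \in K1 -> size (pcol g 0) <= (size p0).-1 + N)%N ->
  forall g, g \in K1 -> (size (pcol g 0) <= (size p0).-1)%N.
Proof.
elim: N => [|N IH] h g gK; first by have := h g gK; rewrite addn0.
apply: IH => // f fK; have [f' [u [f'K _ E]]] := K1_step fK.
have [->|f0] := eqVneq (pcol f 0) 0; first by rewrite size_poly0.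
rewrite -ltnS -addnS; have : (size ('X * pcol f 0)) = (size (pcol f 0)).+1.
  by rewrite mulrC size_mulX.
move=> <-; rewrite E; apply: leq_trans (size_polyD _ _) _; rewrite geq_max h //=.
apply: leq_trans (size_scale_leq _ _) _.
by rewrite -addSnnS; apply: leq_trans (leq_addr _ _); exact: leqSpred.
Qed.

Hypothesis p_nz : forall z w, `|z| = 1 -> `|w| <= 1 -> eval2 p z w != 0.
Hypothesis dn : (d <= n)%N.

Let p0_nz z : `|z| = 1 -> p0.[z] != 0.
Proof. by move=> z1; exact: (q0_neq0 p_nz z1). Qed.

Lemma zeros_count : nzeros_disk (slice0 p) = d.
Proof.
have p0n : p0 != 0.
  by apply: contraNneq (p0_nz (normr1 _)) => ->; rewrite horner0.
rewrite slice0E -/p0 /nzeros_disk; case: (closed_field_poly_normal p0) => s /= pE0.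
have rs r : r \in s -> `|r| != 1.
  move=> rs; apply/eqP => r1; have := p0_nz r1.
  rewrite pE0 hornerZ (eqP (_ : root (\prod_(r <- s) ('X - r%:P)) r)) ?mulr0 ?eqxx //.
  by rewrite root_prod_XsubC.
pose s1 := [seq r <- s | `|r| < 1]; pose s2 := [seq r <- s | ~~ (`|r| < 1)].
have sE : \prod_(r <- s) ('X - r%:P) = \prod_(r <- s1) ('X - r%:P) * \prod_(r <- s2) ('X - r%:P).
  by rewrite !big_filter (bigID (fun r => `|r| < 1)).
have lc0 : lead_coef p0 != 0 by rewrite lead_coef_eq0.
have sz : size p0 = (size s).+1 by rewrite pE0 size_scale // size_prod_XsubC.
have szn : (size s <= n)%N.
  by rewrite -ltnS -sz; apply: size_pcol => i j h; rewrite cf_gt // negb_and -(ltnNge n) h.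
have s12 : (size s1 + size s2)%N = size s by rewrite !size_filter count_predC.
rewrite -size_filter -/s1; apply/eqP; rewrite eqn_leq; apply/andP; split.
  (* At a zero in the disk, the term z f'(z, 0) of [K2_step] is the contracting one. The count gives
     n - d <= n - [size s1]. *)
  have dv f : f \in K2 -> \prod_(r <- s1) ('X - r%:P) %| pcol f 0.
    apply: (@div_roots K2 1 'X (lead_coef p0 *: \prod_(r <- s2) ('X - r%:P))).
    - by rewrite -scalerAl mulrC -sE.
    - by move=> h /K2_step[f' [u [? ? E]]]; exists f', u; rewrite mul1r.
    - by move=> r; rewrite mem_filter => /andP[r1 _]; rewrite hornerX hornerC normr1.
  have : (\dim K2 <= n - size s1)%N.
    apply: (@dim_le_div _ _ _ _ (\prod_(r <- s1) ('X - r%:P))).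
    - by move=> f /(subvP K2D) fD; exact: (E1_inj (leqnSn n) fD).
    - by rewrite monic_neq0 // monic_prod_XsubC.
    move=> f fK; have /dvdpP[h fh] := dv f fK; exists h; first by rewrite mulrC.
    have [->|h0] := eqVneq h 0; first by rewrite size_poly0.
    have := size_pcol 0 (K2Q fK); rewrite fh size_Mmonic ?monic_prod_XsubC // size_prod_XsubC addnS /=.
    by lia.
  have s1n : (size s1 <= n)%N by apply: leq_trans szn; rewrite -s12 leq_addr.
  have dK2 : \dim K2 = (n - d)%N by apply/eqP; rewrite -(eqn_add2l d) -{1}dK1 dim_K12 subnKC.
  by rewrite dK2 -(leq_sub2lE d s1n).
have dv g : g \in K1 -> \prod_(r <- s2) ('X - r%:P) %| pcol g 0.
  apply: (@div_roots K1 'X 1 (lead_coef p0 *: \prod_(r <- s1) ('X - r%:P))).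
  - by rewrite -scalerAl -sE.
  - by move=> h /K1_step[f' [u [? ? E]]]; exists f', u; rewrite mul1r.
  - move=> r; rewrite mem_filter => /andP[r1 /rs rn]; rewrite hornerX hornerC normr1.
    by rewrite lt_def rn /= real_leNgt ?normr_real ?real1.
rewrite -dK1; apply: (@dim_le_div _ _ _ _ (\prod_(r <- s2) ('X - r%:P))).
- by move=> f /(subvP K1D) fD; exact: (E1_inj (leqnSn n) fD).
- by rewrite monic_neq0 // monic_prod_XsubC.
move=> f fK; have /dvdpP[h fh] := dv f fK; exists h; first by rewrite mulrC.
have [->|h0] := eqVneq h 0; first by rewrite size_poly0.
(* With the bound n in place of deg p(z, 0), the quotient would have size at most n - [size s2],
   which may exceed [size s1]. *)
have : (size (pcol f 0%N) <= (size p0).-1)%N.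
  apply: (@K1_size n) => // g gK; apply: leq_trans (leq_addl _ _).
  by apply: size_pcol; exact: K1Q.
rewrite fh size_Mmonic ?monic_prod_XsubC // size_prod_XsubC addnS /= sz /= -s12.
by rewrite leq_add2r.
Qed.

End WithP.
End SplitToBS.

(** * The kernel of the complement of P_{n-1,m}, and nonvanishing of p *)

Section KernelOfSplit.
Variables (R : realType) (n m : nat) (T : {scalar laurent R n m}).
Hypothesis T_gt0 : positive_form T.
Local Notation C := R[i].
Local Notation H := (bipoly R n m).
Local Notation P k l := (Psp R n m k l).
Local Notation Mz := (Mz R n m).
Local Notation form := (dotT T_gt0).
Local Notation D := (domT T_gt0).
Local Notation EN := (E1 T_gt0 n%:Z m%:Z).
Local Notation Pn := (P (n%:Z - 1) m%:Z).
Implicit Types (f g h x y : H) (s t N L : nat) (z w : C).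
(** The truncated multiplication is nilpotent: it raises the order in z until nothing remains. *)
Lemma Mz_eig f c : c != 0 -> Mz f = c *: f -> f = 0.
Proof.
move=> c0 E; apply: cf_inj; elim=> [|s IH] t; rewrite cf0.
  have := cf_Mz0 f t; rewrite E cfZ => /eqP; rewrite mulf_eq0 (negbTE c0) /=.
  by move/eqP.
have := cf_MzS f s t; rewrite E cfZ IH cf0 if_same => /eqP.
by rewrite mulf_eq0 (negbTE c0) /= => /eqP.
Qed.

Lemma eval2_lin z w a f g : eval2 (a *: f + g) z w = a * eval2 f z w + eval2 g z w.
Proof.
rewrite !eval2E mulr_sumr -big_split; apply: eq_bigr => t _ /=.
by rewrite ev_lin mulrDl mulrA.
Qed.
Lemma eval2B z w f g : eval2 (f - g) z w = eval2 f z w - eval2 g z w.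
Proof. by rewrite addrC -scaleN1r eval2_lin mulN1r addrC. Qed.
Lemma eval2Z z w a f : eval2 (a *: f) z w = a * eval2 f z w.
Proof.
rewrite !eval2E mulr_sumr; apply: eq_bigr => t _ /=.
by rewrite evZ mulrA.
Qed.
Lemma eval2_Mz z w f : f \in Pn -> eval2 (Mz f) z w = z * eval2 f z w.
Proof.
move=> fP; rewrite !eval2E mulr_sumr; apply: eq_bigr => t _ /=.
by rewrite ev_Mz // mulrA.
Qed.

(** If f vanishes on the fibre over z, it is multiplication by the variable minus z applied to some
    h in P_{n-1,m}. Then [Mz h] is the orthogonal sum of f and z h and has the norm of h, so f =
    0. *)
Lemma ev_inj z f : `|z| = 1 -> (forall g, g \in Pn -> form f g = 0) ->
  (forall t, (t <= m)%N -> ev z t f = 0) -> f = 0.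
Proof.
move=> z1 fP f0; have z0 := circ_neq0 z1.
(* synthetic division by z - z0, column by column *)
pose hf (s t : nat) : C := \sum_(u < n.+1 | (s < u)%N) cf f u t * z ^+ (u - s.+1).
pose h : H := \matrix_(s, t) hf s t.
have hE s t : cf h s t = hf s t.
  rewrite (mk_cf _ _ hf); case: ifP => // /negbT; rewrite negb_and -!ltnNge => hst.
  rewrite /hf big1 // => u su; rewrite cf_gt ?mul0r // negb_and.
  case/orP: hst => [ns|mt]; last by rewrite -(ltnNge m) mt orbT.
  by have := ltn_ord u; move: su ns; lia.
have hP : h \in Pn.
  apply/PQ => s t ns; rewrite hE /hf big1 // => u su.
  by have := ltn_ord u; move: su ns; lia.
have fE : f = Mz h - z *: h.
  apply: cf_inj => s t; rewrite cfB cfZ hE.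
  have tail k : \sum_(u < n.+1 | (k <= u)%N) cf f u t * z ^+ (u - k) = cf f k t + z * hf k t.
    have [kn|kn] := leqP k n; last first.
      rewrite cf_gt ?negb_and -?(ltnNge n) ?kn // /hf !big1 ?mulr0 ?addr0 // => u ku.
        by have := ltn_ord u; move: ku kn; lia.
      by have := ltn_ord u; move: ku kn; lia.
    have kn1 : (k < n.+1)%N by [].
    rewrite (bigD1 (Ordinal kn1)) //= subnn expr0 mulr1; congr (_ + _).
    rewrite /hf mulr_sumr; apply: eq_big => [u|u]; first by rewrite ltn_neqAle andbC eq_sym.
    move=> /andP[ku nku]; rewrite mulrCA -exprS; congr (_ * _ ^+ _).
    have nku' : (k != u :> nat) by apply: contra nku => /eqP E; apply/eqP/val_inj.
    by move: ku nku'; lia.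
  case: s => [|s]; rewrite ?cf_Mz0.
    have := tail 0%N; rewrite (eq_bigl xpredT) // (eq_bigr (fun u : 'I_n.+1 => cf f u t * z ^+ u)); last first.
      by move=> u _; rewrite subn0.
    rewrite -evE; have [tm|tm] := leqP t m; last first.
      rewrite ev_gt // => /esym/eqP; rewrite addr_eq0 => /eqP ->; by rewrite sub0r.
    by rewrite f0 // => /esym/eqP; rewrite addr_eq0 => /eqP ->; rewrite sub0r.
  rewrite cf_MzS hE; case: ifP => [sn|/negbT sn].
    by apply/eqP; rewrite eq_sym subr_eq eq_sym; rewrite -tail.
  rewrite -leqNgt in sn; rewrite cf_gt; last by rewrite negb_and -(ltnNge n) ltnS sn.
  rewrite /hf big1 ?mulr0 ?subr0 // => u su.
  by have := ltn_ord u; move: su sn; lia.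
apply: (dot_eq0 (form := form)).
have zh : Mz h = f + z *: h by rewrite fE subrK.
have hn : inQ n h by apply/PQ.
have := shift_z T_gt0 hn hn; rewrite zh dot_pyth; last by rewrite dotZr fP // mulr0.
rewrite dotZZ z1 expr1n mul1r => /eqP; rewrite -subr_eq0 addrK => /eqP; exact.
Qed.

Variables (K1 K2 : {vspace H}).
Hypotheses (DK : D = (K1 + K2)%VS)
  (K12 : forall x y, x \in K1 -> y \in K2 -> form x y = 0)
  (K1z : forall x y, x \in K1 -> y \in K2 -> form x (Mz y) = 0)
  (K1E : (K1 <= EN)%VS) (zK2E : (Mz @: K2 <= EN)%VS).
Variable p : H.
Hypotheses (pE : p \in EN) (pp : form p p = 1)
  (pK1 : forall k, k \in K1 -> form p k = 0) (pK2 : forall k, k \in K2 -> form p (Mz k) = 0)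
  (Edec : forall f, f \in EN -> exists a b c, [/\ f = a + Mz b + c *: p, a \in K1 & b \in K2]).

Let K2P f : f \in K2 -> f \in Pn.
Proof.
move=> fK; apply/PQ; have : f \in D by rewrite DK (subvP (addvSr _ _)).
by move=> /memD[].
Qed.

Lemma kernel_ex z : `|z| = 1 -> exists y1 y0 : nat -> H,
  [/\ forall s f, (s <= m)%N -> form f (y1 s) = ev z s f,
      forall s, (s <= m)%N -> y0 s \in Pn,
      forall s f, (s <= m)%N -> f \in Pn -> form f (y0 s) = ev z s f &
      cd_kernel m (fun t => ev z t p) (fun t s => ev z t (y1 s - y0 s))].
Proof.
move=> z1.
have zz : z * z^* = 1 by rewrite -normCK z1 expr1n.
have [x1 hx1] := choice (rep_ex T_gt0 z K1).
have [x2 hx2] := choice (rep_ex T_gt0 z K2).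
have [y1 hy1] := choice (rep_ex T_gt0 z (P (n.+1%:Z - 1) m%:Z)).
have [y0 hy0] := choice (rep_ex T_gt0 z Pn).
pose e0 s := x1 s + x2 s.
(* The representer for E^1_{n,m} along its orthogonal decomposition; the conjugate of z appears
   because the coefficients of z b are z times those of b. *)
pose e1 s := x1 s + (z^* *: Mz (x2 s) + (ev z s p)^* *: p).
have he0 s : rep T_gt0 z (E1 T_gt0 (n%:Z - 1) m%:Z) s (e0 s).
  apply: (rep_sum _ _ _ _ (hx1 s) (hx2 s)) => //.
  - move=> f; rewrite -/D DK => /memv_addP[a aK [b bK ->]]; by exists a, b.
  - by rewrite -/D DK addvSl.
  - by rewrite -/D DK addvSr.
have he1 s : rep T_gt0 z (E1 T_gt0 (n.+1%:Z - 1) m%:Z) s (e1 s).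
  rewrite (Z1 n); have [x1K h1] := hx1 s; have [x2K h2] := hx2 s; split.
    apply: rpredD; first exact: (subvP K1E).
    by apply: rpredD; apply: rpredZ => //; apply: (subvP zK2E); exact: memv_img.
  move=> f /Edec[a [b [c [-> aK bK]]]].
  rewrite !dotDl !dotDr !dotZl !dotZr conjCK h1 //.
  rewrite (K1z aK x2K) (dot_eq0C (pK1 aK)) (dot_eq0C (K1z x1K bK)) (dot_eq0C (pK2 bK)).
  rewrite (pK1 x1K) (pK2 x2K) pp shift_z; first last.
  - by apply/PQ; apply: K2P.
  - by apply/PQ; apply: K2P.
  by rewrite h2 // !evD evZ (ev_Mz _ _ (K2P bK)) ?conjCK; ring.
(* On the circle the conjugate of z and the shift cancel in the K2 component, so passing from n to n
   + 1 changes the kernel of E^1 only by the rank one term of p. *)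
have ee t s : ev z t (e1 s) - ev z t (e0 s) = ev z t p * (ev z s p)^*.
  have [x2K _] := hx2 s; rewrite /e1 /e0 !evD !evZ (ev_Mz _ _ (K2P x2K)).
  have -> : z^* * (z * ev z t (x2 s)) = ev z t (x2 s) by rewrite mulrA [z^* * z]mulrC zz mul1r.
  by ring.
have n1 : (n.+1 <= n.+1)%N by [].
have n0 : (n <= n.+1)%N by [].
have r1 t (tm : (t <= m)%N) := hy1 t.
have r0 t (tm : (t <= m)%N) := hy0 t.
have f1 t (tm : (t <= m)%N) := he1 t.
have f0 t (tm : (t <= m)%N) := he0 t.
exists y1, y0; split.
- move=> s f sm; have [_ h] := hy1 s; apply: h.
  by rewrite (Z1 n) P_full memvf.
- by move=> s sm; case: (hy0 s).
- by move=> s f sm fP; case: (hy0 s) => _; apply.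
split.
- move=> s sm; rewrite evB.
  by rewrite (rep_rec0 z1 n1 r1 f1 sm) (rep_rec0 z1 n0 r0 f0 sm) ee.
- move=> t s tm sm; rewrite !evB.
  have h1 := rep_rec z1 n1 r1 f1 tm sm; have h0 := rep_rec z1 n0 r0 f0 tm sm.
  have -> : ev z t.+1 (y1 s.+1) - ev z t.+1 (y0 s.+1) =
    (ev z t.+1 (y1 s.+1) - ev z t.+1 (e1 s.+1)) - (ev z t.+1 (y0 s.+1) - ev z t.+1 (e0 s.+1))
    + (ev z t.+1 (e1 s.+1) - ev z t.+1 (e0 s.+1)) by ring.
  rewrite h1 h0 ee.
  have -> : (ev z (m - t) p)^* * ev z (m - s) p = ev z (m - s) (e1 (m - t)%N) - ev z (m - s) (e0 (m - t)%N).
    by rewrite ee mulrC.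
  by ring.
- move=> t s tm sm; rewrite !evB rmorphB.
  by rewrite (rep_herm r1 tm sm) (rep_herm r0 tm sm).
- move=> t s tm sm; rewrite !evB.
  by rewrite (rep_persym z1 n1 r1 tm sm) (rep_persym z1 n0 r0 tm sm).
Qed.

Lemma nonvanish z w : `|z| = 1 -> `|w| <= 1 -> eval2 p z w != 0.
Proof.
move=> z1 w1; apply/eqP => pzw.
have zz : z * z^* = 1 by rewrite -normCK z1 expr1n.
have [y1 [y0 [h1 h0 h0' hX]]] := kernel_ex z1.
pose phi := \sum_(s < m.+1) (w ^+ s)^* *: (y1 s - y0 s).
(* [phi] is the component, in the complement of P_{n-1,m}, of the representer of evaluation at (z,
   w); its squared norm is the sum S of [cd_zero]. *)
have sm (s : 'I_m.+1) : (s <= m)%N by rewrite -ltnS.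
have evphi t : ev z t phi = \sum_(s < m.+1) ev z t (y1 s - y0 s) * (w ^+ s)^*.
  by rewrite /phi ev_sum; apply: eq_bigr => s _; rewrite evZ mulrC.
have phiP g : g \in Pn -> form phi g = 0.
  move=> gP; rewrite /phi dot_suml big1 // => s _; rewrite dotZl dotBl.
  by rewrite [form (y1 s) g]dotC h1 // [form (y0 s) g]dotC h0' // subrr mulr0.
have SE : form phi phi = \sum_(t < m.+1) (\sum_(s < m.+1) ev z t (y1 s - y0 s) * (w ^+ s)^*) * w ^+ t.
  rewrite {2}/phi dot_sumr; apply: eq_bigr => t _.
  by rewrite dotZr conjCK dotBr h1 // (phiP _ (h0 _ (sm t))) subr0 -evphi mulrC.
have phi0 : phi = 0.
  apply: (dot_eq0 (form := form)); rewrite SE; apply: (cd_zero hX w1).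
    by rewrite -eval2E.
  by rewrite -SE dot_ge0.
pose y := \sum_(s < m.+1) (w ^+ s)^* *: y1 s.
have yP : y \in Pn.
  have -> : y = \sum_(s < m.+1) (w ^+ s)^* *: y0 s.
    apply/eqP; rewrite -subr_eq0 -sumrB; apply/eqP; rewrite -[RHS]phi0 /phi.
    by apply: eq_bigr => s _; rewrite scalerBr.
  by apply: rpred_sum => s _; rewrite rpredZ ?h0.
have hy f : form f y = eval2 f z w.
  rewrite /y dot_sumr eval2E; apply: eq_bigr => s _.
  by rewrite dotZr conjCK h1 // mulrC.
have yr : (eval2 y z w)^* = eval2 y z w by rewrite -hy conj_Creal // ger0_real // dot_ge0.
have yn : inQ n y by apply/PQ.
(* Now the representer [y] lies in P_{n-1,m}, so its shift stays in the space and can itself be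
   evaluated: the norm of [Mz y - z *: y] reduces to values at (z, w) and vanishes. *)
have Dy : eval2 (Mz y - z *: y) z w = 0 by rewrite eval2B eval2_Mz // eval2Z subrr.
have D0 : Mz y - z *: y = 0.
  apply: (dot_eq0 (form := form)); rewrite dotBr dotZr hy Dy mulr0 subr0.
  rewrite dotBl dotZl shift_z // hy [form y (Mz y)]dotC hy eval2_Mz //.
  by rewrite rmorphM /= yr mulrA zz mul1r subrr.
have y00 : y = 0.
  by apply: (@Mz_eig _ z); [exact: circ_neq0|apply/eqP; rewrite -subr_eq0 D0].
(* Contradiction: evaluation at (z, w) sends the constant 1 to 1, hence is not represented by 0. *)
have := hy (mon R n m 0 0); rewrite y00 dot0r eval2E big_ord_recl big1 => [|t _]; last first.
  by rewrite evE big1 ?mul0r // => s _; rewrite cf_mon andbF mul0r.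
rewrite evE big_ord_recl big1 => [|s _]; last by rewrite cf_mon mul0r.
by rewrite cf_mon /= !mulr1 !addr0 => /eqP; rewrite eq_sym oner_eq0.
Qed.

End KernelOfSplit.

(** * Decay of the compressed shift *)

Section ShiftDecay.
Variables (R : realType) (n m : nat) (T : {scalar laurent R n m}).
Hypothesis T_gt0 : positive_form T.
Local Notation C := R[i].
Local Notation H := (bipoly R n m).
Local Notation P k l := (Psp R n m k l).
Local Notation Mz := (Mz R n m).
Local Notation form := (dotT T_gt0).
Local Notation Pn := (P (n%:Z - 1) m%:Z).
Implicit Types (f g h x y F : H) (s t N L k : nat) (z w : C).

Lemma proj_lin (M : {vspace H}) a x y : proj form M (a *: x + y) = a *: proj form M x + proj form M y.
Proof. by rewrite /proj linearP. Qed.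

(** The inner projection brings the argument into P_{n-1,m}, where [Mz] is the genuine, isometric
    multiplication; [Sz] is thus a contraction defined on the whole space. *)
Definition Sz h : H := proj form Pn (Mz (proj form Pn h)).

Lemma Sz_lin a x y : Sz (a *: x + y) = a *: Sz x + Sz y.
Proof. by rewrite /Sz proj_lin linearP proj_lin. Qed.

Lemma Sz_mem h : Sz h \in Pn. Proof. exact: proj_mem. Qed.

Lemma Sz_id h : h \in Pn -> Sz h = proj form Pn (Mz h).
Proof. by move=> hP; rewrite /Sz (proj_id form hP). Qed.

Lemma proj_eq (M : {vspace H}) x : form x x <= form (proj form M x) (proj form M x) ->
  proj form M x = x.
Proof.
have -> : form x x = form (proj form M x) (proj form M x)
    + form (x - proj form M x) (x - proj form M x).
  rewrite -dot_pyth; first by rewrite addrC subrK.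
  by apply: dot_eq0C; apply: proj_orth; exact: proj_mem.
rewrite gerDl => h; apply/eqP; rewrite eq_sym -subr_eq0; apply/eqP/(dot_eq0 (form := form)).
by apply/eqP; rewrite eq_le h dot_ge0.
Qed.

Lemma Sz_le h : form (Sz h) (Sz h) <= form h h.
Proof.
apply: le_trans (proj_le form _ _) _; rewrite shift_z; try by apply/PQ; exact: proj_mem.
exact: proj_le.
Qed.

Lemma Sz_eq h : form h h <= form (Sz h) (Sz h) -> h \in Pn /\ Sz h = Mz h.
Proof.
move=> hh; have pp : proj form Pn h = h.
  apply: proj_eq; apply: le_trans hh _; apply: le_trans (proj_le form _ _) _.
  by rewrite shift_z //; apply/PQ; exact: proj_mem.
have hP : h \in Pn by rewrite -pp proj_mem.
have hQ : inQ n h by apply/PQ.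
split => //; rewrite Sz_id //; apply: proj_eq.
by rewrite -(Sz_id hP) (shift_z T_gt0 hQ hQ).
Qed.

Lemma Sz_iter_le k h : form (iter k Sz h) (iter k Sz h) <= form h h.
Proof. by elim: k => // k IH; apply: le_trans (Sz_le _) IH. Qed.

Lemma Sz_iter_lin k a x y : iter k Sz (a *: x + y) = a *: iter k Sz x + iter k Sz y.
Proof. by elim: k => //= k ->; rewrite Sz_lin. Qed.

(* No norm is lost only as long as multiplication by z stays inside P_{n-1,m}, which it cannot do n + 1 times. *)
Lemma Sz_iter_eq k h : (k <= n.+1)%N -> form h h <= form (iter k Sz h) (iter k Sz h) ->
  inQ (n.+1 - k) h.
Proof.
elim: k h => [|k IH] h kn hh.
  by rewrite subn0 => s t sn; rewrite cf_gt // negb_and -(ltnNge n) sn.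
rewrite iterSr in hh.
have [hP SE] := Sz_eq (le_trans hh (Sz_iter_le _ _)).
have /IH := le_trans (Sz_le h) hh; rewrite SE => /(_ (ltnW kn)) hQ s t st.
have [sn|sn] := ltnP s n; last by have /PQ := hP; apply.
have := hQ s.+1 t; rewrite cf_MzS sn; apply.
by move: st kn; lia.
Qed.

(** One step preserves the norm of every h in P_{n-1,m} with z h in P_{n-1,m}, so strictness is
    established for the power n + 1, and finite dimension turns it into a uniform ratio. *)
Lemma Sz_decay e : 0 < e -> exists N, forall h,
  form (iter N Sz h) (iter N Sz h) <= e * form h h.
Proof.
move=> e0; have [||r [r0 r1 hr]] := @strict_contraction _ _ form (iter n.+1 Sz).
- by move=> a x y; exact: Sz_iter_lin.
- move=> x x0; rewrite lt_neqAle Sz_iter_le andbT; apply: contra x0 => /eqP xx.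
  have := @Sz_iter_eq n.+1 x (leqnn _); rewrite xx lexx => /(_ isT); rewrite subnn => h.
  by apply/eqP/cf_inj => s t; rewrite cf0 h.
have [N hN] := geom_small r0 r1 e0.
have it k h : form (iter (k * n.+1) Sz h) (iter (k * n.+1) Sz h) <= r ^+ k * form h h.
  elim: k => [|k IH]; first by rewrite mul0n expr0 mul1r.
  rewrite mulSn iterD; apply: le_trans (hr _) _.
  by rewrite exprS -mulrA ler_wpM2l.
exists (N * n.+1)%N => h; apply: le_trans (it _ _) _.
by apply: ler_wpM2r => //; exact: dot_ge0.
Qed.

End ShiftDecay.

(** * The form of T is the inner product of 1/|p|^2 *)

Section FiberIsometry.
Variables (R : realType) (n m : nat) (T : {scalar laurent R n m}).
Hypothesis T_gt0 : positive_form T.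
Local Notation C := R[i].
Local Notation H := (bipoly R n m).
Local Notation P k l := (Psp R n m k l).
Local Notation Mz := (Mz R n m).
Local Notation form := (dotT T_gt0).
Local Notation Pn := (P (n%:Z - 1) m%:Z).
Implicit Types (f g h x y F : H) (s t N L k : nat) (z w : C).
Variable p : H.
Hypothesis p_nz : forall z w : C, `|z| = 1 -> `|w| <= 1 -> eval2 p z w != 0.
Hypothesis ker : forall z, `|z| = 1 -> exists y1 y0 : nat -> H,
  [/\ forall s f, (s <= m)%N -> form f (y1 s) = ev z s f,
      forall s, (s <= m)%N -> y0 s \in Pn,
      forall s f, (s <= m)%N -> f \in Pn -> form f (y0 s) = ev z s f &
      cd_kernel m (fun t => ev z t p) (fun t s => ev z t (y1 s - y0 s))].

Definition orthPn f := forall g, g \in Pn -> form f g = 0.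

(** Expand f in the kernel elements [phi s]: by [kernel_inv] the Toeplitz matrix of the fibre undoes
    the kernel, and what remains are the products of F with the [phi s]. *)
Lemma fiber_dot z F f : `|z| = 1 -> orthPn F -> orthPn f ->
  cmean (fun w => eval2 F z w * (eval2 f z w)^* * dens p z w) = form F f.
Proof.
move=> z1 F0 f0; have [y1 [y0 [h1 h0 h0' hX]]] := ker z1.
pose phi s := y1 s - y0 s.
have phiE s g : (s <= m)%N -> orthPn g -> form g (phi s) = ev z s g.
  by move=> sm g0; rewrite /phi dotBr h1 // g0 ?h0 // subr0.
have phi0 s : (s <= m)%N -> orthPn (phi s).
  by move=> sm g gP; apply: dot_eq0C; rewrite /phi dotBr h1 // h0' // subrr.
have -> : cmean (fun w => eval2 F z w * (eval2 f z w)^* * dens p z w) =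
    \sum_(i < m.+1) \sum_(j < m.+1) ev z i F * (ev z j f)^* * mu p z (i%:Z - j%:Z).
  transitivity (cmean (fun w => (\sum_(i < m.+1) ev z i F * w ^ (i%:Z + 0)) *
     (\sum_(j < m.+1) ev z j f * w ^ (j%:Z + 0))^* * dens p z w)).
    apply: eq_cmean => w w1; rewrite !eval2E; congr (_ * _^* * _);
    by apply: eq_bigr => i _; rewrite addr0.
  rewrite (fiber_sum p_nz m.+1 m.+1 (fun i => ev z i F) (fun j => ev z j f) 0 0 z1).
  apply: eq_bigr => i _; apply: eq_bigr => j _.
  by rewrite !addr0.
pose U := (\sum_(s < m.+1) <[phi s]>)%VS.
(* The [phi s] span the complement of P_{n-1,m}: a vector of the complement orthogonal to all of
   them has zero coefficients on the fibre, hence is 0 by [ev_inj]. *)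
have [c fE] : exists c : 'I_m.+1 -> C, f = \sum_(s < m.+1) c s *: phi s.
  have : f \in U.
    rewrite -(subrK (proj form U f) f) (_ : f - proj form U f = 0) ?add0r ?proj_mem //.
    have phiU s : (s <= m)%N -> phi s \in U.
      rewrite -ltnS => sm; apply/memv_sumP.
      exists (fun i : 'I_m.+1 => if i == Ordinal sm then phi s else 0).
        by move=> i _; case: eqP => [->|_]; rewrite ?mem0v // memv_line.
      by rewrite -big_mkcond big_pred1_eq.
    have U0 g : g \in U -> orthPn g.
      move=> /memv_sumP[v vE ->] k kP; rewrite dot_suml big1 // => i _.
      have /vlineP[a ->] := vE i isT; rewrite dotZl phi0 ?mulr0 //.
      by rewrite -ltnS.
    have r0 : orthPn (f - proj form U f).
      by move=> g gP; rewrite dotBl f0 // (U0 _ (proj_mem _ _ _)) // subrr.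
    apply: (ev_inj z1 r0) => t tm.
    by rewrite -phiE // proj_orth // phiU.
  move=> /memv_sumP[v vE ->].
  have /choice[c hc] : forall i : 'I_m.+1, exists a, v i = a *: phi i.
    by move=> i; have /vlineP := vE i isT.
  by exists c; apply: eq_bigr => i _; rewrite hc.
rewrite {2}fE dot_sumr.
have -> : \sum_(i < m.+1) \sum_(j < m.+1) ev z i F * (ev z j f)^* * mu p z (i%:Z - j%:Z) =
    \sum_(i < m.+1) \sum_(s < m.+1) (c s)^* * (ev z i F * (s == i)%:R).
  apply: eq_bigr => i _; transitivity (\sum_(j < m.+1) \sum_(s < m.+1)
     (c s)^* * (ev z i F * (ev z s (phi j) * mu p z (i%:Z - j%:Z)))).
    apply: eq_bigr => j _; rewrite fE ev_sum rmorph_sum mulr_sumr mulr_suml.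
    apply: eq_bigr => s _; rewrite evZ (rmorphM Num.conj) /=.
    have [_ _ Xh _] := hX; rewrite (Xh s j) ?conjCK; first by ring.
      by rewrite -ltnS.
    by rewrite -ltnS.
  rewrite exchange_big; apply: eq_bigr => s _; rewrite -mulr_sumr -mulr_sumr.
  congr (_ * (_ * _)).
  rewrite (kernel_inv (fun j : int => mu_conj p_nz j z1) (q0_neq0 p_nz z1) (fun k => mu_q_fiber p_nz k z1) hX) //.
    by rewrite -ltnS.
  by rewrite -ltnS.
rewrite exchange_big; apply: eq_bigr => s _; rewrite dotZr phiE ?F0 //; last by rewrite -ltnS.
rewrite -mulr_sumr; congr (_ * _).
rewrite (bigD1 s) //= eqxx mulr1 big1 ?addr0 // => i si.
by rewrite eq_sym (negbTE si) mulr0.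
Qed.

(** The fibrewise product does not depend on z, so z^k integrates against a constant: the complement
    of P_{n-1,m} is a wandering subspace for z. *)
Lemma torus_dot k F f : orthPn F -> orthPn f ->
  G p (fun z w => z ^+ k * eval2 F z w) (eval2 f) = (k == 0%N)%:R * form F f.
Proof.
move=> F0 f0; rewrite (@G_fiber _ _ _ p p_nz _ _ (fun z => form F f * z ^+ k)).
- by rewrite (cmeanZ _ (cokX R k)) cmeanX mulrC.
- by apply: tokM; [exact: tok_zX|exact: tok_eval2].
- exact: tok_eval2.
- by apply: cokM; [exact: cok_cst|exact: cokX].
move=> z z1; rewrite -(fiber_dot z1 F0 f0) mulrC -cmeanZ.
  by apply: eq_cmean => w _; ring.
apply: cokM; last exact: cok_fiber.
have ce (h : H) : cok (eval2 h z).
  apply: (@cok_ext _ (fun w => \sum_(t < m.+1) ev z t h * w ^+ t)).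
    by move=> w _; rewrite eval2E.
  by apply: cok_sum => t _; apply: cokM; [exact: cok_cst|exact: cokX].
by apply: cokM; [|apply: cok_conj].
Qed.

Local Notation S := (Sz T_gt0).
Local Notation pr := (proj form Pn).

(** z^N f minus its remainder in P_{n-1,m}. By [VS] it is a combination of powers of z times
    elements of the complement, on which the two inner products are already known to agree. *)
Let V N f (z w : C) := z ^+ N * eval2 f z w - eval2 (iter N S (pr f)) z w.

Let tokV N f : tok (V N f).
Proof.
by apply: tokB; [apply: tokM; [exact: tok_zX|]|]; exact: tok_eval2.
Qed.

Let tokzV k N f : tok (fun z w => z ^+ k * V N f z w).
Proof. by apply: tokM; [exact: tok_zX|exact: tokV]. Qed.

Let Phi h := Mz h - S h.

Let S_mem N f : iter N S (pr f) \in Pn.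
Proof. by case: N => [|N]; exact: proj_mem. Qed.

Let Phi0 h : h \in Pn -> orthPn (Phi h).
Proof. by move=> hP g gP; rewrite /Phi Sz_id // proj_orth. Qed.

Let PhiPhi h h' : h \in Pn -> h' \in Pn ->
  form (Phi h) (Phi h') = form h h' - form (S h) (S h').
Proof.
move=> hP hP'; have hQ : inQ n h by apply/PQ.
have hQ' : inQ n h' by apply/PQ.
rewrite -(shift_z T_gt0 hQ hQ').
rewrite {2}/Phi dotBr (Phi0 hP (Sz_mem T_gt0 h')) subr0 /Phi dotBl; congr (_ - _).
by rewrite (Sz_id T_gt0 hP') proj_dotr // Sz_mem.
Qed.

Let V0 f z w : V 0 f z w = eval2 (f - pr f) z w.
Proof. by rewrite /V expr0 mul1r eval2B. Qed.

Let VS N f z w : V N.+1 f z w = z * V N f z w + eval2 (Phi (iter N S (pr f))) z w.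
Proof.
rewrite /V /Phi eval2B eval2_Mz //= exprS; by ring.
Qed.

Let V_orth N k f g : orthPn g -> G p (fun z w => z ^+ k.+1 * V N f z w) (eval2 g) = 0.
Proof.
move=> g0; elim: N k => [|N IH] k.
  rewrite (@eqG _ _ _ p _ (fun z w => z ^+ k.+1 * eval2 (f - pr f) z w) _ (eval2 g)) //; last first.
    by move=> z w _ _; rewrite V0.
  by rewrite torus_dot ?mul0r // => x xP; exact: proj_orth.
rewrite (@eqG _ _ _ p _ (fun z w => z ^+ k.+2 * V N f z w
    + z ^+ k.+1 * eval2 (Phi (iter N S (pr f))) z w) _ (eval2 g)) //; last first.
  by move=> z w _ _; rewrite VS mulrDr mulrA -exprSr.
rewrite GDl ?IH ?torus_dot ?mul0r ?addr0 //; first exact: Phi0.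
  by apply: tokM; [exact: tok_zX|exact: tok_eval2].
exact: tok_eval2.
Qed.

Let circ_M z (a b : C) : `|z| = 1 -> z * a * (z * b)^* = a * b^*.
Proof.
move=> z1; have zz : z * z^* = 1 by rewrite -normCK z1 expr1n.
by rewrite (rmorphM Num.conj) /= mulrACA zz mul1r.
Qed.

(** Each step adds a term orthogonal to z times the previous ones, of product [PhiPhi]; the sum
    telescopes. *)
Let VV N f g : G p (V N f) (V N g) = form f g - form (iter N S (pr f)) (iter N S (pr g)).
Proof.
elim: N => [|N IH].
  rewrite (@eqG _ _ _ p _ (fun z w => z ^+ 0 * eval2 (f - pr f) z w) _ (eval2 (g - pr g))); first last.
  - by move=> z w _ _; rewrite V0.
  - by move=> z w _ _; rewrite V0 expr0 mul1r.
  rewrite torus_dot; try by move=> x xP; exact: proj_orth.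
  rewrite mul1r /= dotBr (proj_orth _ _ (proj_mem _ _ _)) subr0 dotBl.
  by rewrite proj_dotr ?proj_mem // proj_dotl ?proj_mem // proj_dotr ?proj_mem.
have t1 h : tok (fun z w => z * V N h z w) by apply: tokM; [exact: tok_z|exact: tokV].
have t2 h : tok (eval2 (Phi h)) by exact: tok_eval2.
rewrite (@eqG _ _ _ p _ (fun z w => z * V N f z w + eval2 (Phi (iter N S (pr f))) z w) _
   (fun z w => z * V N g z w + eval2 (Phi (iter N S (pr g))) z w)); first last.
- by move=> z w _ _; rewrite VS.
- by move=> z w _ _; rewrite VS.
rewrite (GDl p_nz (t1 f) (t2 _) (tokD (t1 g) (t2 _))) !(GDr p_nz _ (t1 g) (t2 _)) //.
have c1 h x : orthPn x -> G p (fun z w => z * V N h z w) (eval2 x) = 0.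
  by move=> x0; exact: (@V_orth N 0 h x x0).
rewrite (c1 f) ?addr0; last exact: Phi0.
rewrite [G p (eval2 _) (fun z w => z * _)](G_conj p_nz) // (c1 g) ?rmorph0 ?add0r; last exact: Phi0.
have -> : G p (eval2 (Phi (iter N S (pr f)))) (eval2 (Phi (iter N S (pr g)))) =
    form (Phi (iter N S (pr f))) (Phi (iter N S (pr g))).
  rewrite -[RHS]mul1r -(@torus_dot 0); try exact: Phi0.
  by apply: eqG => // z w _ _; rewrite expr0 mul1r.
have -> : G p (fun z w => z * V N f z w) (fun z w => z * V N g z w) = G p (V N f) (V N g).
  by apply: eq_tmean => z w z1 _; rewrite circ_M.
rewrite IH PhiPhi //; by ring.
Qed.

Let G_quad : exists2 K : C, 0 <= K & forall h, G p (eval2 h) (eval2 h) <= K ^+ 2 * form h h.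
Proof.
have te h : tok (eval2 h) by exact: tok_eval2.
have [||||B B0 hB] := @quad_bound _ _ (fun h => G p (eval2 h) (eval2 h)) form.
- by move=> h; exact: G_ge0.
- transitivity (G p (fun z w => 0 * eval2 (0 : H) z w) (eval2 (0 : H))); last by rewrite GZl // mul0r.
  by apply: eq_tmean => z w _ _; rewrite -(scale0r (0 : H)) !eval2Z !mul0r.
- move=> a x; rewrite normCK -mulrA -GZr // -GZl //; last by apply: tokM => //; exact: tok_cst.
  by apply: eq_tmean => z w _ _; rewrite !eval2Z.
- move=> x y; have := G_ge0 p (fun z w => eval2 x z w + (-1) * eval2 y z w).
  have tm : tok (fun z w => -1 * eval2 y z w) by apply: tokM => //; exact: tok_cst.
  rewrite (GDl p_nz (te x) tm (tokD (te x) tm)) !(GDr p_nz _ (te x) tm) // !(GZl p_nz) // !(GZr p_nz) //.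
  have -> : G p (eval2 (x + y)) (eval2 (x + y)) = G p (fun z w => eval2 x z w + eval2 y z w)
      (fun z w => eval2 x z w + eval2 y z w).
    by apply: eq_tmean => z w _ _; rewrite -[x]scale1r !eval2_lin scale1r mul1r.
  rewrite (GDl p_nz (te x) (te y) (tokD (te x) (te y))) !(GDr p_nz _ (te x) (te y)) //.
  move=> h; rewrite -subr_ge0; apply: le_trans h _; rewrite le_eqVlt; apply/orP; left; apply/eqP.
  by rewrite rmorphN rmorph1; ring.
(* B <= (B + 1)^2 replaces a square root. *)
exists (B + 1); first by rewrite addr_ge0 // ltW.
move=> h; apply: le_trans (hB h) _; apply: ler_wpM2r; first exact: dot_ge0.
have B1 : 0 <= B ^+ 2 + B + 1 by rewrite !addr_ge0 // ?exprn_ge0 // ltW.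
by rewrite -subr_ge0; apply: le_trans B1 _; rewrite le_eqVlt; apply/orP; left; apply/eqP; ring.
Qed.

Let sq_le (x y : C) : 0 <= y -> `|x| ^+ 2 <= y ^+ 2 -> `|x| <= y.
Proof. by move=> y0; rewrite ler_sqr ?nnegrE. Qed.

Lemma torus_form f g : G p (eval2 f) (eval2 g) = form f g.
Proof.
have [K K0 hK] := G_quad.
have te h : tok (eval2 h) by exact: tok_eval2.
pose B := form f f + form g g.
have B0 : 0 <= B by rewrite addr_ge0 ?dot_ge0.
have fB : form f f <= B by rewrite /B lerDl dot_ge0.
have gB : form g g <= B by rewrite /B lerDr dot_ge0.
(* In the constant, 1 bounds the product of the two remainders in the form of T, each K a mixed
   term, and K^2 their product in [G]. *)
apply/eqP; rewrite -subr_eq0; apply/eqP; apply: (@small0 _ _ (B * (1 + 2 * K + K ^+ 2))).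
  by rewrite mulr_ge0 // !addr_ge0 // ?mulr_ge0 ?exprn_ge0.
(* This choice gives both e <= e0 and e <= 1, so powers of e may be replaced by e. *)
move=> e0 e0p; pose e := e0 / (1 + e0).
have e1p : 0 < 1 + e0 by rewrite addr_gt0.
have ep : 0 < e by rewrite divr_gt0.
have e1 : e <= 1 by rewrite ler_pdivrMr // mul1r lerDr.
have ee0 : e <= e0 by rewrite ler_pdivrMr // ler_peMr // ?lerDl ltW.
have e2e : e ^+ 2 <= e by rewrite expr2 ler_piMl // ltW.
have e21 : e ^+ 2 <= 1 := le_trans e2e e1.
have e_ge0 : 0 <= e := ltW ep.
have [N hN] := Sz_decay T_gt0 (exprn_gt0 2 ep).
have hs h : form h h <= B -> form (iter N S (pr h)) (iter N S (pr h)) <= e ^+ 2 * B.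
  move=> hB; apply: le_trans (hN _) _; apply: ler_wpM2l; first by rewrite exprn_ge0 // ltW.
  exact: le_trans (proj_le _ _ _) hB.
(* The remainders of f and g after N steps; here [outer_idx] is just a local name for the one of
   g. *)
set sf := iter N S (pr f); set outer_idx := iter N S (pr g).
have hf : form sf sf <= e ^+ 2 * B := hs f fB.
have hg : form outer_idx outer_idx <= e ^+ 2 * B := hs g gB.
have VB h : form h h <= B -> G p (V N h) (V N h) <= B.
  by move=> hB; rewrite VV; apply: le_trans hB; rewrite gerDl oppr_le0 dot_ge0.
have GB (s : H) : form s s <= e ^+ 2 * B -> G p (eval2 s) (eval2 s) <= K ^+ 2 * (e ^+ 2 * B).
  by move=> sB; apply: le_trans (hK s) _; apply: ler_wpM2l => //; exact: exprn_ge0.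
have b1 : `|form sf outer_idx| <= e * B.
  apply: sq_le; first by rewrite mulr_ge0.
  apply: le_trans (dotCS _ _ _) _; apply: le_trans (ler_pM _ _ hf hg) _; rewrite ?dot_ge0 //.
  have -> : e ^+ 2 * B * (e ^+ 2 * B) = e ^+ 2 * (e * B) ^+ 2 by ring.
  by apply: ler_piMl e21; rewrite exprn_ge0 // mulr_ge0.
have cross h (s : H) : form h h <= B -> form s s <= e ^+ 2 * B -> `|G p (V N h) (eval2 s)| <= K * e * B.
  move=> hB sB; apply: sq_le; first exact: mulr_ge0 (mulr_ge0 K0 e_ge0) B0.
  apply: le_trans (G_CS p_nz (tokV _ _) (te _)) _.
  apply: le_trans (ler_pM (G_ge0 _ _) (G_ge0 _ _) (VB _ hB) (GB _ sB)) _.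
  by rewrite le_eqVlt; apply/orP; left; apply/eqP; ring.
have b4 : `|G p (eval2 sf) (eval2 outer_idx)| <= K ^+ 2 * e * B.
  apply: sq_le; first exact: mulr_ge0 (mulr_ge0 (exprn_ge0 2 K0) e_ge0) B0.
  apply: le_trans (G_CS p_nz (te _) (te _)) _.
  apply: le_trans (ler_pM (G_ge0 _ _) (G_ge0 _ _) (GB _ hf) (GB _ hg)) _.
  have -> : K ^+ 2 * (e ^+ 2 * B) * (K ^+ 2 * (e ^+ 2 * B)) = e ^+ 2 * (K ^+ 2 * e * B) ^+ 2 by ring.
  by apply: ler_piMl e21; apply: exprn_ge0; exact: mulr_ge0 (mulr_ge0 (exprn_ge0 2 K0) e_ge0) B0.
have GE : G p (eval2 f) (eval2 g) = G p (V N f) (V N g) + G p (V N f) (eval2 outer_idx)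
    + G p (eval2 sf) (V N g) + G p (eval2 sf) (eval2 outer_idx).
  transitivity (G p (fun z w => V N f z w + eval2 sf z w) (fun z w => V N g z w + eval2 outer_idx z w)); last first.
    rewrite (GDl p_nz (tokV N f) (te sf) (tokD (tokV N g) (te outer_idx))).
    by rewrite (GDr p_nz (tokV N f) (tokV N g) (te outer_idx)) (GDr p_nz (te sf) (tokV N g) (te outer_idx)) addrA.
  apply: eq_tmean => z w z1 _; rewrite /V !subrK; congr (_ * _).
  by rewrite circ_M // normrX z1 expr1n.
have -> : G p (eval2 f) (eval2 g) - form f g =
   - form sf outer_idx + G p (V N f) (eval2 outer_idx) + G p (eval2 sf) (V N g) + G p (eval2 sf) (eval2 outer_idx).
  by rewrite GE VV -/sf -/outer_idx; ring.
have n4 (a b c d : C) : `|a + b + c + d| <= `|a| + `|b| + `|c| + `|d|.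
  by do 2 apply: (le_trans (ler_normD _ _)) (lerD _ _) => //; exact: ler_normD.
apply: le_trans (n4 _ _ _ _) _; rewrite normrN [G p (eval2 sf) (V N g)](G_conj p_nz) // norm_conjC.
apply: le_trans (lerD (lerD (lerD b1 (cross f outer_idx fB hg)) (cross g sf gB hf)) b4) _.
have -> : e * B + K * e * B + K * e * B + K ^+ 2 * e * B = B * (1 + 2 * K + K ^+ 2) * e by ring.
by apply: ler_wpM2l => //; rewrite mulr_ge0 // !addr_ge0 // ?mulr_ge0 ?exprn_ge0.
Qed.

End FiberIsometry.

Section SplitBS.
Variables (R : realType) (n m : nat) (T : {scalar laurent R n m}).
Hypothesis T_gt0 : positive_form T.
Local Notation C := R[i].
Local Notation H := (bipoly R n m).
Local Notation Mz := (Mz R n m).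
Local Notation form := (dotT T_gt0).

Lemma eval2_mon s t (z w : C) : (s <= n)%N -> (t <= m)%N ->
  eval2 (mon R n m s t) z w = z ^+ s * w ^+ t.
Proof.
move=> sn tm; rewrite eval2E.
have tm1 : (t < m.+1)%N by [].
have sn1 : (s < n.+1)%N by [].
have cE i j : cf (mon R n m s t) i j = ((i == s) && (j == t))%:R.
  rewrite cf_mon; case: eqP => [->|] //=; case: eqP => [->|] //=; by rewrite sn tm.
rewrite (bigD1 (Ordinal tm1)) //= evE (bigD1 (Ordinal sn1)) //= cE !eqxx mul1r.
rewrite big1 => [|i si]; last first.
  by rewrite cE (_ : (i == s :> nat) = false) ?mul0r //; apply/negbTE.
rewrite addr0 big1 ?addr0 // => j tj; rewrite evE big1 ?mul0r // => i _.
by rewrite cE (_ : (j == t :> nat) = false) ?andbF ?mul0r //; apply/negbTE.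
Qed.

Lemma int_diff (N : nat) (j : int) : `|j| <= N%:Z ->
  exists s s' : nat, [/\ j = s%:Z - s'%:Z, (s <= N)%N & (s' <= N)%N].
Proof.
by case: j => a aN; [exists a, 0%N|exists 0%N, a.+1]; split => //; move: aN; lia.
Qed.

Lemma form_lmon s t s' t' : (s <= n)%N -> (t <= m)%N -> (s' <= n)%N -> (t' <= m)%N ->
  T (lmon R n m (s%:Z - s'%:Z) (t%:Z - t'%:Z)) = form (mon R n m s t) (mon R n m s' t').
Proof. by move=> sn tm sn' tm'; rewrite -lprod_mon. Qed.

Lemma G_mon (p : H) s t s' t' : (s <= n)%N -> (t <= m)%N -> (s' <= n)%N -> (t' <= m)%N ->
  tmean (fun z w => z ^ (s%:Z - s'%:Z) * w ^ (t%:Z - t'%:Z) * dens p z w) =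
  G p (eval2 (mon R n m s t)) (eval2 (mon R n m s' t')).
Proof.
move=> sn tm sn' tm'; apply: eq_tmean => z w z1 w1.
have z0 := circ_neq0 z1; have w0 := circ_neq0 w1.
rewrite !eval2_mon // (rmorphM Num.conj) /=; congr (_ * _).
rewrite !exprnP (circ_conjX _ z1) (circ_conjX _ w1) !expfzDr //; ring.
Qed.

Lemma split_bs d : (d <= n)%N -> split_shift T_gt0 d -> bernstein_szego T d.
Proof.
move=> dn [K1 [K2 [[DK K12] K1z K1E zK2E dK1]]].
have k12 x y : x \in K1 -> y \in K2 -> form x y = 0 by exact: (orthS form K1 K2 K12).
have k1z x y : x \in K1 -> y \in K2 -> form x (Mz y) = 0.
  by move=> xK yK; apply: (orthS form K1 (Mz @: K2)%VS K1z) => //; exact: memv_img.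
have [p [pE pp pK1 pK2 Edec]] := poly_ex DK k12 k1z K1E zK2E.
have nz := nonvanish DK k12 k1z K1E zK2E pE pp pK1 pK2 Edec.
exists p; split.
- exact: nz.
- exact: (zeros_count DK k12 k1z K1E zK2E dK1 pE pp pK1 pK2 Edec nz dn).
move=> j k /int_diff[s [s' [-> sn sn']]] /int_diff[t [t' [-> tm tm']]].
rewrite torus_moment // G_mon // form_lmon // (@torus_form _ _ _ T T_gt0 p nz) //.
exact: (kernel_ex DK k12 k1z K1E zK2E pE pp pK1 pK2 Edec).
Qed.

End SplitBS.

(** * From the Bernstein-Szego condition to the split-shift condition *)

Section Vanishing.
Context (R : realType) (n m : nat).
Local Notation C := R[i].
Local Notation H := (bipoly R n m).
Variable p : H.
Hypothesis p_nz : forall z w : C, `|z| = 1 -> `|w| <= 1 -> eval2 p z w != 0.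
Local Notation G := (G p).
Variables (ef : int -> nat -> C -> C -> C) (c : nat -> nat -> nat -> C) (B : int -> nat -> C).

(** The [ef a t] abstract the monomials of a half-plane of Fourier indices, and [c i t] the
    coefficients in z, of degrees -n to n, of the inverse fibre matrix; by [dual], the [kf] are
    biorthogonal to the [ef]. *)
Definition kf (k : int) i (z w : C) : C :=
  \sum_(t < m) \sum_(l < (n + n).+1) c i t l * ef (k + l%:Z - n%:Z) t z w.

Hypothesis ef_tok : forall a t, tok (ef a t).
Hypothesis dual : forall k b i l, (i < m)%N -> (l < m)%N ->
  G (kf k i) (ef b l) = ((k == b) && (i == l))%:R.
Hypothesis B_kf : forall (k : nat) i, (i < m)%N ->
  \sum_(t < m) \sum_(l < (n + n).+1) (c i t l)^* * B (k%:Z + l%:Z - n%:Z) t = 0.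
Hypothesis B_win : forall a t, (t < m)%N -> - n%:Z <= a -> a < 0 -> B a t = 0.
Variable M : C.
Hypothesis B_bd : forall a t, (t < m)%N -> `|B a t| <= M.

(** By biorthogonality, the function whose products with the [ef b t] are [B b t] for 0 <= b < N and
    0 elsewhere. *)
Let U N (z w : C) := \sum_(k < N) \sum_(i < m) B k%:Z i * kf k%:Z i z w.
Let SS N (W : int -> nat -> C) := \sum_(k < N) \sum_(i < m) (B k%:Z i)^* *
  \sum_(t < m) \sum_(l < (n + n).+1) (c i t l)^* * W (k%:Z + l%:Z - n%:Z) t.

Let kf_tok k i : tok (kf k i).
Proof.
by apply: tok_sum => t _; apply: tok_sum => l _; apply: tokM; [exact: tok_cst|exact: ef_tok].
Qed.
Let Bkf_tok k i : tok (fun z w => B k i * kf k i z w).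
Proof. by apply: tokM; [exact: tok_cst|exact: kf_tok]. Qed.
Let row_tok (k : nat) : tok (fun z w => \sum_(i < m) B k%:Z i * kf k%:Z i z w).
Proof. by apply: tok_sum => i _; exact: Bkf_tok. Qed.
Let U_tok N : tok (U N).
Proof. by apply: tok_sum => k _; apply: tok_sum => i _; exact: Bkf_tok. Qed.

Let trunc N (b : int) t := if (0 <= b) && (b < N%:Z) then B b t else 0.

Let U_ef N b l : (l < m)%N -> G (U N) (ef b l) = trunc N b l.
Proof.
move=> lm; rewrite /U (G_suml p_nz _ (P := xpredT) (U := fun (k : 'I_N) z w => \sum_(i < m) B k%:Z i * kf k%:Z i z w)
  (fun k _ => row_tok k) (ef_tok b l)).
transitivity (\sum_(k < N) (k%:Z == b)%:R * B b l).
  apply: eq_bigr => k _.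
  rewrite (G_suml p_nz _ (P := xpredT) (U := fun (i : 'I_m) z w => B k%:Z i * kf k%:Z i z w)
    (fun i _ => Bkf_tok k%:Z i) (ef_tok b l)).
  rewrite (bigD1 (Ordinal lm)) //= GZl // dual // eqxx andbT.
  rewrite big1 ?addr0 => [|i il].
    by case: eqP => [->|_]; rewrite ?mulr1 ?mul1r ?mulr0 ?mul0r.
  rewrite GZl // dual // (_ : (i == l :> nat) = false) ?andbF ?mulr0 //.
  exact/negbTE.
rewrite /trunc; case: ifP => [/andP[]|].
  case: b => // b _ bN; rewrite ltz_nat in bN.
  rewrite (bigD1 (Ordinal bN)) //= eqxx mul1r big1 ?addr0 // => k kb.
  by rewrite eqz_nat (_ : (k == b :> nat) = false) ?mul0r //; exact/negbTE.
move/negbT => nb; rewrite big1 // => k _; case: eqP => [kb|]; last by rewrite mul0r.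
by case/negP: nb; rewrite -kb ltz_nat ltn_ord.
Qed.

Let G_U u N : tok u -> G u (U N) = SS N (fun b t => G u (ef b t)).
Proof.
move=> hu; rewrite /U (G_sumr p_nz _ (P := xpredT) (U := fun (k : 'I_N) z w => \sum_(i < m) B k%:Z i * kf k%:Z i z w)
  (fun k _ => row_tok k) hu).
apply: eq_bigr => k _.
rewrite (G_sumr p_nz _ (P := xpredT) (U := fun (i : 'I_m) z w => B k%:Z i * kf k%:Z i z w)
  (fun i _ => Bkf_tok k%:Z i) hu).
apply: eq_bigr => i _; rewrite (GZr p_nz _ hu (kf_tok k%:Z i)); congr (_ * _).
have ct (t : nat) (l : nat) : tok (fun z w => c i t l * ef (k%:Z + l%:Z - n%:Z) t z w).
  by apply: tokM; [exact: tok_cst|exact: ef_tok].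
have ct2 (t : nat) : tok (fun z w => \sum_(l < (n + n).+1) c i t l * ef (k%:Z + l%:Z - n%:Z) t z w).
  by apply: tok_sum => l _; exact: ct.
rewrite /kf (G_sumr p_nz _ (P := xpredT) (U := fun (t : 'I_m) z w => \sum_(l < (n + n).+1) c i t l * ef (k%:Z + l%:Z - n%:Z) t z w)
  (fun t _ => ct2 t) hu).
apply: eq_bigr => t _.
rewrite (G_sumr p_nz _ (P := xpredT) (U := fun (l : 'I_(n + n).+1) z w => c i t l * ef (k%:Z + l%:Z - n%:Z) t z w)
  (fun l _ => ct t l) hu).
by apply: eq_bigr => l _; rewrite (GZr p_nz _ hu (ef_tok _ _)).
Qed.

Let SS_B N : SS N B = 0.
Proof.
by rewrite /SS big1 // => k _; rewrite big1 // => i _; rewrite B_kf ?mulr0.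
Qed.

Let eq_SS N W W' : (forall b t, (t < m)%N -> - n%:Z <= b -> b < (N + n)%:Z -> W b t = W' b t) ->
  SS N W = SS N W'.
Proof.
move=> h; apply: eq_bigr => k _; apply: eq_bigr => i _; congr (_ * _).
apply: eq_bigr => t _; apply: eq_bigr => l _; rewrite h //.
  by have := ltn_ord l; lia.
by have := ltn_ord l; have := ltn_ord k; lia.
Qed.

(** [U N'] involves indices from -n to N' + n - 1 only. There the products of [U N] coincide with
    [B], the window giving the negative indices, and [B] is annihilated by the kernel. *)
Let UU N N' : (N' + n <= N)%N -> G (U N) (U N') = 0.
Proof.
move=> NN; rewrite G_U // -(SS_B N'); apply: eq_SS => b t tm nb bN.
rewrite U_ef // /trunc; case: (leP 0 b) => b0 /=; last by rewrite B_win.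
by rewrite ifT //; move: bN NN; lia.
Qed.

Let K := \sum_(i < m) \sum_(t < m) \sum_(l < (n + n).+1) M * (`|c i t l| * M).

(** The truncation is noticed only by the last n rows, whence a bound independent of N. *)
Let UUn N : G (U (N + n)) (U (N + n)) <= n%:R * K.
Proof.
set g := G _ _; have g0 : 0 <= g := G_ge0 p _.
suff : `|g| <= n%:R * K by rewrite ger0_norm.
have -> : g = \sum_(k < n) \sum_(i < m) (B (N + k)%N%:Z i)^* *
   \sum_(t < m) \sum_(l < (n + n).+1) (c i t l)^* *
     (trunc (N + n) ((N + k)%N%:Z + l%:Z - n%:Z) t - B ((N + k)%N%:Z + l%:Z - n%:Z) t).
  transitivity (SS (N + n) (trunc (N + n)) - SS (N + n) B).
    by rewrite SS_B subr0 /g G_U //; apply: eq_SS => b t tm _ _; rewrite U_ef.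
  rewrite /SS -sumrB.
  rewrite big_split_ord /= big1 => [|k _]; last first.
    rewrite -sumrB big1 // => i _; rewrite -mulrBr -sumrB big1 ?mulr0 // => t _.
    rewrite -sumrB big1 // => l _; rewrite -mulrBr /trunc.
    case: (leP 0 (k%:Z + l%:Z - n%:Z)) => b0 /=; last first.
      by rewrite B_win ?subrr ?mulr0 //; have := ltn_ord l; lia.
    by rewrite ifT ?subrr ?mulr0 //; have := ltn_ord k; have := ltn_ord l; lia.
  rewrite add0r; apply: eq_bigr => k _; rewrite -sumrB; apply: eq_bigr => i _.
  rewrite -mulrBr -sumrB; congr (_ * _); apply: eq_bigr => t _.
  by rewrite -sumrB; apply: eq_bigr => l _; rewrite -mulrBr.
have M0 (t : 'I_m) : 0 <= M by apply: le_trans (B_bd 0 (ltn_ord t)).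
apply: le_trans (ler_norm_sum _ _ _) _.
have -> : n%:R * K = \sum_(k < n) K by rewrite sumr_const card_ord mulr_natl.
apply: ler_sum => k _; apply: le_trans (ler_norm_sum _ _ _) _; apply: ler_sum => i _.
rewrite normrM norm_conjC.
have -> : \sum_(t < m) \sum_(l < (n + n).+1) M * (`|c i t l| * M) =
    M * \sum_(t < m) \sum_(l < (n + n).+1) `|c i t l| * M.
  by rewrite mulr_sumr; apply: eq_bigr => t _; rewrite mulr_sumr.
apply: ler_pM => //; first exact: B_bd.
apply: le_trans (ler_norm_sum _ _ _) _; apply: ler_sum => t _.
apply: le_trans (ler_norm_sum _ _ _) _; apply: ler_sum => l _.
rewrite normrM norm_conjC; apply: ler_wpM2l => //.
rewrite /trunc; case: ifP => _; first by rewrite subrr normr0; exact: M0.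
by rewrite sub0r normrN B_bd.
Qed.

(** Applied only to S = 2^N, which reduces the archimedean argument to [geom_small] with ratio
    1/2. *)
Let arch (x D : C) : 0 <= x -> 0 <= D -> (forall S : nat, S%:R * x <= D) -> x = 0.
Proof.
move=> x0 D0 h; apply: (@small0 _ _ D) => // e e0.
have h2 : 0 <= 2^-1 :> C by rewrite invr_ge0.
have h1 : 2^-1 < 1 :> C by rewrite invf_lt1 // ltr1n.
have [N hN] := geom_small h2 h1 e0.
rewrite ger0_norm //; apply: le_trans (ler_wpM2l D0 hN).
by rewrite exprVn ler_pdivlMr ?exprn_gt0 // mulrC -natrX.
Qed.

Variable M' : C.
Hypothesis ef_bd : forall a t, G (ef a t) (ef a t) <= M'.

(* The functions [x s] below are pairwise orthogonal, bounded, and all have the same product B b t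
   with [ef b t] once s is large; by Bessel's inequality that product is 0. *)
Lemma vanishing (b : nat) t : (t < m)%N -> B b%:Z t = 0.
Proof.
(* Indices n + 1 apart meet the gap required by [UU]; the factor b + s + 1 makes them exceed b from
   s = 0 on, and the final n puts them in the form of [UUn]. *)
move=> tm; pose x s := U ((b + s).+1 * n.+1 + n)%N.
have xt s : tok (x s) by exact: U_tok.
have xB s : G (x s) (ef b%:Z t) = B b%:Z t.
  rewrite U_ef // /trunc ifT //= ltz_nat mulSn mulnS; lia.
have xx s s' : (s' < s)%N -> G (x s) (x s') = 0 by move=> ss; apply: UU; nia.
have x2 s : G (x s) (x s) <= n%:R * K by exact: UUn.
have D0 : 0 <= n%:R * K * M'.
  by apply: mulr_ge0; [apply: le_trans (x2 0%N)|apply: le_trans (ef_bd 0 0)]; exact: G_ge0.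
apply/eqP; rewrite -normr_eq0 -sqrf_eq0; apply/eqP.
apply: (@arch _ (n%:R * K * M')) => [||S]; [exact: exprn_ge0|exact: D0|].
have [->|Sp] := posnP S; first by rewrite mul0r.
(* Bessel's inequality by Cauchy-Schwarz: the sum has product S B with [ef], but squared norm at
   most of order S. *)
pose y z w := \sum_(s < S) x s z w.
have yt : tok y by apply: tok_sum => s _; exact: xt.
have yB : G y (ef b%:Z t) = S%:R * B b%:Z t.
  rewrite /y (G_suml p_nz _ (P := xpredT) (U := fun (s : 'I_S) => x s) (fun s _ => xt s) (ef_tok _ _)).
  by rewrite (eq_bigr (fun=> B b%:Z t)) ?sumr_const ?card_ord ?mulr_natl // => s _; rewrite xB.
have yy : G y y <= S%:R * (n%:R * K).
  rewrite {1}/y (G_suml p_nz _ (P := xpredT) (U := fun (s : 'I_S) => x s) (fun s _ => xt s) yt).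
  have -> : S%:R * (n%:R * K) = \sum_(s < S) (n%:R * K) by rewrite sumr_const card_ord mulr_natl.
  apply: ler_sum => s _; apply: le_trans (x2 s).
  rewrite /y (G_sumr p_nz _ (P := xpredT) (U := fun (s : 'I_S) => x s) (fun s _ => xt s) (xt s)).
  rewrite (bigD1 s) //= big1 ?addr0 // => s' ss'.
  have [h|h|h] := ltngtP s s'; last by case/eqP: ss'; exact/val_inj.
    by rewrite (G_conj p_nz (xt s') (xt s)) xx ?rmorph0.
  by rewrite xx.
have S0 : 0 < S%:R :> C by rewrite ltr0n.
rewrite -(ler_pM2l S0); have := G_CS p_nz yt (ef_tok b%:Z t); rewrite yB normrM exprMn normr_nat.
rewrite [X in _ -> X <= _]mulrA -expr2 => /le_trans; apply.
rewrite [leRHS]mulrA; apply: le_trans (ler_pM (G_ge0 p _) (G_ge0 p _) yy (ef_bd _ _)) _.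
by rewrite mulrA.
Qed.

End Vanishing.

(** * The inverse of the fibrewise Toeplitz matrix as a Laurent polynomial in z *)

Section LaurentKernel.
Variables (R : realType) (n m : nat).
Local Notation C := R[i].
Local Notation H := (bipoly R n m).
Implicit Types (g : C -> C) (z w : C).

Definition lpoly g := exists c : nat -> C,
  forall z, `|z| = 1 -> g z = \sum_(l < (n + n).+1) c l * z ^ (l%:Z - n%:Z).

Lemma lpolyD g1 g2 : lpoly g1 -> lpoly g2 -> lpoly (fun z => g1 z + g2 z).
Proof.
move=> [c1 h1] [c2 h2]; exists (fun l => c1 l + c2 l) => z z1.
by rewrite h1 // h2 // -big_split; apply: eq_bigr => l _; rewrite mulrDl.
Qed.
Lemma lpolyZ a g : lpoly g -> lpoly (fun z => a * g z).
Proof.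
move=> [c1 h1]; exists (fun l => a * c1 l) => z z1.
by rewrite h1 // mulr_sumr; apply: eq_bigr => l _; rewrite mulrA.
Qed.
Lemma lpoly_ext g1 g2 : (forall z, `|z| = 1 -> g1 z = g2 z) -> lpoly g1 -> lpoly g2.
Proof. by move=> E [c h]; exists c => z z1; rewrite -E // h. Qed.
Lemma lpolyB g1 g2 : lpoly g1 -> lpoly g2 -> lpoly (fun z => g1 z - g2 z).
Proof.
move=> h1 h2; apply: lpoly_ext (lpolyD h1 (lpolyZ (-1) h2)) => z _.
by rewrite mulN1r.
Qed.
Lemma lpoly0 : lpoly (fun=> 0).
Proof. by exists (fun=> 0) => z _; rewrite big1 // => l _; rewrite mul0r. Qed.
Lemma lpoly_sum (J : Type) (r : seq J) (F : J -> C -> C) :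
  (forall j, lpoly (F j)) -> lpoly (fun z => \sum_(j <- r) F j z).
Proof.
move=> h; elim: r => [|j r IH].
  by apply: lpoly_ext lpoly0 => z _; rewrite big_nil.
by apply: lpoly_ext (lpolyD (h j) IH) => z _; rewrite big_cons.
Qed.
Lemma lpoly_conj g : lpoly g -> lpoly (fun z => (g z)^*).
Proof.
move=> [c h]; exists (fun l => (c (n + n - l)%N)^*) => z z1.
rewrite h // rmorph_sum (reindex_inj rev_ord_inj) /=; apply: eq_bigr => l _.
rewrite (rmorphM Num.conj) /= (circ_conjX _ z1) subSS; congr (_ * _ ^ _).
by have := ltn_ord l; lia.
Qed.
Lemma lpolyX (k : int) : - n%:Z <= k -> k <= n%:Z -> lpoly (fun z => z ^ k).
Proof.
move=> nk kn; exists (fun l => (l%:Z - n%:Z == k)%:R) => z z1.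
have [l lE] : exists l : nat, k = l%:Z - n%:Z.
  by exists (absz (k + n%:Z)); lia.
have ln : (l < (n + n).+1)%N by lia.
rewrite (bigD1 (Ordinal ln)) //= -lE eqxx mul1r big1 ?addr0 // => j jl.
rewrite lE (_ : (_ == _) = false) ?mul0r //; apply/negbTE; apply: contra jl => /eqP E.
by apply/eqP/val_inj => /=; lia.
Qed.
Lemma lpoly_qq t s (f g : H) : lpoly (fun z => ev z t f * (ev z s g)^*).
Proof.
apply: (@lpoly_ext (fun z => \sum_(i < n.+1) \sum_(j < n.+1) (cf f i t * (cf g j s)^*) * z ^ (i%:Z - j%:Z))).
  move=> z z1; have z0 := circ_neq0 z1; rewrite !evE mulr_suml; apply: eq_bigr => i _.
  rewrite rmorph_sum mulr_sumr; apply: eq_bigr => j _.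
  by rewrite (rmorphM Num.conj) /= exprnP exprnP (circ_conjX _ z1) expfzDr // mulrACA.
apply: lpoly_sum => i; apply: lpoly_sum => j; apply: lpolyZ; apply: lpolyX;
by have := ltn_ord i; have := ltn_ord j; lia.
Qed.

Variable p : H.
Definition Kp z i t := kap m (fun t => ev z t p) (cdX m (fun t => ev z t p)) i t.

(** The recursion multiplies no two of its own values, so the degree stays that of a single product
    of a coefficient with a conjugate. *)
Lemma lpoly_Kp i t : lpoly (fun z => Kp z i t).
Proof.
have qq' a b : lpoly (fun z => (ev z a p)^* * ev z b p).
  by apply: lpoly_ext (lpoly_qq b a p p) => z _; rewrite mulrC.
apply: lpolyB; last exact: qq'.
elim: i t => [|i IH] [|t] /=; try exact: lpoly_qq.
by apply: lpolyB; [apply: lpolyD; [exact: IH|exact: lpoly_qq]|exact: qq'].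
Qed.

Lemma lpoly_cok g : lpoly g -> cok g.
Proof.
move=> [c h]; apply: (@cok_ext _ (fun z => \sum_(l < (n + n).+1) c l * z ^ (l%:Z - n%:Z))).
  by move=> z z1; rewrite h.
by apply: cok_sum => l _; apply: cokM; [exact: cok_cst|exact: cokXz].
Qed.

Hypothesis p_nz : forall z w : C, `|z| = 1 -> `|w| <= 1 -> eval2 p z w != 0.

Definition kfun (j : int) i z w := z ^ j * \sum_(t < m) (Kp z i t)^* * w ^+ t.

Lemma tok_kfun j i : tok (kfun j i).
Proof.
apply: tokM; first exact: tok_zXz.
apply: tok_sum => t _; apply: tokM; last exact: tok_wX.
by apply: cok_tokz; apply: cok_conj; apply: lpoly_cok; exact: lpoly_Kp.
Qed.

Lemma kfun_dual k b i l : (i < m)%N -> (l < m)%N ->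
  G p (kfun k i) (fun z w => z ^ b * w ^+ l) = ((k == b) && (i == l))%:R.
Proof.
move=> im lm; rewrite (@G_fiber _ _ _ p p_nz _ _ (fun z => (i == l)%:R * z ^ (k - b))).
- rewrite (cmeanZ _ (cokXz _ (k - b))) cmeanXz subr_eq0 andbC.
  by case: (i == l); rewrite ?mul1r ?mul0r.
- exact: tok_kfun.
- by apply: tokM; [exact: tok_zXz|exact: tok_wX].
- by apply: cokM; [exact: cok_cst|exact: cokXz].
move=> z z1; have z0 := circ_neq0 z1.
transitivity (cmean (fun w => (\sum_(t < m) (z ^ k * (Kp z i t)^*) * w ^ (t%:Z + 0)) *
     (\sum_(j < 1) (z ^ b) * w ^ (j%:Z + l%:Z))^* * dens p z w)).
  apply: eq_cmean => w w1; congr (_ * _ * _).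
    rewrite /kfun mulr_sumr; apply: eq_bigr => t _.
    by rewrite addr0 mulrA.
  by rewrite big_ord1 add0r.
rewrite (fiber_sum p_nz m 1 (fun t => z ^ k * (Kp z i t)^*) (fun=> z ^ b) 0 l%:Z z1).
transitivity (z ^ (k - b) * (\sum_(t < m) Kp z i t * mu p z (l%:Z - t%:Z))^*).
  rewrite rmorph_sum mulr_sumr; apply: eq_bigr => t _; rewrite big_ord1 addr0 add0r.
  rewrite (rmorphM Num.conj) /= -(mu_conj p_nz _ z1) opprB (circ_conjX _ z1) expfzDr //.
  by ring.
rewrite (kap_inv (fun j : int => mu_conj p_nz j z1) (q0_neq0 p_nz z1)
  (fun j => mu_q_fiber p_nz j z1) (cdX_kernel _ _)) //.
by rewrite conjC_nat mulrC.
Qed.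

(** Writing f = (f(z, 0) / p(z, 0)) p + w g on the fibre, the right side is the Fourier coefficient
    of index j of the coefficient of w^i in g. The products of p with w times the kernel vanish, up
    to the term of index -1 given by [kap_inv0]. *)
Lemma kfun_dot (f : H) j i : (i < m)%N ->
  G p (eval2 f) (fun z w => w * kfun j i z w) =
  cmean (fun z => z ^ (- j) * (ev z i.+1 f - ev z 0 f / ev z 0 p * ev z i.+1 p)).
Proof.
move=> im; apply: (G_fiber p_nz).
- exact: tok_eval2.
- by apply: tokM; [exact: (tok_wX R 1)|exact: tok_kfun].
- apply: cokM; first exact: cokXz.
  apply: cokB; first exact: cok_ev.
  apply: cokM; last exact: cok_ev.
  apply: cokM; first exact: cok_ev.
  by apply: cok_polyV => z z1; exact: (q0_neq0 p_nz z1).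
move=> z z1; have z0 := circ_neq0 z1.
transitivity (cmean (fun w => (\sum_(s < m.+1) ev z s f * w ^ (s%:Z + 0)) *
     (\sum_(t < m) (z ^ j * (Kp z i t)^*) * w ^ (t%:Z + 1))^* * dens p z w)).
  apply: eq_cmean => w w1; have w0 := circ_neq0 w1; congr (_ * _^* * _).
    by rewrite eval2E; apply: eq_bigr => s _; rewrite addr0.
  rewrite /kfun mulrCA !mulr_sumr; apply: eq_bigr => t _.
  by rewrite expfzDr // expr1z -exprnP; ring.
rewrite (fiber_sum p_nz m.+1 m (fun s => ev z s f) (fun t => z ^ j * (Kp z i t)^*) 0 1 z1).
transitivity (z ^ (- j) * \sum_(s < m.+1) ev z s f * \sum_(t < m) Kp z i t * mu p z (s%:Z - 1 - t%:Z)).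
  rewrite mulr_sumr; apply: eq_bigr => s _; rewrite !mulr_sumr; apply: eq_bigr => t _.
  rewrite (rmorphM Num.conj) /= conjCK (circ_conjX _ z1) addr0.
  have -> : s%:Z - (t%:Z + 1) = s%:Z - 1 - t%:Z by lia.
  by ring.
congr (_ * _); rewrite big_ord_recl /=.
have -> : \sum_(t < m) Kp z i t * mu p z (0%:Z - 1 - t%:Z) = - (ev z i.+1 p / ev z 0 p).
  rewrite sub0r; exact: (kap_inv0 (fun j : int => mu_conj p_nz j z1) (q0_neq0 p_nz z1)
    (fun j => mu_q_fiber p_nz j z1) (cdX_kernel _ _)).
have -> : \sum_(s < m) ev z (bump 0 s) f * (\sum_(t < m) Kp z i t * mu p z ((bump 0 s)%:Z - 1 - t%:Z)) = ev z i.+1 f.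
  transitivity (\sum_(s < m) ev z s.+1 f * (i == s)%:R).
    apply: eq_bigr => s _; rewrite /bump add1n; congr (_ * _).
    have -> : s.+1%:Z - 1 = s%:Z by lia.
    exact: (kap_inv (fun j : int => mu_conj p_nz j z1) (q0_neq0 p_nz z1)
      (fun j => mu_q_fiber p_nz j z1) (cdX_kernel _ _)).
  by rewrite (sum_ord_delta m (fun s => ev z s.+1 f)) im.
by ring.
Qed.

End LaurentKernel.

(** * Vanishing of the moments outside the window *)

Section VanishingCoefficients.
Variables (R : realType) (n m : nat).
Local Notation C := R[i].
Local Notation H := (bipoly R n m).
Variable p : H.
Hypothesis p_nz : forall z w : C, `|z| = 1 -> `|w| <= 1 -> eval2 p z w != 0.
Implicit Types (f : H) (z w : C).

(* Treats the Fourier indices < 0 and those >= n, both numbered from 0, in the same way. *)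
Definition outer_idx (b : bool) (a : int) : int := if b then n%:Z + a else - a - 1.
Definition outer_step (b : bool) (a : int) : int := if b then a else - a.

Lemma outer_idx_step b k l : outer_idx b (k + l%:Z - n%:Z) = outer_idx b k + outer_step b (l%:Z - n%:Z).
Proof. by case: b; rewrite /outer_idx /outer_step; lia. Qed.
Lemma outer_idx_inj b a a' : (outer_idx b a == outer_idx b a') = (a == a').
Proof. by apply/eqP/eqP; case: b; rewrite /outer_idx; lia. Qed.

Lemma kern_coef b : exists c : nat -> nat -> nat -> C, forall i t z, `|z| = 1 ->
  (Kp p z i t)^* = \sum_(l < (n + n).+1) c i t l * z ^ outer_step b (l%:Z - n%:Z).
Proof.
case: b.
  have /choice[c hc] (x : nat * nat) := lpoly_conj (lpoly_Kp p x.1 x.2).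
  by exists (fun i t => c (i, t)) => i t z z1; rewrite (hc (i, t)).
have /choice[c hc] (x : nat * nat) := lpoly_Kp p x.1 x.2.
exists (fun i t l => (c (i, t) l)^*) => i t z z1; rewrite (hc (i, t) z z1) rmorph_sum.
by apply: eq_bigr => l _; rewrite (rmorphM Num.conj) /= (circ_conjX _ z1).
Qed.

Definition coefA f (j : int) t := G p (eval2 f) (fun z w => w * (z ^ j * w ^+ t)).

Let tok_mon (j : int) t : tok (fun z w : C => z ^ j * w ^+ t).
Proof. by apply: tokM; [exact: tok_zXz|exact: tok_wX]. Qed.
Let tok_wmon (j : int) t : tok (fun z w : C => w * (z ^ j * w ^+ t)).
Proof. by apply: tokM; [exact: (tok_wX R 1)|exact: tok_mon]. Qed.

Let norm_mon z w (j : int) t : `|z| = 1 -> `|w| = 1 -> (z ^ j * w ^+ t) * (z ^ j * w ^+ t)^* = 1.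
Proof.
move=> z1 w1; have z0 := circ_neq0 z1.
rewrite (rmorphM Num.conj) /= (circ_conjX _ z1) mulrACA -expfzDr // subrr expr0z mul1r.
by rewrite -normCK normrX w1 !expr1n.
Qed.

(** In the numbering of [outer_idx], the indices -n, ..., -1 are exactly 0, ..., n - 1 in z, on
    which the form of T gives the moments; the degree n of the kernel is just short enough for this
    window to start the argument. *)
Lemma coefA_vanish b f :
  (forall s t, (s < n)%N -> (t < m)%N -> coefA f s%:Z t = 0) ->
  (forall (k : nat) i, (i < m)%N -> cmean (fun z => z ^ (- outer_idx b k%:Z) *
     (ev z i.+1 f - ev z 0 f / ev z 0 p * ev z i.+1 p)) = 0) ->
  forall (k : nat) t, (t < m)%N -> coefA f (outer_idx b k%:Z) t = 0.
Proof.
move=> f0 fk; have [c hc] := kern_coef b.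
pose ef (a : int) t z w : C := z ^ outer_idx b a * w ^+ t.
have kfE k i z w : `|z| = 1 -> kf n m ef c k i z w = kfun p (outer_idx b k) i z w.
  move=> z1; have z0 := circ_neq0 z1; rewrite /kf /kfun mulr_sumr; apply: eq_bigr => t _.
  rewrite hc // mulr_suml mulr_sumr; apply: eq_bigr => l _.
  by rewrite /ef outer_idx_step expfzDr //; ring.
pose one (z w : C) : C := 1.
have ef_sq a t : G p (ef a t) (ef a t) = G p one one.
  by apply: eq_tmean => z w z1 w1; rewrite norm_mon // rmorph1 mulr1.
have wef_sq (j : int) t : G p (fun z w => w * (z ^ j * w ^+ t)) (fun z w => w * (z ^ j * w ^+ t)) = G p one one.
  apply: eq_tmean => z w z1 w1.
  by rewrite (rmorphM Num.conj) mulrACA norm_mon // /= -normCK w1 expr1n mulr1 rmorph1 mulr1.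
pose D := G p (eval2 f) (eval2 f) * G p one one.
have D0 : 0 <= D by rewrite mulr_ge0 ?G_ge0.
apply: (@vanishing _ n m p p_nz ef c (fun a t => coefA f (outer_idx b a) t) _ _ _ _ (D + 1) _ (G p one one)).
- by move=> a t; exact: tok_mon.
- move=> k a i l im lm; rewrite -(outer_idx_inj b) -(kfun_dual p_nz (outer_idx b k) (outer_idx b a) im lm).
  by apply: eq_tmean => z w z1 w1; rewrite kfE.
- move=> k i im; rewrite -[RHS](fk k i im) -(kfun_dot p_nz f (outer_idx b k%:Z) im).
  transitivity (G p (eval2 f) (fun z w => \sum_(t < m) \sum_(l < (n + n).+1)
      c i t l * (w * ef (k%:Z + l%:Z - n%:Z) t z w))); last first.
    apply: eq_tmean => z w z1 w1; congr (_ * _^* * _); rewrite -kfE // /kf mulr_sumr.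
    by apply: eq_bigr => t _; rewrite mulr_sumr; apply: eq_bigr => l _; rewrite mulrCA.
  have t1 (t : nat) (l : nat) : tok (fun z w => c i t l * (w * ef (k%:Z + l%:Z - n%:Z) t z w)).
    by apply: tokM; [exact: tok_cst|exact: tok_wmon].
  have t2 (t : nat) : tok (fun z w => \sum_(l < (n + n).+1) c i t l * (w * ef (k%:Z + l%:Z - n%:Z) t z w)).
    by apply: tok_sum => l _; exact: t1.
  have tf : tok (eval2 f) by exact: tok_eval2.
  rewrite (G_sumr p_nz _ (P := xpredT) (U := fun (t : 'I_m) z w => \sum_(l < (n + n).+1) c i t l *
     (w * ef (k%:Z + l%:Z - n%:Z) t z w)) (fun t _ => t2 t) tf).
  apply: eq_bigr => t _.
  rewrite (G_sumr p_nz _ (P := xpredT) (U := fun (l : 'I_(n + n).+1) z w => c i t l *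
     (w * ef (k%:Z + l%:Z - n%:Z) t z w)) (fun l _ => t1 t l) tf).
  by apply: eq_bigr => l _; rewrite (GZr p_nz _ tf (tok_wmon _ _)).
- move=> a t tm na a0; have [s sE sn] : exists2 s : nat, outer_idx b a = s%:Z & (s < n)%N.
    by exists (absz (outer_idx b a)); case: (b) na a0; rewrite /outer_idx; lia.
  by rewrite sE f0.
(* Cauchy-Schwarz bounds the square of a moment by D, and D <= (D + 1)^2 avoids a root. *)
- move=> a t tm; have D1 : 0 <= D + 1 by rewrite addr_ge0.
  rewrite -(ler_sqr _ D1) ?nnegrE //; apply: le_trans (G_CS p_nz (tok_eval2 _) (tok_wmon _ _)) _.
  rewrite wef_sq -/D; have D2 : 0 <= D ^+ 2 + D + 1 by rewrite !addr_ge0 // exprn_ge0.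
  by rewrite -subr_ge0; apply: le_trans D2 _; rewrite le_eqVlt; apply/orP; left; apply/eqP; ring.
- by move=> a t; rewrite ef_sq.
Qed.

End VanishingCoefficients.

(** * From equal moments to equal inner products *)

Section BSForm.
Variables (R : realType) (n m : nat) (T : {scalar laurent R n m}).
Hypothesis T_gt0 : positive_form T.
Local Notation C := R[i].
Local Notation H := (bipoly R n m).
Local Notation form := (dotT T_gt0).
Variable p : H.
Hypothesis p_nz : forall z w : C, `|z| = 1 -> `|w| <= 1 -> eval2 p z w != 0.
Hypothesis moments : forall j k : int, `|j| <= n%:Z -> `|k| <= m%:Z ->
  T (lmon R n m j k) =
  torus_int (fun z w => z ^ j * w ^ k / (((2 * pi)%:C)%C ^+ 2 * `|eval2 p z w| ^+ 2)).

Lemma lin_mon_ext (phi psi : H -> C) :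
  (forall a x y, phi (a *: x + y) = a * phi x + phi y) ->
  (forall a x y, psi (a *: x + y) = a * psi x + psi y) ->
  (forall s t, (s <= n)%N -> (t <= m)%N -> phi (mon R n m s t) = psi (mon R n m s t)) ->
  forall f, phi f = psi f.
Proof.
move=> h1 h2 h f.
have z1 : phi 0 = 0.
  by have := h1 (-1) 0 0; rewrite scaler0 addr0 mulN1r addNr.
have z2 : psi 0 = 0.
  by have := h2 (-1) 0 0; rewrite scaler0 addr0 mulN1r addNr.
rewrite (mon_expand f).
have key : forall s t : nat, (s <= n)%N -> (t <= m)%N ->
  forall a x, phi x = psi x -> phi (a *: mon R n m s t + x) = psi (a *: mon R n m s t + x).
  by move=> s t sn tm a x e; rewrite h1 h2 h // e.
have row (s : 'I_n.+1) (r : seq 'I_m.+1) x : phi x = psi x ->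
    phi (\sum_(t <- r) f s t *: mon R n m s t + x) = psi (\sum_(t <- r) f s t *: mon R n m s t + x).
  move=> e; elim: r => [|t r IH]; first by rewrite big_nil add0r.
  rewrite big_cons -addrA; apply: key; first by rewrite -ltnS.
    by rewrite -ltnS.
  exact: IH.
elim: (index_enum _) => [|s r IH]; first by rewrite big_nil z1 z2.
by rewrite big_cons; apply: row.
Qed.

Lemma form_G f g : form f g = G p (eval2 f) (eval2 g).
Proof.
have te h : tok (eval2 (h : H)) by exact: tok_eval2.
have Gl a (x y h : H) : G p (eval2 (a *: x + y)) (eval2 h) = a * G p (eval2 x) (eval2 h) + G p (eval2 y) (eval2 h).
  have ta : tok (fun z w => a * eval2 x z w) by apply: tokM; [exact: tok_cst|exact: te].
  rewrite -(GZl p_nz a (te x) (te h)) -(GDl p_nz ta (te y) (te h)).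
  by apply: eq_tmean => z w _ _; rewrite eval2_lin.
move: f; apply: lin_mon_ext => [a x y|a x y|s t sn tm].
- by rewrite dotDl dotZl.
- exact: Gl.
rewrite dotC (G_conj p_nz (te g) (te _)); congr (_^*).
move: g; apply: lin_mon_ext => [a x y|a x y|s' t' sn' tm'].
- by rewrite dotDl dotZl.
- exact: Gl.
rewrite -form_lmon // -G_mon // moments; first by rewrite torus_moment.
  by move: sn sn'; lia.
by move: tm tm'; lia.
Qed.

End BSForm.

(** * Conjugates of polynomials on the circle *)

Section ReversedPolynomials.
Variable R : realType.
Local Notation C := R[i].
Implicit Types (a h : {poly C}) (z : C).

Lemma rev_poly_ex N a : (size a <= N)%N ->
  exists b : {poly C}, forall z, `|z| = 1 -> z ^+ N * (a.[z])^* = z * b.[z].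
Proof.
move=> aN; exists (\poly_(i < N) (a`_(N.-1 - i))^*) => z z1.
have z0 := circ_neq0 z1.
rewrite (horner_coef_wide _ aN) horner_poly rmorph_sum (reindex_inj rev_ord_inj) /= !mulr_sumr.
apply: eq_bigr => i _; have iN := ltn_ord i.
have -> : (N.-1 - i = N - i.+1)%N by lia.
rewrite (rmorphM Num.conj) (rmorphXn Num.conj) /= (circ_conj z1) exprVn mulrCA [RHS]mulrCA.
congr (_ * _); rewrite -{1}(@subnKC (N - i.+1) N) ?leq_subr // exprD mulrAC divff ?expf_neq0 // mul1r.
by rewrite -exprS; congr (_ ^+ _); lia.
Qed.

Definition roots_poly (s : seq C) : {poly C} := \prod_(r <- s) ('X - r%:P).
(** The reversed polynomial of [roots_poly s]: its zeros are the reflections 1 / conj(r), outside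
    the closed disk when |r| < 1. *)
Definition rev_roots_poly (s : seq C) : {poly C} := \prod_(r <- s) (1 - (r^*)%:P * 'X).

Lemma roots_poly_rev s z : `|z| = 1 -> z ^+ size s * ((roots_poly s).[z])^* = (rev_roots_poly s).[z].
Proof.
move=> z1; rewrite /roots_poly /rev_roots_poly; elim: s => [|r s IH].
  by rewrite !big_nil !hornerC expr0 rmorph1 mul1r.
have zz : z * z^* = 1 by rewrite -normCK z1 expr1n.
rewrite !big_cons !hornerM -IH /= exprS (rmorphM Num.conj) /= hornerXsubC (rmorphB Num.conj) /=.
have -> : (1 - (r^*)%:P * 'X).[z] = z * z^* - r^* * z.
  by rewrite zz hornerD hornerN hornerM hornerX !hornerC.
by ring.
Qed.

Lemma rev_roots_poly_neq0 s z : (forall r, r \in s -> `|r| < 1) -> `|z| <= 1 -> (rev_roots_poly s).[z] != 0.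
Proof.
move=> s1 z1; rewrite /rev_roots_poly horner_prod prodf_seq_neq0; apply/allP => r rs /=.
rewrite hornerD hornerN hornerM hornerX !hornerC subr_eq0; apply/eqP => E.
have : `|r^* * z| < 1 by rewrite normrM norm_conjC; apply: le_lt_trans (s1 r rs); rewrite ler_piMr.
by rewrite -E normr1 ltxx.
Qed.

Lemma roots_poly_neq0 s z : (forall r, r \in s -> `|r| < 1) -> `|z| = 1 -> (roots_poly s).[z] != 0.
Proof.
move=> s1 z1; rewrite /roots_poly horner_prod prodf_seq_neq0; apply/allP => r rs /=.
rewrite !hornerE subr_eq0; apply/eqP => E.
by have := s1 r rs; rewrite -E z1 ltxx.
Qed.

Lemma size_roots_poly s : size (roots_poly s) = (size s).+1.
Proof. exact: size_prod_XsubC. Qed.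

(* On the circle, the conjugate of h / roots_poly s extends to the disk and vanishes at 0. *)
Lemma conj_quot_roots s h : (forall r, r \in s -> `|r| < 1) -> (size h <= size s)%N ->
  exists b : {poly C}, forall z, `|z| = 1 -> (h.[z] / (roots_poly s).[z])^* = z * (b.[z] / (rev_roots_poly s).[z]).
Proof.
move=> s1 hs; have [b hb] := rev_poly_ex hs; exists b => z z1.
have z0 := circ_neq0 z1; have zs : z ^+ size s != 0 by rewrite expf_neq0.
rewrite (rmorphM Num.conj) (fmorphV Num.conj) /= mulrA -hb // -(roots_poly_rev s z1).
have q0 : ((roots_poly s).[z])^* != 0 by rewrite fmorph_eq0 roots_poly_neq0.
by field; rewrite q0 zs.
Qed.
End ReversedPolynomials.

(** * Orthogonality relations from the factorization of p(z, 0) *)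

Section SplitOfBS.
Variables (R : realType) (n m : nat) (T : {scalar laurent R n m}).
Hypothesis T_gt0 : positive_form T.
Local Notation C := R[i].
Local Notation H := (bipoly R n m).
Local Notation Mz := (Mz R n m).
Local Notation form := (dotT T_gt0).
Local Notation D := (domT T_gt0).
Local Notation EN := (E1 T_gt0 n%:Z m%:Z).
Local Notation Pn := (Psp R n m (n%:Z - 1) m%:Z).
Implicit Types (f g : H) (h a : {poly C}) (z w : C).
Variable p : H.
Hypothesis p_nz : forall z w : C, `|z| = 1 -> `|w| <= 1 -> eval2 p z w != 0.
Hypothesis form_G : forall f g, form f g = G p (eval2 f) (eval2 g).
Local Notation coefA := (coefA p).

Let te f : tok (eval2 f). Proof. exact: tok_eval2. Qed.

Let coefA_form f s t : (s <= n)%N -> (t < m)%N ->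
  coefA f s%:Z t = form f (mon R n m s t.+1).
Proof.
move=> sn tm; rewrite form_G; apply: eq_tmean => z w z1 w1; congr (_ * _^* * _).
by rewrite eval2_mon // exprS mulrCA.
Qed.

Let orth_mon f : (forall s t, (s <= n)%N -> (t < m)%N -> form f (mon R n m s t.+1) = 0) ->
  forall g, (forall s, cf g s 0 = 0) -> form f g = 0.
Proof.
move=> h g g0; rewrite (mon_expand g) dot_sumr big1 // => s _; rewrite dot_sumr big1 // => t _.
rewrite dotZr; case: t => -[|t] tm.
  by rewrite -cf_ord g0 rmorph0 mul0r.
by rewrite h ?mulr0 // -ltnS.
Qed.

Let coefA_D f s t : f \in D -> (s < n)%N -> (t < m)%N -> coefA f s%:Z t = 0.
Proof.
move=> /memD[_ fo] sn tm; rewrite coefA_form ?(ltnW sn) //; apply: fo.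
  by move=> i; rewrite cf_mon /= andbF.
move=> i j ni; rewrite cf_mon; case: eqP => [E|//]; move: ni; rewrite E leqNgt sn.
by [].
Qed.

Let D_inQ f : f \in D -> inQ n f. Proof. by move=> /memD[]. Qed.
Let D_Pn f : f \in D -> f \in Pn. Proof. by move=> /D_inQ h; apply/PQ. Qed.

Variables (s1 : seq C) (pout : {poly C}).
Hypothesis p0E : pcol p 0 = roots_poly s1 * pout.
Hypothesis s1_lt : forall r, r \in s1 -> `|r| < 1.
Hypothesis pout_nz : forall z, `|z| <= 1 -> pout.[z] != 0.

Let pin_nz z : `|z| = 1 -> (roots_poly s1).[z] != 0. Proof. exact: roots_poly_neq0. Qed.
Let pout_nz1 z : `|z| = 1 -> pout.[z] != 0. Proof. by move=> z1; rewrite pout_nz // z1. Qed.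

Let ev_p0 z : ev z 0 p = (roots_poly s1).[z] * pout.[z].
Proof. by rewrite /ev p0E hornerM. Qed.

(** Here f(z, 0) / p(z, 0) = h / p_out is analytic on the disk, so g has no Fourier coefficient of
    negative index. Of the resulting moments only the one at -1 is used: it is the product of z f
    with a pure power of w. *)
Lemma K2_shift f h : f \in D -> pcol f 0 = roots_poly s1 * h -> Mz f \in EN.
Proof.
move=> fD fE; have neg t : (t < m)%N -> coefA f (-1) t = 0.
  move=> tm; apply: (@coefA_vanish _ n m p p_nz false f _ _ 0%N t tm) => [i j|k i im].
    exact: coefA_D.
  transitivity (cmean (fun z => z ^+ k.+1 * ((pcol f i.+1 * pout - h * pcol p i.+1).[z] / pout.[z]))).
    apply: eq_cmean => z z1; congr (_ * _).
      by have -> : - (- k%:Z - 1) = k.+1%:Z by lia.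
    rewrite ev_p0 /ev fE !hornerE /=; field.
    by rewrite pout_nz1 // pin_nz.
  by rewrite cmean_quot ?mul0r.
apply/memE1n; apply: orth_mon => -[|s] t sn tm; last first.
  have -> : mon R n m s.+1 t.+1 = Mz (mon R n m s t.+1).
    apply: cf_inj => -[|i] j; rewrite ?cf_Mz0 ?cf_MzS !cf_mon //.
    rewrite eqSS; case: (leqP i.+1 n) => [h'|h'] /=; first by rewrite (ltnW h').
    by rewrite !andbF.
  have hQ : inQ n (mon R n m s t.+1).
    move=> i j ni; rewrite cf_mon; case: eqP => [E|//]; move: ni; rewrite E leqNgt sn.
    by [].
  by rewrite (shift_z T_gt0 (D_inQ fD) hQ) -coefA_form ?(ltnW sn) // coefA_D.
rewrite -[RHS](neg t tm) form_G; apply: eq_tmean => z w z1 w1; have z0 := circ_neq0 z1.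
rewrite eval2_Mz ?D_Pn // eval2_mon // expr0 mul1r; congr (_ * _).
rewrite mulrCA (rmorphM Num.conj _ (w * _)) /= -exprS exprN1 -(circ_conj z1) conjCK.
by ring.
Qed.

Section FirstSpace.
Variables (f : H) (h : {poly C}).
Hypotheses (fD : f \in D) (fE : pcol f 0 = pout * h) (hs : (size h <= size s1)%N).

(** Here f(z, 0) / p(z, 0) = h / p_in, and after conjugation and multiplication by z^n the function
    g becomes z times an analytic function, so its coefficients of index at least n vanish. *)
Lemma K1_coef k t : (t < m)%N -> coefA f k%:Z t = 0.
Proof.
move=> tm; have [kn|kn] := ltnP k n; first exact: coefA_D.
rewrite -(subnKC kn) PoszD; move: {kn k}(k - n)%N => k.
apply: (@coefA_vanish _ n m p p_nz true f) => // [i j|{}k i im]; first exact: coefA_D.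
have [b1 hb1] := rev_poly_ex (size_pcol i.+1 (D_inQ fD)).
have sp : (size (pcol p i.+1) <= n.+1)%N by rewrite size_poly.
(* The columns of p have degree up to n, one more than those of f, so z^n times the conjugate yields
   no factor z; [conj_quot_roots] supplies it, by the bound on the degree of h. *)
have [b2 hb2] := rev_poly_ex sp.
have [b3 hb3] := conj_quot_roots s1_lt hs.
rewrite -[LHS]conjCK -cmean_conj; last first.
  apply: cokM; first exact: cokXz.
  apply: cokB; first exact: cok_ev.
  apply: cokM; last exact: cok_ev.
  apply: cokM; first exact: cok_ev.
  by apply: cok_polyV => z z1; exact: (q0_neq0 p_nz z1).
transitivity ((cmean (fun z => z ^+ k.+1 * ((b1 * rev_roots_poly s1 - b3 * b2).[z] / (rev_roots_poly s1).[z])))^*); last first.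
  by rewrite cmean_quot ?mul0r ?rmorph0 // => z; exact: rev_roots_poly_neq0.
congr (_^*); apply: eq_cmean => z z1; have z0 := circ_neq0 z1.
have -> : ev z 0 f / ev z 0 p = h.[z] / (roots_poly s1).[z].
  rewrite ev_p0 /ev fE hornerM; field.
  by rewrite pout_nz1 // pin_nz.
rewrite (rmorphM Num.conj) (rmorphB Num.conj) (rmorphM Num.conj (h.[z] / _)) /= hb3 //.
rewrite (circ_conjX _ z1) opprK /outer_idx expfzDr // -!exprnP.
have e1 : z ^+ n * (ev z i.+1 f)^* = z * b1.[z] := hb1 z z1.
have e2 : z ^+ n * (ev z i.+1 p)^* = b2.[z].
  by apply: (mulfI z0); rewrite mulrA -exprS; exact: hb2.
have -> : z ^+ n * z ^+ k * ((ev z i.+1 f)^* - z * (b3.[z] / (rev_roots_poly s1).[z]) * (ev z i.+1 p)^*) =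
   z ^+ k * (z ^+ n * (ev z i.+1 f)^* - z * (b3.[z] / (rev_roots_poly s1).[z]) * (z ^+ n * (ev z i.+1 p)^*)).
  by ring.
rewrite e1 e2 !hornerE /= exprS; field.
by rewrite rev_roots_poly_neq0 // z1.
Qed.

Lemma K1_E : f \in EN.
Proof.
by apply/memE1n; apply: orth_mon => s t sn tm; rewrite -coefA_form // K1_coef.
Qed.

Let polyA a t : (t < m)%N -> G p (eval2 f) (fun z w => a.[z] * w ^+ t.+1) = 0.
Proof.
move=> tm; transitivity (G p (eval2 f) (fun z w => \sum_(s < size a) a`_s * (w * (z ^ s%:Z * w ^+ t)))).
  apply: eq_tmean => z w z1 w1; congr (_ * _^* * _); rewrite horner_coef mulr_suml.
  by apply: eq_bigr => s _; rewrite -exprnP exprS; ring.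
have tm1 (s : nat) : tok (fun z w : C => w * (z ^ s%:Z * w ^+ t)).
  by apply: tokM; [exact: (tok_wX R 1)|apply: tokM; [exact: tok_zXz|exact: tok_wX]].
have tm2 (s : nat) : tok (fun z w : C => a`_s * (w * (z ^ s%:Z * w ^+ t))).
  by apply: tokM; [exact: tok_cst|exact: tm1].
rewrite (G_sumr p_nz _ (P := xpredT) (U := fun (s : 'I_(size a)) z w => a`_s *
     (w * (z ^ s%:Z * w ^+ t))) (fun s _ => tm2 s) (te f)).
rewrite big1 // => s _; rewrite (GZr p_nz _ (te f) (tm1 s)).
by rewrite -/(coefA f s%:Z t) K1_coef // mulr0.
Qed.

Let tok_poly a : tok (fun z _ : C => a.[z]).
Proof. by apply: cok_tokz; exact: cok_poly. Qed.

(** All moments of f with index at least 0 vanish, also beyond n, so f is orthogonal to polynomials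
    of any degree in z times a positive power of w; only the slice w = 0 counts. *)
Let G_slice a g : G p (eval2 f) (fun z w => a.[z] * eval2 g z w) =
  G p (eval2 f) (fun z _ => (a * pcol g 0).[z]).
Proof.
transitivity (G p (eval2 f) (fun z w => \sum_(t < m.+1) (a * pcol g t).[z] * w ^+ t)).
  apply: eq_tmean => z w z1 w1; congr (_ * _^* * _); rewrite eval2E mulr_sumr.
  by apply: eq_bigr => t _; rewrite hornerM /ev mulrA.
have tm1 (t : nat) : tok (fun z w : C => (a * pcol g t).[z] * w ^+ t).
  by apply: tokM; [exact: tok_poly|exact: tok_wX].
rewrite (G_sumr p_nz _ (P := xpredT) (U := fun (t : 'I_m.+1) z w => (a * pcol g t).[z] * w ^+ t)
  (fun t _ => tm1 t) (te f)).
rewrite big_ord_recl big1 ?addr0 => [|t _]; last exact: polyA.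
by apply: eq_tmean => z w z1 w1; rewrite expr0 mulr1.
Qed.

(** Against a p the weight leaves the mean of conj(a) f / p. Averaging over w evaluates f / p at w =
    0, and the conjugate of h / p_in is analytic and vanishes at 0. *)
Let G_p a : G p (eval2 f) (fun z w => a.[z] * eval2 p z w) = 0.
Proof.
have [b3 hb3] := conj_quot_roots s1_lt hs.
have cq : cok (fun z => h.[z] / (roots_poly s1).[z]).
  by apply: cokM; [exact: cok_poly|exact: cok_polyV].
have ca : cok (fun z => (a.[z])^*) by apply: cok_conj; exact: cok_poly.
rewrite (@G_fiber _ _ _ p p_nz _ _ (fun z => (a.[z])^* * (h.[z] / (roots_poly s1).[z]))).
- rewrite -[LHS]conjCK -cmean_conj; last exact: cokM.
  transitivity ((cmean (fun z => z ^+ 1 * ((a * b3).[z] / (rev_roots_poly s1).[z])))^*); last first.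
    by rewrite cmean_quot ?mul0r ?rmorph0 // => z; exact: rev_roots_poly_neq0.
  congr (_^*); apply: eq_cmean => z z1; rewrite (rmorphM Num.conj) /= conjCK hb3 // hornerM.
  by rewrite expr1; ring.
- exact: te.
- by apply: tokM; [exact: tok_poly|exact: te].
- exact: cokM.
move=> z z1; have q0 := q0_neq0 p_nz z1.
have -> : h.[z] / (roots_poly s1).[z] = (wpoly f z).[0] / (wpoly p z).[0].
  rewrite !horner_coef0 !coef_poly /= ev_p0 /ev fE hornerM; field.
  by rewrite pout_nz1 // pin_nz.
transitivity (cmean (fun w => (a.[z])^* * (w ^+ 0 * ((wpoly f z).[w] / (wpoly p z).[w])))).
  apply: eq_cmean => w w1; rewrite !wpolyE densE (rmorphM Num.conj) /=.
  have pz : eval2 p z w != 0 by rewrite p_nz // w1.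
  by field; rewrite pz fmorph_eq0.
rewrite cmeanZ ?cmean_quot ?mul1r // => [w w1|]; first by rewrite wpolyE p_nz.
apply: cokM; first exact: cokX.
apply: cokM; first exact: cok_poly.
by apply: cok_polyV => w w1; rewrite wpolyE p_nz // w1.
Qed.

Let G_sup (v : C -> C -> C) N : 0 <= N -> tok v ->
  (forall z w, `|z| = 1 -> `|w| = 1 -> `|v z w| <= N) ->
  G p v v <= N ^+ 2 * G p (fun _ _ => 1) (fun _ _ => 1).
Proof.
move=> N0 tv vN; have t1 : tok (fun _ _ : C => 1 : C) by exact: tok_cst.
rewrite -subr_ge0 /G -tmeanZ; last exact: tokG.
rewrite -tmeanB; last first.
- exact: tokG.
- by apply: tokM; [exact: tok_cst|exact: tokG].
apply: tmean_ge0 => z w z1 w1.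
have -> : N ^+ 2 * (1 * 1^* * dens p z w) - v z w * (v z w)^* * dens p z w =
  (N ^+ 2 - `|v z w| ^+ 2) * dens p z w by rewrite normCK rmorph1; ring.
by apply: mulr_ge0; rewrite ?dens_ge0 // subr_ge0 lerXn2r ?nnegrE ?vN.
Qed.

(** Only the slice p_in b of g counts. It is the slice of the function (b / p_out) p, which would be
    orthogonal to f by [G_p] if 1 / p_out were a polynomial; uniform approximation bridges this. No
    degree bound on b is imposed, so that z g is covered as well. *)
Lemma K12_orth g b : pcol g 0 = roots_poly s1 * b -> form f g = 0.
Proof.
move=> gE; have -> : form f g = G p (eval2 f) (fun z _ => (roots_poly s1 * b).[z]).
  rewrite form_G -gE -[pcol g 0]mul1r -G_slice.
  by apply: eq_tmean => z w _ _; rewrite hornerC mul1r.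
have [K K0 hK] := poly_bounded (roots_poly s1 * pout * b).
pose E := G p (eval2 f) (eval2 f) * (K ^+ 2 * G p (fun _ _ => 1) (fun _ _ => 1)).
have E0 : 0 <= E.
  by apply: mulr_ge0; [exact: G_ge0|apply: mulr_ge0; [exact/exprn_ge0/ltW|exact: G_ge0]].
apply: (@small0 _ _ (E + 1)); first by rewrite addr_ge0.
move=> e e0; have [a ha] := diskalg_polyV pout_nz e0.
have ta : tok (fun z _ : C => (a * (roots_poly s1 * pout * b)).[z]) by exact: tok_poly.
have tb : tok (fun z _ : C => (roots_poly s1 * b).[z]) by exact: tok_poly.
have Ga : G p (eval2 f) (fun z _ => (a * (roots_poly s1 * pout * b)).[z]) = 0.
  rewrite -(G_p (a * b)) G_slice p0E; apply: eq_tmean => z w _ _.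
  by rewrite !hornerM; congr (_ * _^* * _); ring.
pose v (z w : C) := (roots_poly s1 * b).[z] + (-1) * (a * (roots_poly s1 * pout * b)).[z].
have tm1 : tok (fun z _ : C => (-1) * (a * (roots_poly s1 * pout * b)).[z]).
  by apply: tokM; [exact: tok_cst|].
have -> : G p (eval2 f) (fun z _ => (roots_poly s1 * b).[z]) = G p (eval2 f) v.
  by rewrite /v (GDr p_nz (te f) tb tm1) (GZr p_nz _ (te f) ta) Ga mulr0 addr0.
have vE z w : `|z| = 1 -> `|w| = 1 -> `|v z w| <= K * e.
  move=> z1 w1; have -> : v z w = (roots_poly s1 * pout * b).[z] * (pout.[z]^-1 - a.[z]).
    by rewrite /v !hornerM; field; rewrite pout_nz1.
  by rewrite normrM ler_pM // ?hK ?ha // z1.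
have tv : tok v by exact: tokD.
have e0' := ltW e0; have Ke : 0 <= K * e by rewrite mulr_ge0 // ltW.
have Ee : 0 <= (E + 1) * e by rewrite mulr_ge0 // addr_ge0.
rewrite -(ler_sqr _ Ee) ?nnegrE //; apply: le_trans (G_CS p_nz (te f) tv) _.
apply: le_trans (ler_wpM2l (G_ge0 p _) (G_sup Ke tv vE)) _.
have -> : G p (eval2 f) (eval2 f) * ((K * e) ^+ 2 * G p (fun _ _ => 1) (fun _ _ => 1)) = E * e ^+ 2.
  by rewrite /E; ring.
rewrite exprMn; apply: ler_wpM2r; first exact: exprn_ge0.
have E2 : 0 <= E ^+ 2 + E + 1 by rewrite !addr_ge0 // exprn_ge0.
by rewrite -subr_ge0; apply: le_trans E2 _; rewrite le_eqVlt; apply/orP; left; apply/eqP; ring.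
Qed.

End FirstSpace.
End SplitOfBS.

(** * The split given by the inner and outer zeros *)

Section BSSplit.
Variables (R : realType) (n m : nat) (T : {scalar laurent R n m}).
Hypothesis T_gt0 : positive_form T.
Local Notation C := R[i].
Local Notation H := (bipoly R n m).
Local Notation form := (dotT T_gt0).
Local Notation D := (domT T_gt0).

(** The slice w = 0 is an isomorphism from [D] onto the polynomials of degree below n, so the
    multiples of [D0] lift to a subspace; lifts of the products with powers of z span it. *)
Lemma lift_space (D0 : {poly C}) k :
  (forall q : {poly C}, (size q <= k)%N -> (size (D0 * q)%R <= n)%N) ->
  exists K : {vspace H}, [/\ (K <= D)%VS,
    forall f, f \in K -> exists2 q, pcol f 0 = D0 * q & (size q <= k)%N &
    forall q : {poly C}, (size q <= k)%N -> exists2 f, f \in K & pcol f 0 = D0 * q].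
Proof.
move=> hk; have nn : (n <= n.+1)%N by [].
have /choice[F hF] (i : 'I_k) : exists f, f \in D /\ pcol f 0 = D0 * 'X^i.
  have := lift_ex T_gt0 nn (hk 'X^i _); rewrite size_polyXn => /(_ (ltn_ord i))[f fD fE].
  by exists f.
have pcol_sum (v : 'I_k -> H) : pcol (\sum_i v i) 0 = \sum_i pcol (v i) 0.
  by elim/big_rec2: _ => [|i a b _ <-]; rewrite ?pcol0 ?pcolD.
exists (\sum_i <[F i]>)%VS; split.
- by apply/subv_sumP => i _; rewrite -memvE; have [] := hF i.
- move=> f /memv_sumP[v vE ->].
  have /choice[c hc] : forall i, exists a, v i = a *: F i.
    by move=> i; have /vlineP := vE i isT.
  exists (\sum_i c i *: 'X^i); last first.
    apply/leq_sizeP => j kj; rewrite coef_sum big1 // => i _.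
    by rewrite coefZ coefXn gtn_eqF ?mulr0 // (leq_trans _ kj).
  rewrite pcol_sum mulr_sumr; apply: eq_bigr => i _.
  by rewrite hc pcolZ; have [_ ->] := hF i; rewrite scalerAr.
move=> q qk; exists (\sum_(i < k) q`_i *: F i).
  apply: rpred_sum => i _; apply: rpredZ; apply: (subvP (sumv_sup i (erefl _) (subvv _))).
  exact: memv_line.
rewrite pcol_sum -[q in RHS](coefK q) poly_def (big_ord_widen _ (fun i => q`_i *: 'X^i) qk) mulr_sumr.
rewrite [RHS]big_mkcond /=; apply: eq_bigr => i _.
rewrite pcolZ; have [_ ->] := hF i; case: ltnP => [_|h]; first by rewrite scalerAr.
by rewrite nth_default ?scale0r.
Qed.

Lemma bs_split d : (d <= n)%N -> bernstein_szego T d -> split_shift T_gt0 d.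
Proof.
move=> dn [p [p_nz pd pm]]; have fG := form_G T_gt0 p_nz pm.
have p0z z : `|z| = 1 -> (pcol p 0).[z] != 0 by move=> z1; exact: (q0_neq0 p_nz z1).
have p0n : pcol p 0 != 0.
  by apply: contraNneq (p0z _ (normr1 _)) => ->; rewrite horner0.
move: pd; rewrite slice0E /nzeros_disk; case: (closed_field_poly_normal _) => s /= pE pd.
pose s1 := [seq r <- s | `|r| < 1]; pose s2 := [seq r <- s | ~~ (`|r| < 1)].
pose pout := lead_coef (pcol p 0) *: roots_poly s2.
have ss1 : size s1 = d by rewrite size_filter.
have p0E : pcol p 0 = roots_poly s1 * pout.
  rewrite {1}pE /pout -scalerAr; congr (_ *: _).
  by rewrite /roots_poly !big_filter [LHS](bigID (fun r => `|r| < 1)).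
have s1l r : r \in s1 -> `|r| < 1 by rewrite mem_filter => /andP[].
have poz z : `|z| <= 1 -> pout.[z] != 0.
  move=> z1; rewrite /pout hornerZ mulf_neq0 ?lead_coef_eq0 //.
  rewrite /roots_poly horner_prod prodf_seq_neq0; apply/allP => r rs /=.
  rewrite hornerXsubC subr_eq0; apply/eqP => zr; subst r.
  have z1' : `|z| = 1.
    move: rs; rewrite mem_filter lt_neqAle z1 andbT negbK => /andP[/eqP e _]; exact: e.
  have := p0z z z1'; rewrite pE hornerZ mulf_eq0 negb_or => /andP[_].
  have zs : z \in s by move: rs; rewrite mem_filter => /andP[].
  by rewrite horner_prod prodf_seq_neq0 => /allP /(_ z zs) /=; rewrite hornerXsubC subrr eqxx.
have pon : pout != 0.
  by apply: contraNneq (poz 0 _) => [->|]; rewrite ?horner0 // normr0 ler01.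
have pin0 : roots_poly s1 != 0 by rewrite -size_poly_gt0 size_roots_poly.
have szp : (size (roots_poly s1) + size pout <= n.+2)%N.
  have : (size (pcol p 0) <= n.+1)%N by rewrite size_poly.
  by rewrite p0E size_mul // size_roots_poly addSn.
have szo : (size pout <= (n - d).+1)%N by move: szp; rewrite size_roots_poly ss1; lia.
have [|K1 [K1D K1q K1f]] := @lift_space pout d.
  move=> q qd; apply: leq_trans (size_polyMleq _ _) _; move: szo qd dn; lia.
have [|K2 [K2D K2q K2f]] := @lift_space (roots_poly s1) (n - d).
  by move=> q qd; apply: leq_trans (size_polyMleq _ _) _; rewrite size_roots_poly ss1; move: qd dn; lia.
have orth f g b : f \in K1 -> pcol g 0 = roots_poly s1 * b -> form f g = 0.
  move=> fK gE; have [q fE qd] := K1q f fK.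
  apply: (K12_orth p_nz fG p0E s1l poz (subvP K1D _ fK) fE _ gE).
  by rewrite ss1.
have k12 f g : f \in K1 -> g \in K2 -> form f g = 0.
  by move=> fK gK; have [q gE _] := K2q g gK; exact: orth fK gE.
have nn : (n <= n.+1)%N by [].
have Dinj f : f \in D -> pcol f 0 = 0 -> f = 0 by exact: E1_inj.
have dK1 : \dim K1 = d.
  apply/eqP; rewrite eqn_leq; apply/andP; split; last exact: (dim_ge_div pon).
  apply: (dim_le_div _ pon) => // f fK; apply: Dinj; exact: (subvP K1D).
exists K1, K2; split => //.
(* The dimensions d and at least n - d add up, and orthogonality makes the sum direct, so it
   exhausts the domain. *)
- split; last by apply/orthS.
  apply/eqP; rewrite eq_sym eqEdim subv_add K1D K2D /=.
  rewrite dimv_disjoint_sum.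
    rewrite (dim_D T_gt0) dK1 -leq_subLR; exact: (dim_ge_div pin0).
  apply/eqP; rewrite -subv0; apply/subvP => x; rewrite memv_cap => /andP[x1 x2].
  by rewrite memv0; apply/eqP/(dot_eq0 (form := form))/k12.
- apply/orthS => f g fK /memv_imgP[x xK ->]; have [q xE _] := K2q x xK.
  (* The slice of z x is again a multiple of p_in. *)
  apply: (orth _ _ ('X * q) fK); rewrite pcol_Mz ?xE; first by rewrite mulrCA.
  by apply/PQ; have /memD[] := subvP K2D _ xK.
- apply/subvP => f fK; have [q fE qd] := K1q f fK.
  by apply: (K1_E p_nz fG p0E s1l poz (subvP K1D _ fK) fE); rewrite ss1.
apply/subvP => _ /memv_imgP[x xK ->]; have [q xE _] := K2q x xK.
exact: (K2_shift p_nz fG p0E s1l poz (subvP K2D _ xK) xE).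
Qed.
End BSSplit.

Theorem corollary2p6 (R : realType) (n m : nat) (T : {scalar laurent R n m})
    (T_gt0 : positive_form T) (d : nat) (d_le_n : (d <= n)%N) :
  [<-> bernstein_szego T d;
       split_shift T_gt0 d;
       matrix_condition T_gt0 d].
Proof.
tfae; [exact: bs_split|exact: split_matrix|].
by move=> /matrix_split; exact: split_bs.
Qed.
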